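(* In each of the two categories of unframed long virtual knots and framed long virtual knots, the glueing invariant $$G(K)=\begin{cases}\sum_d \mathrm{sgn}(d)\bigl([K^d_{glue}]-[K^0_{sing}]\bigr)&\text{in the unframed case}\\ \sum_d \mathrm{sgn}(d)\,[K^d_{glue}]&\text{in the framed case}\end{cases}$$ is an invariant of long virtual knots of that category, is a Vassiliev invariant of order one, and is the universal Vassiliev invariant of order one, in the following sense: for every Vassiliev invariant $V$ of order $\le1$ of long virtual knots of that category with values in an abelian group, and every pair of homotopic long virtual knots $K,K_0$ of that category, $\tfrac12\bigl(G(K)-G(K_0)\bigr)$ is a well-defined element of the free abelian group in which $G$ takes values, and $$V(K)=V(K_0)+V^{(1)}\Bigl(\tfrac12\bigl(G(K)-G(K_0)\bigr)\Bigr).$$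
   Context: A long virtual knot diagram is an immersion $\mathbb{R}\to\mathbb{R}^2$ which coincides with the $x$-axis outside some closed ball centered at the origin and whose double points are decorated either as classical crossings (with over/under information, hence a sign $\pm1$) or as virtual crossings. Long virtual knots (the unframed category) are diagrams modulo the classical Reidemeister moves 1, 2, 3, the purely virtual Reidemeister moves 1, 2, 3, and the mixed move (sliding an arc carrying only virtual crossings past a classical crossing). Framed long virtual knots are defined in the same way, except that classical Reidemeister move 1 is replaced by the framed Reidemeister move 1, which inserts or removes on an arc two consecutive kinks whose classical crossings have opposite signs. Two (framed) long virtual knots are homotopic if they are related by the moves of the category together with crossing changes (CC) at classical crossings. A singular long virtual knot may also have finitely many transverse double points. Singular knots are taken modulo the moves of the category (the classical Reidemeister moves 2, 3, the purely virtual Reidemeister moves 1, 2, 3, the mixed move, and either the classical Reidemeister move 1 in the unframed category or the framed Reidemeister move 1 in the framed category) and rigid vertex isotopy: an arc may be slid over, under, or virtually across a double point, and a double point followed by a classical crossing of the same two strands may be replaced by that classical crossing followed by the double point. The flat equivalence class of a singular knot is its class when crossing changes at classical crossings are also allowed (double points are kept). A knot invariant $\nu$ with values in an abelian group is extended to singular knots by $\nu(K_\bullet)=\nu(K_+)-\nu(K_-)$, where $K_\pm$ replace a double point by a positive/negative crossing. It is a Vassiliev (finite-type) invariant of order $\le n$ if it vanishes on all knots with more than $n$ double points; it has order one if it has order $\le1$ but is not of order $\le0$. If $V$ has order $\le1$, its extension $V^{(1)}$ to knots with exactly one double point depends only on the flat equivalence class of the singular knot; $V^{(1)}$ is extended linearly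 to the free abelian group on these classes. For a long virtual knot diagram $K$ and a classical crossing $d$, $[K^d_{glue}]$ is the flat equivalence class (in the category considered) of the singular long knot obtained by replacing $d$ by a double point. $[K^0_{sing}]$ is the flat equivalence class of the singular long knot obtained from $K$ by introducing a kink by a Reidemeister 1 move and replacing the new crossing by a double point (the class does not depend on where the kink is introduced). Sums are over all classical crossings $d$ of $K$, and $G(K)$ lies in the free abelian group generated by flat equivalence classes of singular long virtual knots of that category with exactly one double point. *)

(* Defs.v *)
From HB Require Import structures.
From mathcomp Require Import all_boot all_order all_algebra.
From mathcomp Require Import freeg.
From mathcomp Require Import boolp.
From Stdlib Require Import Relations.Relation_Operators.
Set Implicit Arguments.
Unset Strict Implicit.
Unset Printing Implicit Defensive.

(* A plane diagram of a long curve is recorded, up to isotopy of the plane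
   fixing the two ends, by its decorated oriented Gauss code: the sequence of
   passages through double points met while travelling along the curve from
   -oo to +oo.

   A passage ((c, d), k) consists of the name c of the double point, a bit d
   telling whether the curve crosses there the other branch from the left of
   that branch to its right (d = true) or from right to left (d = false), and
   the decoration k of the double point. *)
Inductive kind := Classical of bool | Virtual | Double.

Definition kind_code (k : kind) : option (option bool) :=
  match k with
  | Classical e => Some (Some e)
  | Virtual => Some None
  | Double => None
  end.
Definition kind_decode (o : option (option bool)) : kind :=
  match o with
  | Some (Some e) => Classical e
  | Some None => Virtual
  | None => Double
  end.
Lemma kind_codeK : cancel kind_code kind_decode. Proof. by case. Qed.
HB.instance Definition _ := Countable.copy kind (can_type kind_codeK).

Definition is_classical (k : kind) : bool :=
  if k is Classical _ then true else false.

Definition code := seq (nat * bool * kind).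

Definition shadow (w : code) : seq (nat * bool) := [seq l.1 | l <- w].

Definition wf (w : code) : bool :=
  uniq (shadow w) && all (fun l => ((l.1.1, ~~ l.1.2), l.2) \in w) w.

(* Cut the curve at its m passages into the edges 0, ..., m; edge i precedes
   passage i. The point (i, true) (resp. (i, false)) stands for the left (resp.
   right) side of edge i. If passage i crosses the branch of passage j from left
   to right, the four corners at the crossing join the following sides. *)
Definition corners (i j : nat) : seq ((nat * bool) * (nat * bool)) :=
  [:: ((i, true), (j.+1, true)); ((i.+1, true), (j.+1, false));
      ((i.+1, false), (j, false)); ((i, false), (j, true))].

Definition all_corners (s : seq (nat * bool)) :=
  flatten [seq corners (index (l.1, true) s) (index (l.1, false) s)
          | l <- s & l.2].

(* The two ends of the curve are joined at the point at infinity. *)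
Definition face_joins (s : seq (nat * bool)) :=
  [:: ((0, true), (size s, true)); ((0, false), (size s, false))]
    ++ all_corners s.

Definition side (m : nat) : finType := ('I_m.+1 * bool)%type.
Definition side_val m (x : side m) : nat * bool := (val x.1, x.2).

Definition same_face (s : seq (nat * bool)) : rel (side (size s)) :=
  fun x y => ((side_val x, side_val y) \in face_joins s)
          || ((side_val y, side_val x) \in face_joins s).

Definition nfaces (s : seq (nat * bool)) : nat :=
  n_comp (@same_face s) predT.

(* Euler's formula V + F = E + 2 on the sphere; the vertices are the double
   points and the point at infinity. *)
Definition planar (s : seq (nat * bool)) : bool :=
  ((size s)./2.+1 + nfaces s == (size s).+1 + 2)%N.

Definition ndouble (w : code) : nat :=
  count (fun l => l.1.2 && (l.2 == Double)) w.

Definition valid (n : nat) (w : code) : bool :=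
  [&& wf w, planar (shadow w) & ndouble w == n].

(* Diagrams with exactly n (rigid) double points, besides their classical and
   virtual crossings; diagram 0 is the type of long virtual knot diagrams. *)
Record diagram (n : nat) := Diagram {
  code_of :> code;
  code_valid : valid n code_of
}.
HB.instance Definition _ n := [isSub for @code_of n].
HB.instance Definition _ n := [Choice of diagram n by <:].

Definition set_kind (c : nat) (k : kind) (w : code) : code :=
  [seq (if l.1.1 == c then (l.1, k) else l) | l <- w].

Definition kink (c : nat) (d : bool) (k : kind) : code :=
  [:: ((c, d), k); ((c, ~~ d), k)].

Definition fresh (w : code) : nat := (\max_(l <- w) l.1.1).+1.

Definition insert_kink (p : nat) (d : bool) (w : code) : code :=
  take p w ++ kink (fresh w) d Double ++ drop p w.

Lemma shadow_set_kind c k w : shadow (set_kind c k w) = shadow w.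
Proof. by rewrite /shadow -map_comp; apply: eq_map => l /=; case: ifP. Qed.

Lemma wf_set_kind c k w : wf w -> wf (set_kind c k w).
Proof.
case/andP=> uw /allP cw; apply/andP; split; first by rewrite shadow_set_kind.
apply/allP=> _ /mapP[l lw ->]; apply/mapP.
exists ((l.1.1, ~~ l.1.2), l.2); first exact: cw.
by rewrite /=; case: ifP.
Qed.

Lemma set_kind_id c d k w : wf w -> ((c, d), k) \in w -> set_kind c k w = w.
Proof.
case/andP=> uw /allP cw ckw.
have inj l l' : l \in w -> l' \in w -> l.1 = l'.1 -> l = l'.
  move=> lw lw'; elim: w uw {cw ckw} lw lw' => //= a w IH /andP[aw uw].
  rewrite !inE => /predU1P[->|lw] /predU1P[->|lw'] // eql; last exact: IH.
    by case/negP: aw; rewrite eql map_f.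
  by case/negP: aw; rewrite -eql map_f.
rewrite -[RHS]map_id; apply/eq_in_map => -[[c' d'] k'] lw /=.
case: eqP => // ec; rewrite -{}ec in ckw *.
case: (eqVneq d' d) => [ed|ned]; first by rewrite ed in lw *; exact: inj.
have ed : d' = ~~ d by case: d d' ned {lw ckw} => -[].
by apply: (inj (c', d', k) (c', d', k')) => //; rewrite ed; apply: cw ckw.
Qed.

Lemma ndouble_set_kind c d k0 k w : wf w -> ((c, d), k0) \in w ->
  (ndouble (set_kind c k w) + (k0 == Double) =
   ndouble w + (k == Double))%N.
Proof.
move=> wfw ckw.
pose N := count (fun l => [&& l.1.1 != c, l.1.2 & l.2 == Double]) w.
have E k' : ndouble (set_kind c k' w) = (N + (k' == Double))%N.
  have e1 : count (fun l => l.1 == (c, true)) w = 1%N.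
    rewrite -(count_map fst (pred1 (c, true))).
    case/andP: (wfw) => uw cw; rewrite (count_uniq_mem _ uw).
    suff -> : (c, true) \in shadow w by [].
    case: d ckw => ckw; first exact: (map_f fst ckw).
    exact: (map_f fst (allP cw _ ckw)).
  rewrite /ndouble /set_kind count_map /N.
  case ek : (k' == Double).
    rewrite -[nat_of_bool true]/1%N -[in RHS]e1 -count_predUI.
    have e0 a : a =1 pred0 -> count a w = 0%N by move/eq_count->; apply: count_pred0.
    rewrite [X in (_ + X)%N]e0 ?addn0; last first.
      by move=> [[c' d'] k'']; rewrite /= xpair_eqE; case: (c' == c); rewrite ?andbF.
    apply: eq_count => -[[c' d'] k''] /=.
    by rewrite xpair_eqE; case: eqP => //= _; rewrite ?ek ?andbT ?eqb_id ?orbF.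
  rewrite addn0; apply: eq_count => -[[c' d'] k''] /=.
  by case: eqP => //= _; rewrite ek andbF.
by rewrite -{2}(set_kind_id wfw ckw) !E addnAC.
Qed.

Lemma same_face_sym t : connect_sym (@same_face t).
Proof. by apply: sym_connect_sym => x y; rewrite /same_face orbC. Qed.

Section KinkPlanar.
Variables (c : nat) (d : bool) (u v : seq (nat * bool)).
Let s := u ++ v.
Let s' := u ++ [:: (c, d); (c, ~~ d)] ++ v.
Let p := size u.
Hypothesis fc : forall b, (c, b) \notin s.
Hypothesis cl : forall l, l \in s -> (l.1, ~~ l.2) \in s.

Let sz : size s' = (size s).+2.
Proof. by rewrite !size_cat /= !addnS. Qed.

Let sh i := if i < p then i else i.+2.

Let index_old l : l \in s -> index l s' = sh (index l s).
Proof.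
move=> ls; rewrite /s' /s /sh /p !index_cat.
have [lu|lu] := boolP (l \in u); first by rewrite index_mem lu.
rewrite ltnNge leq_addr /=.
have ne b : ((c, b) == l) = false by apply: contraTF ls => /eqP<-; apply: fc.
by rewrite /= !inE ![l == _]eq_sym !ne /= !addSn !addnS.
Qed.

Let index_new b : index (c, b) s' = (p + (b != d))%N.
Proof.
have cu : (c, b) \notin u.
  by have := fc b; rewrite mem_cat negb_or => /andP[].
rewrite /s' index_cat (negPf cu) /= !xpair_eqE eqxx /=.
by case: d b {cu} => -[].
Qed.

Let mem_corners_old l : l \in s -> l.2 ->
  {subset corners (index (l.1, true) s) (index (l.1, false) s)
   <= all_corners s}.
Proof.
move=> ls lt x xc; apply/flatten_mapP; exists l => //.
by rewrite mem_filter lt.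
Qed.

Let cornersP' x : x \in all_corners s' ->
  x \in corners (p + ~~ d) (p + d) \/
  exists2 l, l \in s & [/\ l.2, (l.1, true) \in s, (l.1, false) \in s
    & x \in corners (sh (index (l.1, true) s)) (sh (index (l.1, false) s))].
Proof.
case/flatten_mapP=> l; rewrite mem_filter => /andP[lt ls'] xl.
have [e|ne] := eqVneq l.1 c.
  by left; rewrite e !index_new in xl; case: d xl.
have ls : l \in s.
  move: ls'; rewrite !mem_cat !inE -orbA => /or4P[->|/eqP e|/eqP e|->] //.
  - by rewrite e eqxx in ne.
  - by rewrite e eqxx in ne.
  - by rewrite orbT.
have lT : (l.1, true) \in s by rewrite -lt -surjective_pairing.
have lF : (l.1, false) \in s by have := cl lT.
right; exists l => //; split=> //.
by rewrite -!index_old.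
Qed.

Let sub_new : {subset corners (p + ~~ d) (p + d) <= all_corners s'}.
Proof.
move=> x xc; apply/flatten_mapP; exists (c, true).
  by rewrite mem_filter /= !mem_cat !inE !xpair_eqE eqxx; case: d; rewrite ?orbT.
by rewrite !index_new /=; case: d xc.
Qed.

Let sub_old l : l \in s -> l.2 ->
  {subset corners (sh (index (l.1, true) s)) (sh (index (l.1, false) s))
   <= all_corners s'}.
Proof.
move=> ls lt x xc; have lT : (l.1, true) \in s by rewrite -lt -surjective_pairing.
have lF : (l.1, false) \in s by have := cl lT.
rewrite -!index_old // in xc; apply/flatten_mapP; exists l => //.
by rewrite mem_filter lt !mem_cat; move: ls; rewrite mem_cat => /orP[]->;
   rewrite ?orbT.
Qed.

Let hN (i : nat) := if i <= p then i else i.+2.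
Let rN (x : nat * bool) : nat * bool :=
  if x.1 <= p then x else
  if x.1 == p.+1 then (p, ~~ d) else (x.1.-2, x.2).

Let ltps : p <= size s. Proof. by rewrite size_cat leq_addr. Qed.

Let h (x : side (size s)) : side (size s') := (inord (hN x.1), x.2).
Let r (x : side (size s')) : side (size s) :=
  (inord (rN (side_val x)).1, (rN (side_val x)).2).

Let hv x : side_val (h x) = (hN x.1, x.2).
Proof.
rewrite /side_val /h /= inordK // /hN sz; have := ltn_ord x.1.
by case: ifP => _ lt //; apply: leq_trans lt (leq_trans (leqnSn _) (leqnSn _)).
Qed.

Let rv x : side_val (r x) = rN (side_val x).
Proof.
rewrite /side_val /r /= inordK -?surjective_pairing // /rN /=.
case: x => -[i lti] b /=; case: (leqP i p) => [le|lt] /=; first exact: leq_trans le ltps.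
case: eqP => _ /=; first by rewrite ltnS.
by rewrite sz in lti; case: i lti {lt} => [|[]].
Qed.

Let rh x : r (h x) = x.
Proof.
have inj : injective (@side_val (size s)).
  by move=> [i b] [j b'] [/val_inj -> ->].
apply: inj; rewrite rv hv /rN /hN /=; case: x => i b /=.
case: (leqP i p) => [->|lt] //=; rewrite leqNgt ltnS (ltnW (ltnW _)) //=.
by rewrite eqSS gtn_eqF //= ltnS ltnW.
Qed.

Let mono : side (size s') := (inord p.+1, ~~ d).
Let monov : side_val mono = (p.+1, ~~ d).
Proof. by rewrite /side_val /= inordK // sz !ltnS ltnW. Qed.

Let mk m (a : nat * bool) : side m := (inord a.1, a.2).
Let mkK m (x : side m) : mk m (side_val x) = x.
Proof. by case: x => i b; rewrite /mk /= inord_val. Qed.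

Let conn t (a b : nat * bool) :=
  connect (@same_face t) (mk (size t) a) (mk (size t) b).

Let conn_sym t a b : conn t a b = conn t b a.
Proof. exact: same_face_sym. Qed.

Let conn_trans t b a x : conn t a b -> conn t b x -> conn t a x.
Proof. exact: connect_trans. Qed.

Let step t a b : a.1 <= size t -> b.1 <= size t ->
  (a, b) \in face_joins t -> conn t a b.
Proof.
move=> la lb j; apply: connect1.
by rewrite /same_face /side_val /= !inordK // -!surjective_pairing j.
Qed.

Let joins_new a b : (a, b) \in corners (p + ~~ d) (p + d) ->
  (a, b) \in face_joins s'.
Proof. by move/sub_new => ab; rewrite mem_cat ab orbT. Qed.

Let rng_p i : i <= p.+2 -> i <= size s'.
Proof. by move=> ip; rewrite sz (leq_trans ip) // !ltnS. Qed.

Let conn_p b : conn s' (p, b) (p.+2, b).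
Proof.
have J x y i j : i <= p.+2 -> j <= p.+2 ->
    ((i, x), (j, y)) \in corners (p + ~~ d) (p + d) -> conn s' (i, x) (j, y).
  by move=> li lj k; apply: step (joins_new k); apply: rng_p.
have l0 : p <= p.+2 by rewrite -addn2 leq_addr.
have l1 : p.+1 <= p.+2 by [].
have l2 : p.+2 <= p.+2 by [].
move: J; rewrite /corners; case: d => /=; rewrite addn0 addn1 => J; case: b.
- by apply: J; rewrite ?inE ?eqxx.
- apply: (@conn_trans _ (p.+1, true)); first by apply: J; rewrite ?inE ?eqxx ?orbT.
  by apply: J; rewrite ?inE ?eqxx ?orbT.
- apply: (@conn_trans _ (p.+1, false)); rewrite conn_sym; apply: J;
  by rewrite ?inE ?eqxx ?orbT.
- by rewrite conn_sym; apply: J; rewrite ?inE ?eqxx ?orbT.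
Qed.

Let hE a : a.1 <= size s -> h (mk (size s) a) = mk (size s') (hN a.1, a.2).
Proof. by move=> la; rewrite /h /mk /= inordK. Qed.

Let shS i : (sh i).+1 = hN i.+1.
Proof. by rewrite /sh /hN; case: ltnP. Qed.

Let sh_h i b : conn s' (hN i, b) (sh i, b).
Proof.
rewrite /sh /hN; case: (ltngtP i p) => [_|_|->]; first exact: connect0.
  exact: connect0.
exact: conn_p.
Qed.

Let sh_le i : i < size s -> sh i < size s'.
Proof.
rewrite sz /sh; case: ifP => _ lt //.
by apply: leq_trans lt (leq_trans (leqnSn _) (leqnSn _)).
Qed.

Let joins_old a b : (a, b) \in face_joins s ->
  conn s' (hN a.1, a.2) (hN b.1, b.2).
Proof.
have end_conn x : conn s' (hN 0, x) (hN (size s), x).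
  have c0 : conn s' (0, x) ((size s).+2, x).
    apply: step => //=; first by rewrite sz.
    by rewrite /face_joins sz; case: x; rewrite mem_cat !inE eqxx ?orbT.
  rewrite {1}/hN leq0n /hN; move: c0; have := ltps; rewrite leq_eqVlt.
  case/predU1P=> [<- c0|lt]; last by rewrite leqNgt lt.
  rewrite leqnn; apply: conn_trans c0 _; rewrite conn_sym.
  exact: conn_p.
rewrite mem_cat !inE => /orP[/orP[]/eqP[-> ->] //|].
case/flatten_mapP=> l; rewrite mem_filter => /andP[lt ls].
have lT : (l.1, true) \in s by rewrite -lt -surjective_pairing.
have lF : (l.1, false) \in s by have := cl lT.
have := sub_old ls lt; rewrite -!index_mem in lT lF.
move: (index (_, true) s) (index (_, false) s) lT lF => i j li lj sub.
have Q x y : (x, y) \in corners (sh i) (sh j) -> conn s' x y.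
  move=> xy; apply: step; last by rewrite mem_cat sub ?orbT.
    by move: xy; rewrite !inE => /or4P[]/eqP[-> _] /=; (exact: sh_le || exact: ltnW (sh_le _)).
  by move: xy; rewrite !inE => /or4P[]/eqP[_ ->] /=; (exact: sh_le || exact: ltnW (sh_le _)).
rewrite !inE => /or4P[]/eqP[-> ->] /=; rewrite -?shS.
- by apply: conn_trans (sh_h _ _) _; apply: Q; rewrite !inE eqxx.
- by apply: Q; rewrite !inE eqxx ?orbT.
- rewrite conn_sym; apply: conn_trans (sh_h _ _) _; rewrite conn_sym.
  by apply: Q; rewrite !inE eqxx ?orbT.
- apply: conn_trans (sh_h _ _) _; rewrite conn_sym; apply: conn_trans (sh_h _ _) _.
  by rewrite conn_sym; apply: Q; rewrite !inE eqxx ?orbT.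
Qed.

Let rN_sh i b : rN (sh i, b) = (i, b).
Proof.
rewrite /rN /sh /=; case: (ltnP i p) => [lt|le]; first by rewrite ltnW.
by rewrite leqNgt ltnS (leq_trans le) //= eqSS gtn_eqF // ltnS.
Qed.

Let rN_shS i b : rN ((sh i).+1, b) = (i.+1, b).
Proof.
rewrite /rN /sh /=; case: (ltnP i p) => [->|le] //=.
have lt : p < i.+2 := leq_trans le (leqnSn i).
by rewrite ltnNge (ltnW lt) /= eqSS (gtn_eqF lt).
Qed.

Let rN_p b : rN (p, b) = (p, b). Proof. by rewrite /rN leqnn. Qed.
Let rN_p1 b : rN (p.+1, b) = (p, ~~ d).
Proof. by rewrite /rN /= ltnn eqxx. Qed.
Let rN_p2 b : rN (p.+2, b) = (p, b).
Proof. by rewrite /rN /= leqNgt ltnS leqnSn eqSS gtn_eqF. Qed.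


Let joins_r a b : (a, b) \in face_joins s' ->
  (a == (p.+1, ~~ d)) = (b == (p.+1, ~~ d)) /\
  (rN a = rN b \/ (rN a, rN b) \in face_joins s).
Proof.
have ne i b' : i != p.+1 -> ((i, b') == (p.+1, ~~ d)) = false.
  by rewrite xpair_eqE => /negPf ->.
rewrite mem_cat => /orP[e|].
  have {}e : ((a, b) == ((0, true), (size s', true)))
    || ((a, b) == ((0, false), (size s', false))) by rewrite !inE in e.
  have e0 x : rN (0, x) = (0, x) by [].
  have e1 x : rN (size s', x) = (size s, x).
    have lt : p < (size s).+1 := ltps.
    by rewrite sz /rN /= ltnNge (ltnW lt) /= eqSS (gtn_eqF lt).
  have n1 : size s' != p.+1 by rewrite sz eqSS gtn_eqF // ltnS ltps.
  case/orP: e => /eqP[-> ->]; rewrite !ne ?e0 ?e1 //; split=> //; right;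
  by rewrite mem_cat !inE eqxx ?orbT.
case/cornersP' => [|[l ls [lt lT lF]]].
  have n0 : p != p.+1 by rewrite ltn_eqF.
  have n2 : p.+2 != p.+1 by rewrite gtn_eqF.
  case ed: d => /=; rewrite addn0 addn1 !inE => /or4P[]/eqP[-> ->];
  split; rewrite ?rN_p ?rN_p1 ?rN_p2 ?ed ?xpair_eqE ?(negPf n0) ?(negPf n2)
    ?eqxx //; by left.
have m0 i : sh i != p.+1.
  rewrite /sh; case: ltnP => [ip|pi]; last by rewrite eqSS gtn_eqF.
  by rewrite ltn_eqF // ltnS ltnW.
have m1 i : (sh i).+1 != p.+1.
  rewrite /sh eqSS; case: ltnP => [ip|pi]; first by rewrite ltn_eqF.
  by rewrite (gtn_eqF (leq_trans pi (leqnSn i) : p < i.+2)).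
move=> k; have := mem_corners_old ls lt.
move: (index (_, true) s) (index (_, false) s) k => i j k sub.
have J : {subset corners i j <= face_joins s}.
  by move=> x /sub xs; rewrite mem_cat xs orbT.
rewrite !inE in k; case/or4P: k => /eqP[-> ->];
rewrite ?rN_sh ?rN_shS !ne //; split=> //; right; apply: J;
by rewrite !inE eqxx ?orbT.
Qed.

Let cl_mono : closed (@same_face s') (pred1 mono).
Proof.
have E (x : side (size s')) : (x == mono) = (side_val x == (p.+1, ~~ d)).
  apply/eqP/eqP => [->|e]; first exact: monov.
  by rewrite -[x]mkK e.
by move=> x y; rewrite /same_face !inE !E => /orP[]/joins_r[].
Qed.

Let connect_r x y :
  connect (@same_face s') x y -> connect (@same_face s) (r x) (r y).
Proof.
case/connectP=> q + ->; elim: q x => //= z q IH x /andP[xz /IH].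
apply: connect_trans.
have inj : injective (@side_val (size s)).
  by move=> [i b] [j b'] [/val_inj -> ->].
have Q a b : rN (side_val a) = rN (side_val b) \/
    (rN (side_val a), rN (side_val b)) \in face_joins s ->
  connect (@same_face s) (r a) (r b).
  rewrite -!rv => -[/inj -> //|j].
  by apply: connect1; rewrite /same_face j.
case/orP: xz => /joins_r[_ /Q] //.
by rewrite same_face_sym.
Qed.

Let connect_h x y :
  connect (@same_face s) x y -> connect (@same_face s') (h x) (h y).
Proof.
case/connectP=> q + ->; elim: q x => //= z q IH x /andP[xz /IH].
apply: connect_trans.
have Q a b : (side_val a, side_val b) \in face_joins s ->
  connect (@same_face s') (h a) (h b).
  by move/joins_old; rewrite -(hv a) -(hv b) /conn !mkK.
by case/orP: xz => /Q //; rewrite same_face_sym.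
Qed.

Let connect_hr x : x != mono -> connect (@same_face s') x (h (r x)).
Proof.
move=> nx; rewrite -[X in connect _ X](mkK x) -[X in connect _ _ X]mkK.
rewrite (hv (r x) : _ = (hN (side_val (r x)).1, (side_val (r x)).2)) rv.
rewrite -/(conn s' _ _); move: nx.
have -> : (x == mono) = (side_val x == (p.+1, ~~ d)).
  by apply/eqP/eqP => [->|e]; [exact: monov|rewrite -[x]mkK e].
case: (side_val x) => i b; rewrite /rN /hN /=.
case: (leqP i p) => [le|lt /=]; first by rewrite /= le => _; apply: connect0.
case: (i =P p.+1) => [->|ne _] /=.
  rewrite xpair_eqE eqxx /= leqnn => nb.
  have {nb}-> : b = d by case: b d nb => -[].
  have l0 : p <= p.+2 := leq_trans (leqnSn p) (leqnSn p.+1).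
  have l1 : p.+1 <= p.+2 := leqnSn p.+1.
  have J x1 y1 : ((p.+1, x1), (p, y1)) \in corners (p + ~~ d) (p + d) ->
      conn s' (p.+1, x1) (p, y1).
    by move=> k; apply: step; [exact: rng_p|exact: rng_p|exact: joins_new].
  have J' x1 y1 : ((p, y1), (p.+1, x1)) \in corners (p + ~~ d) (p + d) ->
      conn s' (p.+1, x1) (p, y1).
    move=> k; rewrite conn_sym.
    by apply: step; [exact: rng_p|exact: rng_p|exact: joins_new].
  move: J J'; case: d => /=; rewrite addn0 addn1 => J J'.
    by apply: J'; rewrite !inE eqxx ?orbT.
  by apply: J; rewrite !inE eqxx ?orbT.
case: i lt ne => [|[|i]] //= lt ne.
  by move: lt; rewrite ltnS leqn0 => /eqP e; case: ne; rewrite e.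
case: (leqP i p) => [le|_]; last exact: connect0.
have -> : i = p.
  apply/eqP; rewrite eqn_leq le; move: lt; rewrite ltnS leq_eqVlt ltnS.
  by case/predU1P => // e; case: ne; rewrite e.
by rewrite conn_sym; apply: conn_p.
Qed.

Lemma nfaces_kink : nfaces s' = (nfaces s).+1.
Proof.
have cm x : connect (@same_face s') mono x = (x == mono).
  apply/idP/eqP => [/(closed_connect cl_mono)|->]; last exact: connect0.
  by rewrite !inE eqxx => /esym/eqP.
have hm x : h x != mono.
  apply/eqP => /(congr1 (@side_val _)); rewrite hv monov /hN => -[+ _].
  case: leqP => [le e|lt [e]]; first by rewrite e ltnn in le.
  by rewrite -e ltnNge leqnSn in lt.
rewrite /nfaces (n_compC (connect (@same_face s') mono)) n_comp_connect;
  last exact: same_face_sym.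
rewrite add1n; congr _.+1.
rewrite (adjunction_n_comp h (@same_face_sym _) (@same_face_sym s)).
- by apply: eq_n_comp_r => x; rewrite !inE cm hm.
- by apply: predC_closed; apply: connect_closed; apply: same_face_sym.
split=> [x|x y _].
  by rewrite !inE cm => nx; exists (r x); apply: connect_hr.
apply/idP/idP; first exact: connect_h.
by move/connect_r; rewrite !rh.
Qed.
End KinkPlanar.

Lemma planar_kink c d u v :
    (forall b, (c, b) \notin u ++ v) ->
    (forall l, l \in u ++ v -> (l.1, ~~ l.2) \in u ++ v) ->
  planar (u ++ [:: (c, d); (c, ~~ d)] ++ v) = planar (u ++ v).
Proof.
move=> fc cl; rewrite /planar nfaces_kink //.
have -> : size (u ++ [:: (c, d); (c, ~~ d)] ++ v) = (size (u ++ v)).+2.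
  by rewrite !size_cat /= !addnS.
by rewrite /= addSn addnS !addSn !eqSS.
Qed.

Lemma fresh_notin w b : (fresh w, b) \notin shadow w.
Proof.
apply/mapP=> -[l lw e]; have := @leq_bigmax_seq _ w xpredT (fun l => l.1.1) l lw isT.
by rewrite -e /= /fresh ltnn.
Qed.

Lemma valid_insert_kink n p d w :
  valid n w -> valid n.+1 (insert_kink p d w).
Proof.
case/and3P=> wfw pw nw; have /andP[uw /allP cw] := wfw.
have shE : shadow (insert_kink p d w) = take p (shadow w)
    ++ [:: (fresh w, d); (fresh w, ~~ d)] ++ drop p (shadow w).
  by rewrite /shadow /insert_kink !map_cat map_take map_drop.
have pE : perm_eq (insert_kink p d w) (kink (fresh w) d Double ++ w).
  by rewrite /insert_kink perm_catCA perm_cat2l cat_take_drop.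
apply/and3P; split.
- apply/andP; split.
    rewrite (perm_uniq (perm_map fst pE)) /= !inE xpair_eqE eqxx.
    by rewrite -![_ \in map _ _]/(_ \in shadow w) !(negPf (fresh_notin w _)) uw;
       case: d {shE pE}.
  apply/allP=> l; rewrite !(perm_mem pE) !mem_cat => /orP[|/cw->].
    by rewrite !inE => /orP[]/eqP-> /=; rewrite ?negbK eqxx ?orbT.
  by rewrite orbT.
- rewrite shE planar_kink cat_take_drop //; first exact: fresh_notin.
  by move=> _ /mapP[l lw ->]; apply/mapP; exists ((l.1.1, ~~ l.1.2), l.2);
     first exact: cw.
- rewrite /ndouble (permP pE) count_cat -/(ndouble w) (eqP nw) /=.
  by case: d {shE pE}.
Qed.

Definition double_points (w : code) : seq nat :=
  [seq l.1.1 | l <- w & l.1.2 && (l.2 == Double)].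

Definition classical_crossings (w : code) : seq nat :=
  [seq l.1.1 | l <- w & l.1.2 && is_classical l.2].

Lemma valid_glue n c w : valid n w -> c \in classical_crossings w ->
  valid n.+1 (set_kind c Double w).
Proof.
case/and3P=> wfw pw nw /mapP[[[c' d] k]]; rewrite mem_filter /=.
case/andP=> /andP[_ kc] lw e; rewrite -{}e in lw *.
rewrite /valid wf_set_kind // shadow_set_kind pw /=.
have := ndouble_set_kind Double wfw lw; rewrite (eqP nw).
by case: k kc {lw} => //= e _; rewrite addn0 addn1 => ->.
Qed.

Lemma valid_resolve n e w : valid n.+1 w ->
  valid n (set_kind (head 0 (double_points w)) (Classical e) w).
Proof.
case/and3P=> wfw pw nw.
rewrite /valid wf_set_kind // shadow_set_kind pw /=.
set c := head _ _; have : c \in double_points w.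
  have : size (double_points w) = n.+1 by rewrite size_map size_filter; exact/eqP.
  by rewrite /c; case: (double_points w) => // a q _; rewrite /= inE eqxx.
case/mapP=> [[[c' d] k]]; rewrite mem_filter /= => /andP[/andP[_ /eqP->]] lw ec.
rewrite -{}ec in lw.
have := ndouble_set_kind (Classical e) wfw lw; rewrite (eqP nw) eqxx /=.
by rewrite addn0 addn1 => -[->].
Qed.

Definition add_kink n (K : diagram n) (p : nat) (d : bool) : diagram n.+1 :=
  Diagram (valid_insert_kink p d (code_valid K)).

Definition crossing n (K : diagram n) := seq_sub (classical_crossings K).

Definition glue n (K : diagram n) (c : crossing K) : diagram n.+1 :=
  Diagram (valid_glue (code_valid K) (ssvalP c)).

(* Iterated resolutions form an alternating sum over the signs given to all the
   double points, so resolving the first one met along the curve is harmless. *)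
Definition resolve n (S : diagram n.+1) (e : bool) : diagram n :=
  Diagram (valid_resolve e (code_valid S)).

Inductive category := Unframed | Framed.

(* A local move is given by the list of the pairs (contents before, contents
   after) of the arcs of the curve lying in the disc where it takes place; the
   arcs may be met in any order along the curve. Since both sides of a move are
   required to be planar diagrams, consecutive passages forming a monogon, a
   bigon or a triangle with compatible directions bound a face. *)
Definition tangle_move := seq (code * code).

Definition deforms (P : tangle_move) (w w' : code) : Prop :=
  exists (Q : tangle_move) (u0 : code) (us : seq code),
    [/\ perm_eq Q P, size us = size Q,
        w = u0 ++ flatten [seq z.1.1 ++ z.2 | z <- zip Q us]
      & w' = u0 ++ flatten [seq z.1.2 ++ z.2 | z <- zip Q us]].

(* The crossings met by an arc passing over (Some true), under (Some false) or
   virtually across (None) other branches. A crossing is positive iff its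
   overpass goes from the left of the underpass to its right. *)
Definition pass_kind (layer : option bool) (d : bool) : kind :=
  if layer is Some over then Classical (d == over) else Virtual.

Definition arc (o : bool) (l l' : nat * bool * kind) : code :=
  if o then [:: l; l'] else [:: l'; l].

(* Two arcs cross at x and y; the first arc meets x first, and the second one
   meets x first iff o, so that the arcs are parallel or antiparallel. *)
Definition R2_move (layer : option bool) (x y : nat) (d o : bool) :
    tangle_move :=
  let kx := pass_kind layer d in
  let ky := pass_kind layer (~~ d) in
  [:: ([::], [:: ((x, d), kx); ((y, ~~ d), ky)]);
      ([::], arc o ((x, ~~ d), kx) ((y, d), ky))].

(* Three arcs 1, 2, 3 cross at x = 12, y = 23, z = 31, and arc i meets arc i+1
   before arc i+2 iff f_i. When all f_i are true the triangle is coherently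
   oriented and the arcs i go through the crossings (i, i+1) in the same
   direction t; reversing an arc changes the directions at its two crossings.
   Arc 3 slides from one side of x to the other. *)
Definition slide_move (layer : option bool) (k : kind) (x y z : nat)
    (t f1 f2 f3 : bool) : tangle_move :=
  let dx := t (+) f1 (+) f2 in
  let dy := t (+) f2 (+) f3 in
  let dz := t (+) f3 (+) f1 in
  let ky := pass_kind layer (~~ dy) in
  let kz := pass_kind layer dz in
  let arc1 o := arc o ((x, dx), k) ((z, ~~ dz), kz) in
  let arc2 o := arc o ((y, dy), ky) ((x, ~~ dx), k) in
  let arc3 o := arc o ((z, dz), kz) ((y, ~~ dy), ky) in
  [:: (arc1 f1, arc1 (~~ f1)); (arc2 f2, arc2 (~~ f2));
      (arc3 f3, arc3 (~~ f3))].

(* A bigon with a double point at x and a classical crossing at y becomes one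
   with a classical crossing of the same sign at x and a double point at y. *)
Definition flype_move (x y : nat) (d o e : bool) : tangle_move :=
  let side kx ky :=
    ([:: ((x, d), kx); ((y, ~~ d), ky)],
     arc o ((x, ~~ d), kx) ((y, d), ky)) in
  let before := side Double (Classical e) in
  let after := side (Classical e) Double in
  [:: (before.1, after.1); (before.2, after.2)].

Inductive move (C : category) : tangle_move -> Prop :=
| R1_classical x d e of C = Unframed :
    move C [:: ([::], kink x d (Classical e))]
| R1_framed x y d d' e of C = Framed :
    move C [:: ([::], kink x d (Classical e) ++ kink y d' (Classical (~~ e)))]
| R1_virtual x d : move C [:: ([::], kink x d Virtual)]
| R2 layer x y d o : move C (R2_move layer x y d o)
| R3_virtual k x y z t f1 f2 f3 :
    move C (slide_move None k x y z t f1 f2 f3)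
| R3_classical over k x y z t f1 f2 f3 of k != Virtual :
    move C (slide_move (Some over) k x y z t f1 f2 f3)
| Flype x y d o e : move C (flype_move x y d o e).

Definition crossing_change (x : nat) (e : bool) : tangle_move :=
  [:: ([:: ((x, true), Classical e)], [:: ((x, true), Classical (~~ e))]);
      ([:: ((x, false), Classical e)], [:: ((x, false), Classical (~~ e))])].

Definition rename (f : nat -> nat) (w : code) : code :=
  [seq ((f l.1.1, l.1.2), l.2) | l <- w].

Definition same_up_to_names (w w' : code) : Prop :=
  exists2 f, injective f & w' = rename f w.

Definition knot_step (C : category) n (S S' : diagram n) : Prop :=
  same_up_to_names S S' \/ exists2 P, move C P & deforms P S S'.

Definition flat_step (C : category) n (S S' : diagram n) : Prop :=
  knot_step C S S' \/ exists x e, deforms (crossing_change x e) S S'.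

Definition isotopic (C : category) n : diagram n -> diagram n -> Prop :=
  clos_refl_sym_trans _ (@knot_step C n).

Definition flat_equiv (C : category) n : diagram n -> diagram n -> Prop :=
  clos_refl_sym_trans _ (@flat_step C n).

Definition homotopic (C : category) : diagram 0 -> diagram 0 -> Prop :=
  @flat_equiv C 0.

Definition flat_rel (C : category) n : rel (diagram n) :=
  fun S S' => `[< flat_equiv C S S' >].

Lemma flat_rel_refl C n : reflexive (@flat_rel C n).
Proof. by move=> S; apply/asboolP; apply: rst_refl. Qed.
Lemma flat_rel_sym C n : symmetric (@flat_rel C n).
Proof. by move=> S S'; apply/asboolP/asboolP; apply: rst_sym. Qed.
Lemma flat_rel_trans C n : transitive (@flat_rel C n).
Proof.
by move=> S S' S'' /asboolP h /asboolP h'; apply/asboolP; apply: rst_trans h h'.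
Qed.
Canonical flat_equiv_rel C n :=
  EquivRel (@flat_rel C n)
    (@flat_rel_refl C n) (@flat_rel_sym C n) (@flat_rel_trans C n).

Definition flat_class (C : category) := {eq_quot (@flat_rel C 1)}%qT.
HB.instance Definition _ C := Choice.on (flat_class C).

Definition flat_group (C : category) := {freeg (flat_class C)}.
HB.instance Definition _ C := GRing.Zmodule.on (flat_group C).

Local Open Scope ring_scope.
Local Open Scope quotient_scope.

Definition gen (C : category) (S : diagram 1) : flat_group C :=
  << \pi_(flat_class C) S >>.

Definition sgn n (K : diagram n) (c : crossing K) : int :=
  if ((ssval c, true), Classical true) \in code_of K then 1 else -1.

(* kpos chooses where, and with which rotation, the kink of [K^0_sing] is
   introduced. *)
Definition glueing (C : category) (kpos : diagram 0 -> nat * bool)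
    (K : diagram 0) : flat_group C :=
  match C with
  | Unframed => \sum_(c : crossing K)
      (gen C (glue c) - gen C (add_kink K (kpos K).1 (kpos K).2)) *~ sgn c
  | Framed => \sum_(c : crossing K) gen C (glue c) *~ sgn c
  end.

Definition knot_invariant (C : category) (T : Type) (nu : diagram 0 -> T) :
    Prop :=
  forall K K', isotopic C K K' -> nu K = nu K'.

Section Vassiliev.
Variables (C : category) (A : zmodType) (nu : diagram 0 -> A).

Fixpoint singular_ext n : diagram n -> A :=
  match n return diagram n -> A with
  | 0 => nu
  | m.+1 => fun S =>
      singular_ext (resolve S true) - singular_ext (resolve S false)
  end.

Definition order_le (n : nat) : Prop :=
  knot_invariant C nu /\
  forall m (S : diagram m), (n < m)%N -> singular_ext S = 0.

Definition order_one : Prop := order_le 1 /\ ~ order_le 0.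
End Vassiliev.

(* Main.v *)
(* A crossing change alters V by the value of V^(1) on the diagram glued at that
   crossing, and alters G by twice the class of that diagram (minus twice the
   class of the double kink in the unframed category, on which V^(1) vanishes by
   the first Reidemeister move); following a homotopy gives universality.

   Invariance of G: crossings outside the disc of a move are glued before and
   after it; the two crossings of a second Reidemeister move have opposite signs
   and their glued diagrams differ by a flype; in a third Reidemeister move every
   vertex may be made rigid after crossing changes. The first Reidemeister moves
   rest on sliding a double kink past a crossing: the transverse strand is pulled
   over the loop of the kink (R2), slid over its vertex (R3) and released (R2).

   G has order one because the jump of G depends only on the flat class; it is not
   of order zero in the unframed category because the parity of the number of
   classical passages between the two passages through the double point is a flat
   invariant.

   The diagrams met on the way have to be planar. A Gauss code is planar iff every
   choice of signs mod 2 at the crossings is the boundary defect of some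
   two-colouring of the faces (vanishing of the first homology mod 2 of the
   surface), and such colourings can be transported by hand through the moves. *)
From HB Require Import structures.
Require Import Defs.
From mathcomp Require Import all_boot all_order all_algebra.
From mathcomp Require Import freeg.
From mathcomp Require Import boolp zify.
From Stdlib Require Import Relations.Relation_Operators.
Set Implicit Arguments.
Unset Strict Implicit.
Unset Printing Implicit Defensive.

(** * Planarity in terms of two-colourings of the faces *)

(** A diagram is a Gauss code that passes a global test, Euler's formula, and both ends of every
    move must pass it. So a chain of moves is not enough: each intermediate code has to be shown
    planar, and a count of faces is not local. Colourings are local: when the old diagram is planar
    and the strands entering a disc keep their colours at its boundary, a new content of the disc is
    planar as soon as colours with arbitrary charges can be written down for its faces. Flat
    equivalence ignores crossing signs, so a triangle move or a flype is made legal by first giving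
    the crossings the signs it demands and restoring them afterwards; only the nature of a crossing
    (classical, virtual, double) has to be followed. Sums over crossings are taken over total
    functions on codes, so that glued codes can be rewritten without carrying proofs of validity.
    The half of a difference of glueing invariants is built step by step along a homotopy; its
    uniqueness rests on the absence of 2-torsion in a free abelian group. *)

Lemma card_component_colourings (T : finType) (e : rel T) : connect_sym e ->
  #|[set f : {ffun T -> bool} | [forall x, forall y, e x y ==> (f x == f y)]]|
  = 2 ^ n_comp e predT.
Proof.
move=> sym_e; set F := [set f | _].
have FP (f : {ffun T -> bool}) : reflect (forall x y, connect e x y ->
  f x = f y) (f \in F).
  rewrite inE; apply: (iffP forallP) => [fe x y|fe x].
    case/connectP=> p + ->; elim: p x => //= z p IH x /andP[xz /IH <-].
    by apply/eqP; move/forallP: (fe x) => /(_ z) /implyP; apply.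
  by apply/forallP=> y; apply/implyP=> xy; rewrite (fe x y) // connect1.
(* A colouring is determined by the set of component roots that it colours [true], and every set of
   roots occurs. *)
pose r (f : {ffun T -> bool}) := [set x | roots e x && f x].
have inj : {in F &, injective r}.
  move=> f g /FP fF /FP gF rfg; apply/ffunP=> x.
  have := fingraph.connect_root e x => xr; rewrite (fF _ _ xr) (gF _ _ xr).
  have := congr1 (fun A : {set T} => fingraph.root e x \in A) rfg.
  by rewrite !inE (fingraph.roots_root sym_e).
rewrite -(card_in_imset inj).
have -> : [set r f | f in F] = powerset [set x | roots e x].
  apply/setP=> A; rewrite powersetE; apply/imsetP/subsetP.
    by case=> f _ -> x; rewrite !inE => /andP[].
  move=> sA; exists [ffun x => fingraph.root e x \in A].
    apply/FP=> x y xy; rewrite !ffunE.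
    by rewrite ((fingraph.rootP sym_e) xy).
  apply/setP=> x; rewrite inE ffunE.
  case: (boolP (fingraph.roots e x)) => [/eqP -> |nr] //=.
  by apply: contraNF nr => /sA; rewrite inE.
rewrite card_powerset /n_comp_mem; congr (2 ^ _).
by apply: eq_card => x; rewrite !inE andbT.
Qed.

(* A two-colouring of the faces is recorded by the colours [Q c] at the four
   corners of each crossing [c]: left and right of the passage [(c, true)], first
   before it and then after it. *)
Definition corner_colours := (bool * bool * bool * bool)%type.

(** The branch [(c, false)] crosses the branch [(c, true)] from right to left: it comes in between
    the two right corners [b], [d] and leaves between the two left corners [a], [c]. *)
Definition before (Q : nat -> corner_colours) (l : nat * bool) : bool * bool :=
  let: (a, b, c, d) := Q l.1 in if l.2 then (a, b) else (b, d).

Definition after (Q : nat -> corner_colours) (l : nat * bool) : bool * bool :=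
  let: (a, b, c, d) := Q l.1 in if l.2 then (c, d) else (a, c).

Definition charge (q : corner_colours) : bool :=
  let: (a, b, c, d) := q in a (+) b (+) c (+) d.

Fixpoint walk (Q : nat -> corner_colours) (st : bool * bool)
    (s : seq (nat * bool)) (st' : bool * bool) : bool :=
  if s is l :: s' then (st == before Q l) && walk Q (after Q l) s' st'
  else st == st'.

(** Only the difference [b] of the two start colours is prescribed: exchanging the two colours
    everywhere alters neither this difference nor any charge. The walk returns to [st] because the
    two ends meet at infinity. *)
Definition colourable (s : seq (nat * bool)) : Prop :=
  forall b (g : nat -> bool), exists Q st,
    [/\ walk Q st s st, st.1 (+) st.2 = b
      & forall l, l \in s -> charge (Q l.1) = g l.1].

Definition flip_closed (s : seq (nat * bool)) : bool :=
  all (fun l => (l.1, ~~ l.2) \in s) s.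

Section Colourings.
Variable s : seq (nat * bool).
Hypotheses (us : uniq s) (cs : flip_closed s).
Let m := size s.
Let x0 : nat * bool := (0, true).

Let flipS l : l \in s -> (l.1, ~~ l.2) \in s. Proof. exact: (allP cs). Qed.

Let mem2 l b : l \in s -> (l.1, b) \in s.
Proof. by case: l => c d ls; have := flipS ls; case: b; case: d ls. Qed.

(** Here [u k] holds the colours on the left and on the right of edge [k]; the four equations are
    the four [corners] of a crossing, and [u 0 = u m] is the join at infinity. *)
Definition face_colouring (u : nat -> bool * bool) : Prop :=
  [/\ u 0 = u m & forall c, (c, true) \in s ->
      let i := index (c, true) s in let j := index (c, false) s in
      [/\ (u i).1 = (u j.+1).1, (u i.+1).1 = (u j.+1).2,
          (u i.+1).2 = (u j).2 & (u i).2 = (u j).1]].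

Let Phi := [set f : {ffun side m -> bool} |
  [forall x, forall y, @same_face s x y ==> (f x == f y)]].
Let st (f : {ffun side m -> bool}) k : bool * bool :=
  locked (f (inord k, true), f (inord k, false)).
Let stE f k : st f k = (f (inord k, true), f (inord k, false)).
Proof. by rewrite /st -lock. Qed.

Let PhiP f : reflect (face_colouring (st f)) (f \in Phi).
Proof.
have fE x : f x = if x.2 then (st f (val x.1)).1 else (st f (val x.1)).2.
  by rewrite stE; case: x => i [] /=; rewrite inord_val.
pose V (f : {ffun side m -> bool}) (x : nat * bool) :=
  if x.2 then (st f x.1).1 else (st f x.1).2.
have fV x : f x = V f (side_val x) by rewrite fE.
have bd x y : (x, y) \in face_joins s -> x.1 <= m /\ y.1 <= m.
  rewrite mem_cat !inE => /orP[/orP[]/eqP[-> ->] //|].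
  case/flatten_mapP=> l; rewrite mem_filter => /andP[lt ls].
  have [ltr lf] : index (l.1, true) s < m /\ index (l.1, false) s < m.
    by rewrite !index_mem !mem2.
  by rewrite !inE => /or4P[]/eqP[-> ->] /=; rewrite ?(ltnW lf) ?(ltnW ltr).
have J : f \in Phi <-> forall x y, (x, y) \in face_joins s -> V f x = V f y.
  rewrite inE; split.
    move/forallP=> H x y xy; have [xm ym] := bd _ _ xy.
    have /forallP/(_ (inord y.1, y.2))/implyP := H (inord x.1, x.2).
    rewrite /same_face /side_val /= !inordK // -!surjective_pairing xy.
    by move=> /(_ isT) /eqP; rewrite !fV /side_val /= !inordK // -!surjective_pairing.
  move=> H; apply/forallP=> x; apply/forallP=> y; apply/implyP.
  by rewrite !fV => /orP[] /H ->.
apply: (iffP idP) => [/J H|[e0 H]].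
  split.
    by rewrite [st f 0]surjective_pairing [RHS]surjective_pairing; congr pair;
      [apply: (H (0,true) (m,true))|apply: (H (0,false) (m,false))];
      rewrite mem_cat !inE eqxx ?orbT.
  move=> c cts i j.
  have C x y : (x, y) \in corners i j -> V f x = V f y.
    move=> xy; apply: H; rewrite mem_cat; apply/orP; right.
    by apply/flatten_mapP; exists (c, true); rewrite // mem_filter.
  split.
  - by apply: (C (i, true) (j.+1, true)); rewrite !inE eqxx ?orbT.
  - by apply: (C (i.+1, true) (j.+1, false)); rewrite !inE eqxx ?orbT.
  - by apply: (C (i.+1, false) (j, false)); rewrite !inE eqxx ?orbT.
  - by apply: (C (i, false) (j, true)); rewrite !inE eqxx ?orbT.
apply/J=> x y; rewrite mem_cat !inE /= => /orP[/orP[]/eqP[-> ->] //|].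
- exact: (congr1 fst e0).
- exact: (congr1 snd e0).
case/flatten_mapP=> -[c []]; rewrite mem_filter //= => cts.
by case: (H c cts) => h1 h2 h3 h4; rewrite !inE => /or4P[]/eqP[-> ->] /=.
Qed.

Let at_index k : k < m ->
  exists c b, [/\ (c, true) \in s, (c, b) \in s & k = index (c, b) s].
Proof.
move=> km; case e: (nth x0 s k) => [c b]; have cs' : (c, b) \in s by rewrite -e mem_nth.
by exists c, b; split=> //; [exact: (mem2 true cs')|by rewrite -e index_uniq].
Qed.

(** Through a crossing of charge zero the difference between the two sides of a strand is preserved,
    so it stays zero from the start on. Then no strand separates two colours, the four corners of
    each crossing agree, and the colour never changes. *)
Lemma face_colouring_eq0 u : face_colouring u -> u 0 = (false, false) ->
  (forall k, k < m -> (nth x0 s k).2 ->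
     (u k).1 (+) (u k).2 (+) (u k.+1).1 (+) (u k.+1).2 = false) ->
  forall k, k <= m -> u k = (false, false).
Proof.
move=> [_ H] u0 ch.
have C c : (c, true) \in s ->
    let i := index (c, true) s in (u i).1 (+) (u i).2 (+) (u i.+1).1 (+) (u i.+1).2 =
      false.
  move=> cts i; apply: ch; first by rewrite index_mem.
  by rewrite nth_index.
have D k : k <= m -> (u k).1 (+) (u k).2 = false.
  elim: k => [|k IH km]; first by rewrite u0.
  have [c [b [ct cb ek]]] := at_index km; move: (IH (ltnW km)).
  case: (H c ct) => h1 h2 h3 h4; move: (C c ct) => /= ch0.
  rewrite ek; case: b {cb ek}; move: h1 h2 h3 h4 ch0;
  move: (u (index (c, true) s)) (u (index (c, true) s).+1) (u (index (c,
    false) s)) (u (index (c, false) s).+1) =>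
    [a1 a2] [a3 a4] [a5 a6] [a7 a8] /= -> -> -> ->;
  by case: a5 a6 a7 a8 => [] [] [] [].
elim=> [|k IH km]; first by rewrite u0.
have [c [b [ct cb ek]]] := at_index km; move: (IH (ltnW km)).
have [lt lf] : index (c, true) s < m /\ index (c, false) s < m.
  by rewrite !index_mem; split=> //; apply: mem2 ct.
case: (H c ct) => h1 h2 h3 h4; move: (D _ km).
rewrite ek; case: b {cb ek}; move: h1 h2 h3 h4 (D _ (ltnW lt)) (D _ (ltnW lf)) (D _
  lt) (D _ lf);
move: (u (index (c, true) s)) (u (index (c, true) s).+1) (u (index (c,
  false) s)) (u (index (c, false) s).+1) =>
  [a1 a2] [a3 a4] [a5 a6] [a7 a8] /= -> -> -> ->;
by case: a5 a6 a7 a8 => [] [] [] [].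
Qed.

(* A colouring is determined by the colours at the start and by its charges:
   this injection is Euler's inequality, and planarity says that it is onto. *)
Let par (f : {ffun side m -> bool}) : (bool * bool) * {set 'I_m} :=
  (st f 0, [set k : 'I_m | (nth x0 s k).2 &&
     charge ((st f k).1, (st f k).2, (st f k.+1).1, (st f k.+1).2)]).

Let rng : {set (bool * bool) * {set 'I_m}} :=
  setX setT (powerset [set k : 'I_m | (nth x0 s k).2]).

Let par_inj : {in Phi &, injective par}.
Proof.
move=> f g /PhiP fP /PhiP gP [e0 eX].
pose h : {ffun side m -> bool} := [ffun x => f x (+) g x].
have hE k : st h k = ((st f k).1 (+) (st g k).1, (st f k).2 (+) (st g k).2).
  by rewrite !stE !ffunE.
have hP : face_colouring (st h).
  case: fP gP => f0 fP [g0 gP]; split; first by rewrite !hE f0 g0.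
  move=> c ct i j; rewrite !hE /=.
  by case: (fP c ct) (gP c ct) => -> -> -> -> [-> -> -> ->].
have Z : forall k, k <= m -> st h k = (false, false).
  apply: face_colouring_eq0 hP _ _; first by rewrite hE e0 !addbb.
  move=> k km nk; have /setP/(_ (Ordinal km)) := eX.
  rewrite !hE !inE /= nk /=.
  move: (st f k) (st g k) (st f k.+1) (st g k.+1) => [a1 a2] [a3 a4] [a5 a6] [a7 a8] /=.
  by case: a1 a2 a3 a4 a5 a6 a7 a8 => [] [] [] [] [] [] [] [].
apply/ffunP=> -[k b]; have := Z k (ltn_ord k : k <= m).
rewrite stE !ffunE inord_val => -[].
by case: b; case: (f _) (g _) (f _) (g _) => [] [] [] [].
Qed.

Let par_sub : [set par f | f in Phi] \subset rng.
Proof.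
apply/subsetP=> _ /imsetP[f _ ->]; rewrite inE in_setT /= powersetE.
by apply/subsetP=> k; rewrite !inE => /andP[].
Qed.

Let half_size : #|[set k : 'I_m | (nth x0 s k).2]| * 2 = m.
Proof.
have -> : #|[set k : 'I_m | (nth x0 s k).2]| = count (fun l => l.2) s.
  rewrite -sum1_card -sum1_count (big_nth x0) big_mkord.
  by apply: eq_bigl => k; rewrite inE.
have flipK : involutive (fun l : nat * bool => (l.1, ~~ l.2)).
  by case=> c b /=; rewrite negbK.
have pe : perm_eq s [seq (l.1, ~~ l.2) | l <- s].
  rewrite perm_sym; apply: uniq_perm => //; first by rewrite map_inj_uniq //;
    apply: inv_inj.
  move=> l; apply/mapP/idP => [[l' ls ->]|ls]; first exact: flipS.
  by exists (l.1, ~~ l.2); [apply: flipS|rewrite (flipK l)].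
have e2 : count (fun l => l.2) s = count (fun l => ~~ l.2) s.
  by rewrite {1}(permP pe) count_map.
by rewrite muln2 -addnn {2}e2 count_predC.
Qed.

Let card_rng : #|rng| = 2 ^ (m./2.+2).
Proof.
rewrite cardsX cardsT card_prod card_bool card_powerset !expnS mulnA; congr (_ * 2 ^ _).
by move: half_size; set n := #|_|; lia.
Qed.

(** As [m] is even, Euler's formula says that there are [m./2 + 2] faces. This is the exponent of
    [#|rng|]: two start colours and one charge for each of the [m./2] crossings. *)
Let nfaces_rng : planar s = (#|Phi| == #|rng|).
Proof.
rewrite card_rng card_component_colourings; last exact: same_face_sym.
rewrite eqn_exp2l // -/(nfaces s) /planar -/m.
have em : m = (m./2).*2 by move: half_size; set n := #|_|; lia.
by apply/eqP/eqP; move: (nfaces s) => F; lia.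
Qed.

Let planar_onto : planar s <-> forall p, p \in rng -> exists2 f, f \in Phi & par f = p.
Proof.
rewrite nfaces_rng -(card_in_imset par_inj); split.
  move=> /eqP e p pr; have : p \in par @: Phi.
    by have /eqP-> : par @: Phi == rng by rewrite eqEcard par_sub e /=.
  by case/imsetP=> f fP ->; exists f.
move=> H; rewrite eqn_leq subset_leq_card ?par_sub //=.
apply: subset_leq_card; apply/subsetP=> p /H[f fP <-]; exact: imset_f.
Qed.

Let colours_of (u : nat -> bool * bool) c : corner_colours :=
  let i := index (c, true) s in ((u i).1, (u i).2, (u i.+1).1, (u i.+1).2).

Let walk_of u : face_colouring u -> walk (colours_of u) (u 0) s (u m).
Proof.
move=> [_ H]; have B k : k < m -> u k = before (colours_of u) (nth x0 s k) /\
    u k.+1 = after (colours_of u) (nth x0 s k).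
  move=> km; have [c [b [ct cb ek]]] := at_index km.
  rewrite {2 4}ek nth_index //.
  case: (H c ct) => h1 h2 h3 h4; rewrite /before /after /colours_of /=.
  rewrite ek; case: b {ek cb}; first by rewrite -!surjective_pairing.
  by rewrite h1 h2 h3 h4 -!surjective_pairing.
suff: forall n k, k + n = m -> walk (colours_of u) (u k) (drop k s) (u m).
  by move/(_ m 0 erefl); rewrite drop0.
elim=> [|n IH] k; first by rewrite addn0 => ->; rewrite drop_size /=.
move=> e; have km : k < m by lia.
rewrite (drop_nth x0) //=; have [bk <-] := B k km; rewrite -bk eqxx.
by apply: IH; lia.
Qed.

Lemma colourableP : planar s <-> colourable s.
Proof.
rewrite planar_onto; split=> [H b g|H].
  have [|f /PhiP fP [e0' eX]] := H (false, b,
    [set k : 'I_m | (nth x0 s k).2 & g (nth x0 s k).1]).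
    by rewrite inE in_setT /= powersetE; apply/subsetP=> k; rewrite !inE => /andP[].
  exists (colours_of (st f)), (st f 0); split.
  - by case: (fP) => e0 _; rewrite {2}e0; apply: walk_of.
  - by rewrite e0'.
  move=> [c d] ls; have ct : (c, true) \in s by apply: mem2 ls.
  have im : index (c, true) s < m by rewrite index_mem.
  have /setP/(_ (Ordinal im)) := eX.
  by rewrite !inE /= nth_index //= /colours_of => ->.
move=> [[a b] X]; rewrite inE in_setT powersetE /= => sX.
(* The charge of [c] is read off [X] at the position of [(c, true)]; the value [false] serves the
   names that do not occur in [s]. *)
have [Q [t [wt tb cg]]] := H (a (+) b) (fun c =>
  if insub (index (c, true) s) is Some k then k \in X else false).
pose u k := if k is k'.+1 then after Q (nth x0 s k') else t.
have uB k : k < m -> u k = before Q (nth x0 s k).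
  suff W n k0 : k0 + n = m -> walk Q (u k0) (drop k0 s) t.
    move=> km; have /W : k + (m - k) = m by rewrite subnKC // ltnW.
    by rewrite (drop_nth x0) //= => /andP[/eqP].
  elim: k0 n => [|k0 IH] n e; first by rewrite drop0.
  have km : k0 < m by rewrite -e addSn ltnS leq_addr.
  have /IH : k0 + n.+1 = m by rewrite -e addnS.
  by rewrite (drop_nth x0) //= => /andP[].
have um : u m = t.
  suff W n k0 : k0 + n = m -> walk Q (u k0) (drop k0 s) t.
    by have := W 0 m (addn0 _); rewrite drop_size => /eqP.
  elim: k0 n => [|k0 IH] n e; first by rewrite drop0.
  have km : k0 < m by rewrite -e addSn ltnS leq_addr.
  have /IH : k0 + n.+1 = m by rewrite -e addnS.
  by rewrite (drop_nth x0) //= => /andP[].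
(* Adding the constant [t.1 (+) a] to all faces brings the start colours to [(a, b)]; a charge is a
   sum of four colours and does not feel it. *)
pose v k := ((u k).1 (+) t.1 (+) a, (u k).2 (+) t.1 (+) a).
pose f : {ffun side m -> bool} := [ffun x =>
  if x.2 then (v (val x.1)).1 else (v (val x.1)).2].
have stf k : k <= m -> st f k = v k by move=> km; rewrite stE !ffunE /= inordK.
have corner c d : (c, d) \in s ->
  u (index (c, d) s) = before Q (c, d) /\ u (index (c, d) s).+1 = after Q (c, d).
  by move=> cds; rewrite uB ?index_mem //= nth_index.
have fP : f \in Phi.
  apply/PhiP; split; first by rewrite !stf // /v /= um.
  move=> c ct i j; have cf : (c, false) \in s by apply: mem2 ct.
  have im : i < m by rewrite index_mem.
  have jm : j < m by rewrite index_mem.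
  rewrite (stf i (ltnW im)) (stf j (ltnW jm)) (stf _ im) (stf _ jm) /v.
  have [-> ->] := corner _ _ ct; have [-> ->] := corner _ _ cf.
  by rewrite /before /after /=; case: (Q c) => [[[q1 q2] q3] q4].
exists f => //; congr (_, _).
  by rewrite stf // /v /=; move: tb; case: (t) (a) (b) => [] [] [] [] [].
apply/setP=> k; rewrite inE.
have [c [d [ct cd ek]]] := at_index (ltn_ord k).
have nk : nth x0 s k = (c, d) by rewrite ek nth_index.
rewrite nk /=; case: d cd nk ek => cd nk ek /=; last first.
  by apply/esym/negP => /(subsetP sX); rewrite inE nk.
rewrite !stf ?(ltnW (ltn_ord k)) // /v ek.
have [-> ->] := corner _ _ ct; move: (cg _ ct) => /=.
have -> : insub (index (c, true) s) = Some k.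
  by rewrite -ek valK.
rewrite /before /after /=; case: (Q c) => [[[q1 q2] q3] q4] /= <-.
by case: q1 q2 q3 q4 (t.1) a {tb sX v f stf fP} => [] [] [] [] [] [].
Qed.
End Colourings.

(** * Local changes of a curve that keep it colourable *)

Lemma walk_cat Q st u v st' :
  walk Q st (u ++ v) st' <-> exists2 t, walk Q st u t & walk Q t v st'.
Proof.
elim: u st => [|l u IH] st /=; first by split=> [|[t /eqP->]] //; exists st.
case: eqP => //= _; last by split=> // -[].
Qed.

Lemma eq_walk Q Q' st s st' : (forall l, l \in s -> Q l.1 = Q' l.1) ->
  walk Q st s st' = walk Q' st s st'.
Proof.
elim: s st => //= l s IH st QQ'.
have e : Q l.1 = Q' l.1 by apply: QQ'; rewrite mem_head.
by rewrite /before /after e IH // => l' ls; apply: QQ'; rewrite in_cons ls orbT.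
Qed.

(* The curve with two distinguished arcs, met in the order given by [o]. *)
Definition fill (T : Type) (o : bool) (u0 u1 u2 a b : seq T) : seq T :=
  if o then u0 ++ a ++ u1 ++ b ++ u2 else u0 ++ b ++ u1 ++ a ++ u2.

Lemma map_fill (T S : Type) (f : T -> S) o u0 u1 u2 a b :
  map f (fill o u0 u1 u2 a b) =
  fill o (map f u0) (map f u1) (map f u2) (map f a) (map f b).
Proof. by case: o; rewrite /fill !map_cat. Qed.

Lemma perm_fill (T : eqType) o (u0 u1 u2 a b : seq T) :
  perm_eq (fill o u0 u1 u2 a b) ((a ++ b) ++ u0 ++ u1 ++ u2).
Proof.
by apply/permP=> p; case: o; rewrite /fill !count_cat; lia.
Qed.

(** Colours outside the disc survive as long as each arc enters and leaves with the same colours.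
    The charges [g0] demanded of the old diagram may differ from [g] at the crossings inside the
    disc, since the charges of new crossings have to be balanced by an old one. *)
Lemma colourable_fill o u0 u1 u2 a b a' b' :
    (forall g : nat -> bool, exists2 g0 : nat -> bool,
        forall l, l \in u0 ++ u1 ++ u2 -> g0 l.1 = g l.1
      & forall Q pa qa pb qb, walk Q pa a qa -> walk Q pb b qb ->
          (forall l, l \in a ++ b -> charge (Q l.1) = g0 l.1) ->
        exists Q', [/\ forall l, l \in u0 ++ u1 ++ u2 -> Q' l.1 = Q l.1,
          walk Q' pa a' qa, walk Q' pb b' qb
        & forall l, l \in a' ++ b' -> charge (Q' l.1) = g l.1]) ->
  colourable (fill o u0 u1 u2 a b) -> colourable (fill o u0 u1 u2 a' b').
Proof.
move=> loc H c g; have [g0 gg0 {}loc] := loc g.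
have [Q [st [wQ sc cQ]]] := H c g0.
have mE l : (l \in fill o u0 u1 u2 a b) = (l \in a ++ b) || (l \in u0 ++ u1 ++ u2).
  by rewrite (perm_mem (perm_fill _ _ _ _ _ _)) mem_cat.
have mE' l : (l \in fill o u0 u1 u2 a' b') = (l \in a' ++ b') || (l \in u0 ++ u1 ++ u2).
  by rewrite (perm_mem (perm_fill _ _ _ _ _ _)) mem_cat.
have [pa [qa [pb [qb [wa wb K]]]]] : exists pa qa pb qb, [/\ walk Q pa a qa,
  walk Q pb b qb &
   forall Q', (forall l, l \in u0 ++ u1 ++ u2 -> Q' l.1 = Q l.1) ->
   walk Q' pa a' qa -> walk Q' pb b' qb -> walk Q' st (fill o u0 u1 u2 a' b') st].
  move: wQ; have cp Q' v p q : (forall l, l \in u0 ++ u1 ++ u2 -> Q' l.1 = Q l.1) ->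
      {subset v <= u0 ++ u1 ++ u2} -> walk Q p v q -> walk Q' p v q.
    by move=> e sv; rewrite (eq_walk _ _ (Q' := Q')) // => l /sv /e.
  have s0 : {subset u0 <= u0 ++ u1 ++ u2} by move=> l; rewrite !mem_cat => ->.
  have s1 : {subset u1 <= u0 ++ u1 ++ u2} by move=> l; rewrite !mem_cat => ->;
    rewrite orbT.
  have s2 : {subset u2 <= u0 ++ u1 ++ u2} by move=> l; rewrite !mem_cat => ->;
    rewrite !orbT.
  rewrite /fill; case: o {H mE mE' cQ} =>
    /walk_cat[p w0 /walk_cat[q w1 /walk_cat[r w2 /walk_cat[t w3 w4]]]].
    exists p, q, r, t; split=> // Q' e wa wb.
    apply/walk_cat; exists p; first exact: cp w0.
    apply/walk_cat; exists q => //; apply/walk_cat; exists r; first exact: cp w2.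
    by apply/walk_cat; exists t => //; apply: cp w4.
  exists r, t, p, q; split=> // Q' e wa wb.
  apply/walk_cat; exists p; first exact: cp w0.
  apply/walk_cat; exists q => //; apply/walk_cat; exists r; first exact: cp w2.
  by apply/walk_cat; exists t => //; apply: cp w4.
have [|Q' [eQ wa' wb' cQ']] := loc _ _ _ _ _ wa wb.
  by move=> l lab; apply: cQ; rewrite mE lab.
exists Q', st; split=> //; first exact: K.
move=> l; rewrite mE' => /orP[/cQ' //|lu].
by rewrite eQ // cQ ?mE ?lu ?orbT // gg0.
Qed.

Definition names (w : code) : seq nat := [seq l.1.1 | l <- w].

Definition fresh_for (c : nat) (s : seq (nat * bool)) := c \notin [seq l.1 | l <- s].

Lemma fresh_forE c s l : fresh_for c s -> l \in s -> (l.1 == c) = false.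
Proof. by move=> cs ls; apply: contraNF cs => /eqP <-; apply: map_f. Qed.

(** Let [x] and [y] have charge zero. Crossing a strand then adds to both colours the difference
    across that strand, which is the same at [x] and [y]; crossing it twice restores the colours, so
    the arcs can be deleted. *)
Lemma colourable_bigon_removal o u0 u1 u2 x y d p :
    x != y -> fresh_for x (u0 ++ u1 ++ u2) -> fresh_for y (u0 ++ u1 ++ u2) ->
  colourable (fill o u0 u1 u2 [:: (x, d); (y, ~~ d)]
    (if p then [:: (x, ~~ d); (y, d)] else [:: (y, d); (x, ~~ d)])) ->
  colourable (u0 ++ u1 ++ u2).
Proof.
move=> xy fx fy H.
have -> : u0 ++ u1 ++ u2 = fill o u0 u1 u2 [::] [::] by case: o {H}.
apply: colourable_fill H => g.
exists (fun n => (n != x) && (n != y) && g n).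
  by move=> l lu; rewrite (fresh_forE fx lu) (fresh_forE fy lu).
move=> Q pa qa pb qb wa wb ch; exists Q; split=> //;
move: (ch (x, d)) (ch (y, ~~ d)) wa wb;
  rewrite !inE !eqxx !orbT /= andbF => /(_ isT) + /(_ isT);
case: p {ch} => /=; rewrite /before /after /charge /=;
move: (Q x) (Q y) => [[[a1 a2] a3] a4] [[[a5 a6] a7] a8];
case: d => /= c1 c2 /and3P[/eqP e1 /eqP e2 /eqP e3] /and3P[/eqP e4 /eqP e5 /eqP e6];
subst; case: e2; case: e5; move: c1 c2;
by case: a1 a2 a3 a4 a5 a6 a7 a8 => [] [] [] [] [] [] [] [].
Qed.

(** The order in which the transverse strand meets the crossings depends on the rotation of the kink
    and on the direction of the strand; it is used with [d != b]. *)
Definition mirror (d : bool) (s : seq (nat * bool)) := if d then s else rev s.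

(* Corner colours of a crossing whose passage with bit [b] goes from the colours
   [p] to the colours [q]. *)
Definition corners_at (b : bool) (p q : bool * bool) : corner_colours :=
  if b then (p.1, p.2, q.1, q.2) else (q.1, p.1, q.2, p.2).

Section KinkCrossing.
Variables (o : bool) (u0 u1 u2 : seq (nat * bool)) (c x y z : nat) (d b : bool).
Hypothesis names4 : uniq [:: c; x; y; z].
Hypothesis fresh4 : forall n, n \in [:: c; x; y; z] -> fresh_for n (u0 ++ u1 ++ u2).

Let neqs : [/\ (x == c) = false, (y == c) = false, (z == c) = false &
  [/\ (y == x) = false, (z == x) = false & (z == y) = false]].
Proof.
move: names4; rewrite /= !inE !negb_or -!andbA =>
  /and5P[/negPf h1 /negPf h2 /negPf h3 /negPf h4].
rewrite andbT => /andP[/negPf h5 /negPf h6].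
by rewrite (eq_sym x) (eq_sym y c) (eq_sym z c) (eq_sym y x) (eq_sym z x) (eq_sym z).
Qed.

Let off l : l \in u0 ++ u1 ++ u2 -> [/\ (l.1 == c) = false, (l.1 == x) = false,
  (l.1 == y) = false & (l.1 == z) = false].
Proof.
by move=> lu; split; apply: fresh_forE lu; apply: fresh4; rewrite !inE eqxx ?orbT.
Qed.

(* A kink [c] followed by a crossing [x] whose transverse strand has been pulled
   over the loop of the kink; then the same after the third Reidemeister move at
   the triangle [c], [x], [y]. *)
Definition pulled_arm := [:: (c, d); (y, b); (z, ~~ b); (c, ~~ d); (x, b)].

Definition pulled_strand := mirror (d != b) [:: (x, ~~ b); (y, ~~ b); (z, b)].

Definition slid_arm := [:: (y, b); (c, d); (z, ~~ b); (x, b); (c, ~~ d)].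

Definition slid_strand := mirror (d != b) [:: (y, ~~ b); (x, ~~ b); (z, b)].

(** Three faces are new: the triangle [c], [x], [y] gets the colour [t], the part of the loop next
    to the vertex [c] gets [n], and the part of the loop beyond the strand gets [be]. The charges at
    [c], [y], [z] determine them. In particular [t] differs from the neighbouring old colour by
    [tau], the sum of the charges at [y] and [z]; this shifts the charge at [x], hence the choice of
    [g0]. *)
Lemma colourable_pulled :
  colourable (fill o u0 u1 u2 [:: (x, b)] [:: (x, ~~ b)]) ->
  colourable (fill o u0 u1 u2 pulled_arm pulled_strand).
Proof.
apply: colourable_fill => g; have [n1 n2 n3 [n4 n5 n6]] := neqs.
pose tau := g y (+) g z; pose gam := g c (+) tau.
exists (fun n => if n == x then g x (+) tau else g n).
  by move=> l /off[_ -> _ _].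
move=> Q [p q] [r s] pb qb wa wb /(_ (x, b)); rewrite /= mem_head eqxx => /(_ isT) ch.
pose t := (if d then q else p) (+) tau.
pose n := (if d then p else q) (+) gam.
pose r' := if d then s else r.
pose p' := if d then q else p.
pose be := n (+) r' (+) p' (+) g z.
pose sw (u v : bool) := if d then (v, u) else (u, v).
exists (fun k => if k == c then corners_at d (p, q) (sw n t) else
  if k == x then corners_at b (if d then (p, t) else (t, q)) (r, s) else
  if k == y then corners_at b (sw n t) (sw be r') else
  if k == z then corners_at (~~ b) (sw be r') (sw n p') else Q k).
split.
- by move=> l /off[-> -> -> ->].
- move: wa wb ch; rewrite /= /before /after /charge /corners_at /= !eqxx n1 n2 n3 n4
  n5 n6.
  rewrite /sw /be /n /t /r' /p' /gam /tau; move: (Q x) => [[[a1 a2] a3] a4].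
  case: d; case: b => /= /andP[/eqP[-> ->] /eqP[<- <-]] _;
  by move: (g c) (g x) (g y) (g z) => [] [] [] []; case: a1 a2 a3 a4 => [] [] [] [].
- move: wa wb ch; rewrite /pulled_strand /mirror /= /before /after /charge /corners_at
  /= ?eqxx.
  rewrite /sw /be /n /t /r' /p' /gam /tau; move: (Q x) => [[[a1 a2] a3] a4].
  case: d; case: b => /= /andP[/eqP[-> ->] /eqP[<- <-]] /andP[/eqP-> /eqP <-];
  rewrite /rev /= /before /after /corners_at /= !eqxx ?n1 ?n2 ?n3 ?n4 ?n5 ?n6;
  by move: (g c) (g x) (g y) (g z) => [] [] [] []; case: a1 a2 a3 a4 => [] [] [] [].
have chk k : k \in [:: c; x; y;
  z] -> charge (if k == c then corners_at d (p, q) (sw n t) else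
  if k == x then corners_at b (if d then (p, t) else (t, q)) (r, s) else
  if k == y then corners_at b (sw n t) (sw be r') else
  if k == z then corners_at (~~ b) (sw be r') (sw n p') else Q k) = g k.
  move: wa wb ch.
  rewrite /sw /be /n /t /r' /p' /gam /tau /= /before /after /charge;
    move: (Q x) => [[[a1 a2] a3] a4].
  rewrite !inE => wa _ ch /or4P[] /eqP->; rewrite ?eqxx ?n1 ?n2 ?n3 ?n4 ?n5 ?n6;
  move: wa ch; case: d; case: b => /= /andP[/eqP[e1 e2] /eqP[e3 e4]];
    rewrite ?e1 ?e2 -?e3 -?e4 {e1 e2 e3 e4};
  by move: (g c) (g x) (g y) (g z) => [] [] [] []; case: a1 a2 a3 a4 => [] [] [] [].
have nm : all (fun l => l.1 \in [:: c; x; y; z]) (pulled_arm ++ pulled_strand).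
  by rewrite /pulled_strand /mirror; case: (d != b); rewrite /= !inE !eqxx ?orbT.
by move=> l ls; apply: chk; apply: (allP nm).
Qed.

(** The same three faces after the triangle move. Now [y] plays the part of the old crossing, so its
    charge absorbs those of [x] and [z]. *)
Lemma colourable_slid :
  colourable (fill o u0 u1 u2 [:: (y, b)] [:: (y, ~~ b)]) ->
  colourable (fill o u0 u1 u2 slid_arm slid_strand).
Proof.
apply: colourable_fill => g; have [n1 n2 n3 [n4 n5 n6]] := neqs.
pose tau := g x (+) g z; pose gam := g c (+) tau.
exists (fun n => if n == y then g y (+) tau else g n).
  by move=> l /off[_ _ -> _].
move=> Q [p q] [r s] pb qb wa wb /(_ (y, b)); rewrite /= mem_head eqxx => /(_ isT) ch.
pose r' := if d then s else r.
pose s' := if d then r else s.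
pose p' := if d then q else p.
pose t := r' (+) tau.
pose n := s' (+) gam.
pose be := n (+) r' (+) p' (+) g z.
pose sw (u v : bool) := if d then (v, u) else (u, v).
exists (fun k => if k == c then corners_at d (sw t s') (sw n r') else
  if k == x then corners_at b (sw be p') (sw n t) else
  if k == y then corners_at b (p, q) (sw t s') else
  if k == z then corners_at (~~ b) (sw n r') (sw be p') else Q k).
split.
- by move=> l /off[-> -> -> ->].
- move: wa wb ch; rewrite /= /before /after /charge /corners_at /= !eqxx n1 n2 n3 n4
  n5 n6.
  rewrite /sw /be /n /t /r' /s' /p' /gam /tau; move: (Q y) => [[[a1 a2] a3] a4].
  case: d; case: b => /= /andP[/eqP[-> ->] /eqP[<- <-]] _;
  by move: (g c) (g x) (g y) (g z) => [] [] [] []; case: a1 a2 a3 a4 => [] [] [] [].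
- move: wa wb ch; rewrite /slid_strand /mirror /= /before /after /charge /corners_at
  /= ?eqxx.
  rewrite /sw /be /n /t /r' /s' /p' /gam /tau; move: (Q y) => [[[a1 a2] a3] a4].
  case: d; case: b => /= /andP[/eqP[-> ->] /eqP[<- <-]] /andP[/eqP-> /eqP <-];
  rewrite /rev /= /before /after /corners_at /= !eqxx ?n1 ?n2 ?n3 ?n4 ?n5 ?n6;
  by move: (g c) (g x) (g y) (g z) => [] [] [] []; case: a1 a2 a3 a4 => [] [] [] [].
have chk k : k \in [:: c; x; y;
  z] -> charge ((fun k => if k == c then corners_at d (sw t s') (sw n r') else
  if k == x then corners_at b (sw be p') (sw n t) else
  if k == y then corners_at b (p, q) (sw t s') else
  if k == z then corners_at (~~ b) (sw n r') (sw be p') else Q k) k) = g k.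
  move: wa wb ch.
  rewrite /sw /be /n /t /r' /s' /p' /gam /tau /= /before /after /charge;
    move: (Q y) => [[[a1 a2] a3] a4].
  rewrite !inE => wa _ ch /or4P[] /eqP->; rewrite ?eqxx ?n1 ?n2 ?n3 ?n4 ?n5 ?n6;
  move: wa ch; case: d; case: b => /= /andP[/eqP[e1 e2] /eqP[e3 e4]];
    rewrite ?e1 ?e2 -?e3 -?e4 {e1 e2 e3 e4};
  by move: (g c) (g x) (g y) (g z) => [] [] [] []; case: a1 a2 a3 a4 => [] [] [] [].
have nm : all (fun l => l.1 \in [:: c; x; y; z]) (slid_arm ++ slid_strand).
  by rewrite /slid_strand /mirror; case: (d != b); rewrite /= !inE !eqxx ?orbT.
by move=> l ls; apply: chk; apply: (allP nm).
Qed.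
End KinkCrossing.

(** * Flat equivalence and isotopy of codes *)

Lemma wf_perm w w' : perm_eq w w' -> wf w = wf w'.
Proof.
move=> e; rewrite /wf (perm_uniq (perm_map fst e)) (perm_all _ e); congr (_ && _).
by apply: eq_all => l; rewrite (perm_mem e).
Qed.

Lemma ndouble_perm w w' : perm_eq w w' -> ndouble w = ndouble w'.
Proof. by move=> e; rewrite /ndouble (permP e). Qed.

Lemma names_cat w w' : names (w ++ w') = names w ++ names w'.
Proof. exact: map_cat. Qed.

Lemma names_shadow w : names w = [seq l.1 | l <- shadow w].
Proof. by rewrite /names -map_comp. Qed.

Lemma wf_kink c d k w : wf (kink c d k ++ w) = (c \notin names w) && wf w.
Proof.
apply/idP/andP => [|[cw /andP[uw /allP clw]]].
  case/andP; rewrite /= !inE xpair_eqE eqxx /= => /and3P[].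
  rewrite negb_or => /andP[_ h1] h2 uw => /and3P[_ _ /allP clw].
  have cw : c \notin names w.
    apply/negP => /mapP[[[c' d'] k'] lw e]; rewrite /= in e; subst c'.
    have : (c, d') \in shadow w by apply: (map_f fst lw).
    case: (eqVneq d' d) h1 h2 => [->|nd] h1 h2 h; first by rewrite h in h1.
    by have e : d' = ~~ d by [case: d d' nd {h1 h2 h lw clw} => [] []];
      rewrite -e h in h2.
  split=> //; apply/andP; split=> //; apply/allP=> l lw; have := clw l lw.
  rewrite !inE => /or3P[/eqP e|/eqP e|] //; case/negP: cw; apply/mapP; exists l => //.
    by move: e => /(congr1 (fun l => l.1.1)).
  by move: e => /(congr1 (fun l => l.1.1)).
have nc b : (c, b) \notin shadow w by apply: contra cw => /(map_f fst);
  rewrite names_shadow.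
apply/andP; split.
  rewrite /= -![_ \in map _ _]/(_ \in shadow w) inE xpair_eqE eqxx /= (negPf (nc _))
    (negPf (nc _)) uw orbF andbT.
  by case: d.
rewrite /= !inE !eqxx orbT negbK eqxx /=.
by apply/allP=> l /clw; rewrite !inE => ->; rewrite !orbT.
Qed.

Lemma wf_shadow w : wf w -> uniq (shadow w) /\ flip_closed (shadow w).
Proof.
case/andP=> uw /allP cw; split=> //; apply/allP=> _ /mapP[l lw ->].
by apply/mapP; exists ((l.1.1, ~~ l.1.2), l.2); rewrite ?cw.
Qed.

Lemma planarP w : wf w -> planar (shadow w) <-> colourable (shadow w).
Proof. by case/wf_shadow; apply: colourableP. Qed.

Lemma wf_kindP w c d k : wf w -> ((c, d), k) \in w ->
  forall l, l \in w -> l.1.1 = c -> l.2 = k.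
Proof.
move=> wfw ckw l lw e; move: lw; rewrite -(set_kind_id wfw ckw) => /mapP[l' _ el].
by move: e; rewrite {}el; case: eqP => //= ne /ne.
Qed.

Definition deco (K : nat -> kind) (s : seq (nat * bool)) : code :=
  [seq (l, K l.1) | l <- s].

Lemma shadow_deco K s : shadow (deco K s) = s.
Proof. by rewrite /shadow -map_comp map_id. Qed.

Lemma deco_cat K s t : deco K (s ++ t) = deco K s ++ deco K t.
Proof. exact: map_cat. Qed.

(** A normal form for the passages of a set of crossings. Well-formedness and the number of double
    points do not depend on the order of the passages, so both can be computed here; only planarity
    needs the true order. *)
Definition chords (ns : seq nat) : seq (nat * bool) :=
  flatten [seq [:: (n, true); (n, false)] | n <- ns].

Lemma wf_chords K ns r :
  wf (deco K (chords ns) ++ r) = [&& uniq ns, all (fun n =>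
    n \notin names r) ns & wf r].
Proof.
elim: ns => //= n ns IH.
rewrite -[LHS]/(wf (kink n true (K n) ++ (deco K (chords ns) ++ r))) wf_kink IH.
rewrite names_cat mem_cat negb_or -!andbA.
have -> : (n \notin names (deco K (chords ns))) = (n \notin ns).
  congr (~~ _); elim: ns {IH} => //= m ns IH; rewrite !inE -IH orbA orbb.
  by [].
by case: (n \notin ns) (n \notin names r) (uniq ns) => [] [] [].
Qed.

Lemma ndouble_chords K ns r :
  ndouble (deco K (chords ns) ++ r) = (count (fun n => K n == Double) ns + ndouble r)%N.
Proof.
elim: ns => //= n ns IH.
by rewrite {1}/ndouble /= -/(ndouble _) IH /= add0n addnA.
Qed.

Lemma split_name w c d k : wf w -> ((c, d), k) \in w ->
  exists o u0 u1 u2, w = fill o u0 u1 u2 [:: ((c, d), k)] [:: ((c, ~~ d), k)] /\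
    c \notin names (u0 ++ u1 ++ u2).
Proof.
move=> wfw cw; have [_ /allP clw] := andP wfw.
have cw' := clw _ cw; rewrite /= in cw'.
suff [o [u0 [u1 [u2 e]]]] : exists o u0 u1 u2, w = fill o u0 u1 u2 [:: ((c, d),
  k)] [:: ((c, ~~ d), k)].
  exists o, u0, u1, u2; split=> //; move: wfw;
    rewrite e (wf_perm (perm_fill _ _ _ _ _ _)).
  by rewrite (wf_kink c d k) => /andP[].
case/splitPr: cw cw' {clw wfw} => u v; rewrite mem_cat inE => /orP[|/predU1P[[]|]].
- by case/splitPr=> u0 u1; exists false, u0, u1, v; rewrite /fill -catA.
- by case: d.
- by case/splitPr=> u1 u2; exists true, u, u1, u2.
Qed.

Lemma set_kind_off c k u : c \notin names u -> set_kind c k u = u.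
Proof.
move=> cu; rewrite -[RHS]map_id; apply/eq_in_map => l lu; case: eqP => // e.
by case/negP: cu; apply/mapP; exists l.
Qed.

Lemma set_kind_fill c k o u0 u1 u2 a b : c \notin names (u0 ++ u1 ++ u2) ->
  set_kind c k (fill o u0 u1 u2 a b) = fill o u0 u1 u2 (set_kind c k a) (set_kind c k
    b).
Proof.
rewrite !names_cat !mem_cat !negb_or => /and3P[h0 h1 h2].
by rewrite -{2}(set_kind_off k h0) -{2}(set_kind_off k h1) -{2}(set_kind_off k h2);
  apply: map_fill.
Qed.

Section CodeRelations.
Variables (n : nat) (R : diagram n -> diagram n -> Prop).

(** Stated on codes, so that equal codes can be rewritten freely; the validity of both ends is
    hidden in the witnesses. *)
Definition code_rel (w w' : code) : Prop :=
  exists S S' : diagram n,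
    [/\ code_of S = w, code_of S' = w' & clos_refl_sym_trans _ R S S'].

Lemma code_rel_refl w : valid n w -> code_rel w w.
Proof. by move=> v; exists (Diagram v), (Diagram v); split=> //; apply: rst_refl. Qed.

Lemma code_rel_sym w w' : code_rel w w' -> code_rel w' w.
Proof. by case=> S [S' [e e' r]]; exists S', S; split=> //; apply: rst_sym. Qed.

Lemma code_rel_trans w w' w'' : code_rel w w' -> code_rel w' w'' -> code_rel w w''.
Proof.
case=> S [S' [<- <- r]] [T [T' [/val_inj eT <- r']]]; exists S, T'; split=> //.
by apply: rst_trans r _; rewrite -eT.
Qed.

Lemma code_rel_step w w' : valid n w -> valid n w' ->
  (forall S S' : diagram n, code_of S = w -> code_of S' = w' -> R S S') ->
    code_rel w w'.
Proof.
by move=> v v' H; exists (Diagram v), (Diagram v'); split=> //; apply: rst_step;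
  apply: H.
Qed.
End CodeRelations.

Local Notation feq C n := (code_rel (@flat_step C n)).
Local Notation ieq C n := (code_rel (@knot_step C n)).

Lemma feq_move C n P w w' : move C P -> deforms P w w' ->
  valid n w -> valid n w' -> feq C n w w'.
Proof.
move=> m h v v'; apply: code_rel_step => // S S' eS eS'.
by left; right; exists P; rewrite // eS eS'.
Qed.

Lemma ieq_move C n P w w' : move C P -> deforms P w w' ->
  valid n w -> valid n w' -> ieq C n w w'.
Proof.
move=> m h v v'; apply: code_rel_step => // S S' eS eS'.
by right; exists P; rewrite // eS eS'.
Qed.

Lemma ieq_rename C n f w : injective f -> valid n w -> valid n (rename f w) ->
  ieq C n w (rename f w).
Proof.
move=> fi v v'; apply: code_rel_step => // S S' eS eS'.
by left; exists f; rewrite // eS eS'.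
Qed.

Lemma ieq_feq C n w w' : ieq C n w w' -> feq C n w w'.
Proof.
case=> S [S' [eS eS' r]]; exists S, S'; split=> //.
elim: r => [T T' s|T|T T' _ h|T T' T'' _ h _ h'].
- by apply: rst_step; left.
- exact: rst_refl.
- exact: rst_sym.
- exact: rst_trans h h'.
Qed.

(** A curve cut into pieces: [inl] is an arc inside the disc with its contents before and after,
    [inr] a stretch left alone. A move is then exhibited by listing the pieces in the order in which
    the curve meets them. *)
Definition piece := ((code * code) + code)%type.

Definition piece_before (p : piece) := match p with inl ab => ab.1 | inr u => u end.

Definition piece_after (p : piece) := match p with inl ab => ab.2 | inr u => u end.

Definition piece_arcs (T : seq piece) : tangle_move :=
  pmap (fun p : piece => if p is inl ab then Some ab else None) T.

Lemma deforms_pieces P T : perm_eq (piece_arcs T) P ->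
  deforms P (flatten [seq piece_before p | p <- T]) (flatten [seq piece_after p | p <-
    T]).
Proof.
move=> eP; suff [u0 [us [su eb ea]]] : exists u0 us, [/\ size us = size (piece_arcs T),
   flatten [seq piece_before p | p <- T] = u0 ++ flatten [seq z.1.1 ++ z.2 | z <- zip
     (piece_arcs T) us]
   & flatten [seq piece_after p | p <- T] = u0 ++ flatten [seq z.1.2 ++ z.2 | z <- zip
     (piece_arcs T) us]].
  by exists (piece_arcs T), u0, us.
elim: T {eP} => [|[[a b]|u] T [u0 [us [su eb ea]]]] /=; first by exists [::], [::].
  by exists [::], (u0 :: us); rewrite /= su eb ea !catA.
by exists (u ++ u0), us; rewrite su eb ea !catA.
Qed.

Lemma deforms_context P T u v w w' :
    w = u ++ flatten [seq piece_before p | p <- T] ++ v ->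
    w' = u ++ flatten [seq piece_after p | p <- T] ++ v ->
  perm_eq (piece_arcs T) P -> deforms P w w'.
Proof.
move=> -> -> e; have := @deforms_pieces P (inr u :: T ++ [:: inr v]).
by rewrite /piece_arcs /= pmap_cat !map_cat !flatten_cat /= !cats0; apply.
Qed.

Lemma deforms_fill P o u0 u1 u2 TA TB a b a' b' :
    a = flatten [seq piece_before p | p <- TA] ->
      b = flatten [seq piece_before p | p <- TB] ->
    a' = flatten [seq piece_after p | p <- TA] ->
      b' = flatten [seq piece_after p | p <- TB] ->
    perm_eq (piece_arcs (TA ++ TB)) P ->
  deforms P (fill o u0 u1 u2 a b) (fill o u0 u1 u2 a' b').
Proof.
move=> -> -> -> -> e.
have pac S S' : piece_arcs (S ++ S') = piece_arcs S ++ piece_arcs S' by apply: pmap_cat.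
pose T : seq piece := if o then inr u0 :: TA ++ inr u1 :: TB ++ [:: inr u2]
         else inr u0 :: TB ++ inr u1 :: TA ++ [:: inr u2].
have eT : perm_eq (piece_arcs T) P.
  rewrite -(permPr e) pac /T; case: o {T};
    rewrite -cat1s !pac /= -cat1s !pac /= cats0 //.
  by rewrite perm_catC.
have := deforms_pieces eT; congr deforms; rewrite /T /fill; case: o {T eT} => /=;
  by rewrite !map_cat !flatten_cat /= !map_cat !flatten_cat /= cats0.
Qed.

Lemma deforms_catl P v w w' : deforms P w w' -> deforms P (v ++ w) (v ++ w').
Proof.
by case=> Q [u0 [us [e s -> ->]]]; exists Q, (v ++ u0), us; rewrite !catA.
Qed.

Definition map_move (f : code -> code) (P : tangle_move) : tangle_move :=
  [seq (f p.1, f p.2) | p <- P].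

Lemma deforms_map (f : nat * bool * kind -> nat * bool * kind) P w w' :
  deforms P w w' -> deforms (map_move (map f) P) (map f w) (map f w').
Proof.
case=> Q [u0 [us [e s -> ->]]].
exists (map_move (map f) Q), (map f u0), (map (map f) us); split.
- exact: perm_map.
- by rewrite !size_map.
- rewrite map_cat map_flatten; congr (_ ++ flatten _).
  by elim: Q us s {e} => [|q Q IH] [|u us] //= [s]; rewrite map_cat IH.
- rewrite map_cat map_flatten; congr (_ ++ flatten _).
  by elim: Q us s {e} => [|q Q IH] [|u us] //= [s]; rewrite map_cat IH.
Qed.

(** * Crossing signs under flat equivalence *)

Definition flat_kind (k : kind) := if k is Classical _ then Classical true else k.

Definition flat_code (w : code) : code := [seq (l.1, flat_kind l.2) | l <- w].

Lemma flat_kind_idem k : flat_kind (flat_kind k) = flat_kind k.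
Proof. by case: k. Qed.

Lemma flat_kind_Double k : (flat_kind k == Double) = (k == Double).
Proof. by case: k. Qed.

Section Flattening.
Variables (C : category) (n : nat).

Let flat_on (ns : seq nat) (w : code) : code :=
  [seq if l.1.1 \in ns then (l.1, flat_kind l.2) else l | l <- w].

Let valid_flat_on ns w : valid n w -> valid n (flat_on ns w).
Proof.
have sE : shadow (flat_on ns w) = shadow w.
  by rewrite /shadow -map_comp; apply: eq_map => l /=; case: ifP.
case/and3P=> /andP[uw /allP cw] pw /eqP nw; apply/and3P; split.
- rewrite /wf sE uw /=; apply/allP=> _ /mapP[l lw ->]; apply/mapP.
  by exists ((l.1.1, ~~ l.1.2), l.2); [apply: cw|rewrite /=; case: ifP].
- by rewrite sE.
- rewrite -nw /ndouble count_map; apply/eqP; apply: eq_count => l /=.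
  by case: ifP; rewrite /= ?flat_kind_Double.
Qed.

Let flat_on1 c w : valid n w -> feq C n w (flat_on [:: c] w).
Proof.
move=> v; have v' := valid_flat_on [:: c] v.
case: (boolP (c \in names w)) => [/mapP[[[c' d] k] lw e]|nc]; last first.
  have -> : flat_on [:: c] w = w; last exact: code_rel_refl.
  rewrite -[RHS]map_id; apply/eq_in_map => l lw; rewrite inE; case: eqP => // e.
  by case/negP: nc; apply/mapP; exists l.
rewrite /= in e; subst c'; have /and3P[wfw _ _] := v.
have E : flat_on [:: c] w = set_kind c (flat_kind k) w.
  apply/eq_in_map => l lw'; rewrite inE; case: eqP => // e.
  by rewrite (wf_kindP wfw lw lw' e).
case: (eqVneq k (Classical false)) => [ek|nk]; last first.
  rewrite E; have -> : flat_kind k = k by case: k nk {lw E} => // -[].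
  by rewrite (set_kind_id wfw lw); apply: code_rel_refl.
have lw1 : ((c, true), k) \in w.
  by case: d lw => // lw; have := allP (proj2 (andP wfw)) _ lw.
apply: code_rel_step => // S S' eS eS'; right; exists c, false; rewrite eS eS' E ek.
have [o [u0 [u1 [u2 [ew cu]]]]] := split_name wfw lw1.
rewrite {}ew set_kind_fill //=.
apply: (@deforms_fill _ _ _ _ _
  [:: inl ([:: ((c, true), Classical false)], [:: ((c, true), Classical true)])]
  [:: inl ([:: ((c, false), Classical false)], [:: ((c, false), Classical true)])]);
  by rewrite /= ?eqxx ?ek.
Qed.

(** One name is flattened at a time, which costs at most one crossing change; every intermediate
    code is valid because shadow and double points are untouched. *)
Lemma feq_flat w : valid n w -> feq C n w (flat_code w).
Proof.
move=> v; have -> : flat_code w = flat_on (names w) w.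
  apply/eq_in_map => l lw; have -> // : l.1.1 \in names w.
  exact: (map_f (fun l => l.1.1)).
elim: (names w) => [|c ns IH].
  have -> : flat_on [::] w = w by rewrite /flat_on /= map_id.
  exact: code_rel_refl.
have -> : flat_on (c :: ns) w = flat_on [:: c] (flat_on ns w).
  rewrite /flat_on -map_comp; apply: eq_map => l /=; rewrite !inE.
  by case: (l.1.1 \in ns); rewrite /= ?orbT ?orbF ?flat_kind_idem //; case: eqP.
by apply: code_rel_trans IH _; apply: flat_on1; apply: valid_flat_on.
Qed.

Lemma feq_sign w w' : valid n w -> valid n w' -> flat_code w = flat_code w' ->
  feq C n w w'.
Proof.
move=> v v' e; apply: code_rel_trans (feq_flat v) _; rewrite e.
by apply: code_rel_sym; apply: feq_flat.
Qed.
End Flattening.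

(** * Sliding a kink past a crossing *)

Lemma shadow_fill o u0 u1 u2 a b :
  shadow (fill o u0 u1 u2 a b) =
  fill o (shadow u0) (shadow u1) (shadow u2) (shadow a) (shadow b).
Proof. exact: map_fill. Qed.

Lemma planar_kink_in c d k u v : wf (u ++ v) -> c \notin names (u ++ v) ->
  planar (shadow (u ++ kink c d k ++ v)) = planar (shadow (u ++ v)).
Proof.
move=> wfw cw; rewrite /shadow !map_cat planar_kink // -map_cat.
  by move=> b; apply: contra cw => /(map_f fst); rewrite names_shadow.
by have [_ /allP] := wf_shadow wfw.
Qed.

Lemma colourable_rename f s : involutive f ->
  colourable s -> colourable [seq (f l.1, l.2) | l <- s].
Proof.
move=> fK H b g; have [Q [st [wQ sb cQ]]] := H b (g \o f).
exists (Q \o f), st; split=> //; last first.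
  by move=> _ /mapP[l ls ->] /=; rewrite fK cQ //= .
move: wQ; move: {2 4}st => st'; elim: s st {H sb cQ} => //= l s IH st /andP[/eqP-> w].
have e1 : before (Q \o f) (f l.1, l.2) = before Q l by rewrite /before /= fK.
have e2 : after (Q \o f) (f l.1, l.2) = after Q l by rewrite /after /= fK.
by rewrite e1 e2 eqxx; apply: IH.
Qed.

Definition swap (x y n : nat) := if n == x then y else if n == y then x else n.

Lemma swapK x y : involutive (swap x y).
Proof.
move=> n; rewrite /swap; case: (n =P x) => [->|/eqP nx]; first by rewrite eqxx;
  case: eqP.
by case: (n =P y) => [->|/eqP ny]; rewrite ?eqxx // (negPf nx) (negPf ny).
Qed.

Lemma rename_off x y u : x \notin names u -> y \notin names u ->
  rename (swap x y) u = u.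
Proof.
move=> xu yu; rewrite -[RHS]map_id; apply/eq_in_map => -[[c d] k] lu.
rewrite /swap /=; case: eqP => [e|_]; first by case/negP: xu; rewrite -e;
  apply: (map_f (fun l => l.1.1) lu).
by case: eqP => [e|//]; case/negP: yu; rewrite -e; apply: (map_f (fun l => l.1.1) lu).
Qed.

Lemma rename_fill f o u0 u1 u2 a b :
  rename f (fill o u0 u1 u2 a b) = fill o (rename f u0) (rename f u1) (rename f u2)
    (rename f a) (rename f b).
Proof. exact: map_fill. Qed.

Lemma flat_fill o u0 u1 u2 a b :
  flat_code (fill o u0 u1 u2 a b) =
  fill o (flat_code u0) (flat_code u1) (flat_code u2) (flat_code a) (flat_code b).
Proof. exact: map_fill. Qed.

Lemma flat_deco K K' s : {in s, forall l, flat_kind (K l.1) = flat_kind (K' l.1)} ->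
  flat_code (deco K s) = flat_code (deco K' s).
Proof. by move=> e; rewrite /flat_code -!map_comp; apply/eq_in_map => l /e /= ->. Qed.

Lemma perm_rot3 (T : eqType) (a b c : T) : perm_eq [:: a; b; c] [:: b; c; a].
Proof. by apply/permPl; exact: (perm_catC [:: a] [:: b; c]). Qed.

Lemma perm_rot3' (T : eqType) (a b c : T) : perm_eq [:: a; b; c] [:: c; a; b].
Proof. by apply/permPl; exact: (perm_catC [:: a; b] [:: c]). Qed.

Definition upd (K : nat -> kind) (m : nat) (k : kind) : nat -> kind :=
  fun q => if q == m then k else K q.

Section ArcPermutations.
Variables (c x y z : nat) (d b : bool).

Lemma perm_pulled : perm_eq (pulled_arm c x y z d b ++ pulled_strand x y z d b)
  (chords [:: c; x; y; z]).
Proof. by apply/permP=> p; case: d; case: b => /=;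
  move: (nat_of_bool (p (c, true))) (nat_of_bool (p (c, false))) (nat_of_bool (p (x,
  true))) (nat_of_bool (p (x, false)))
 (nat_of_bool (p (y, true))) (nat_of_bool (p (y, false))) (nat_of_bool (p (z,
   true))) (nat_of_bool (p (z, false))) => *; lia. Qed.

Lemma perm_slid : perm_eq (slid_arm c x y z d b ++ slid_strand x y z d b) (chords [::
  c; x; y; z]).
Proof. by apply/permP=> p; case: d; case: b => /=;
  move: (nat_of_bool (p (c, true))) (nat_of_bool (p (c, false))) (nat_of_bool (p (x,
  true))) (nat_of_bool (p (x, false)))
 (nat_of_bool (p (y, true))) (nat_of_bool (p (y, false))) (nat_of_bool (p (z,
   true))) (nat_of_bool (p (z, false))) => *; lia. Qed.

Lemma perm_kink_crossing : perm_eq ([:: (c, d); (c, ~~ d);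
  (x, b)] ++ [:: (x, ~~ b)]) (chords [:: c; x]).
Proof. by apply/permP=> p; case: d; case: b => /=;
  move: (nat_of_bool (p (c, true))) (nat_of_bool (p (c, false))) (nat_of_bool (p (x,
  true))) (nat_of_bool (p (x, false))) => *; lia. Qed.

Lemma perm_crossing_kink : perm_eq ([:: (x, b); (c, d);
  (c, ~~ d)] ++ [:: (x, ~~ b)]) (chords [:: c; x]).
Proof. by apply/permP=> p; case: d; case: b => /=;
  move: (nat_of_bool (p (c, true))) (nat_of_bool (p (c, false))) (nat_of_bool (p (x,
  true))) (nat_of_bool (p (x, false))) => *; lia. Qed.

End ArcPermutations.

Section KinkPass.
Variables (C : category) (n : nat) (o : bool) (u0 u1 u2 : code).
Variables (c x y z : nat) (d b : bool).
Let r := u0 ++ u1 ++ u2.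
Hypotheses (wr : wf r) (names4 : uniq [:: c; x; y; z]).
Hypothesis off4 : all (fun m => m \notin names r) [:: c; x; y; z].
Let base m := fill o (shadow u0) (shadow u1) (shadow u2) [:: (m, b)] [:: (m, ~~ b)].
Hypothesis base_x : colourable (base x).

(** The stations of the slide, for a decoration [K]: in [S] the kink precedes the crossing [x]; in
    [A] the strand has been pulled over the loop; in [B] the triangle move has been made; in [F m]
    the strand is released and the kink follows the crossing, called [m]. *)
Let A K := fill o u0 u1 u2 (deco K (pulled_arm c x y z d b)) (deco K (pulled_strand x
  y z d b)).
Let B K := fill o u0 u1 u2 (deco K (slid_arm c x y z d b)) (deco K (slid_strand x y z
  d b)).
Let S K := fill o u0 u1 u2 (deco K [:: (c, d); (c, ~~ d);
  (x, b)]) (deco K [:: (x, ~~ b)]).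
Let F m K := fill o u0 u1 u2 (deco K [:: (m, b); (c, d);
  (c, ~~ d)]) (deco K [:: (m, ~~ b)]).

Let shadow_r : shadow r = shadow u0 ++ shadow u1 ++ shadow u2.
Proof. by rewrite /shadow !map_cat. Qed.

Let fresh4 m : m \in [:: c; x; y;
  z] -> fresh_for m (shadow u0 ++ shadow u1 ++ shadow u2).
Proof. by move=> /(allP off4); rewrite names_shadow shadow_r. Qed.

Let off m : m \in [:: c; x; y; z] -> m \notin names r.
Proof. exact: (allP off4). Qed.

Let neq_xy : [/\ c != x, c != y, c != z & [/\ x != y, x != z & y != z]].
Proof.
move: names4; rewrite /= !inE !negb_or -!andbA => /and5P[h1 h2 h3 h4].
by rewrite andbT => /andP[h5 h6].
Qed.

Let wf_arcs K s t ns : perm_eq (s ++ t) (chords ns) ->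
  wf (fill o u0 u1 u2 (deco K s) (deco K t)) =
  [&& uniq ns, all (fun m => m \notin names r) ns & wf r].
Proof.
move=> e; rewrite (wf_perm (perm_fill _ _ _ _ _ _)) -deco_cat -(wf_chords K).
by apply: wf_perm; rewrite perm_cat2r; apply: perm_map.
Qed.

Let ndouble_arcs K s t ns : perm_eq (s ++ t) (chords ns) ->
  ndouble (fill o u0 u1 u2 (deco K s) (deco K t)) =
  (count (fun m => K m == Double) ns + ndouble r)%N.
Proof.
move=> e; rewrite (ndouble_perm (perm_fill _ _ _ _ _ _)) -deco_cat -(ndouble_chords K).
by apply: ndouble_perm; rewrite perm_cat2r; apply: perm_map.
Qed.

Let permA : perm_eq (pulled_arm c x y z d b ++ pulled_strand x y z d b) (chords [:: c;
  x; y; z]).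
Proof. exact: perm_pulled. Qed.
Let permB : perm_eq (slid_arm c x y z d b ++ slid_strand x y z d b) (chords [:: c; x;
  y; z]).
Proof. exact: perm_slid. Qed.
Let permS : perm_eq ([:: (c, d); (c, ~~ d); (x, b)] ++ [:: (x, ~~ b)]) (chords [:: c;
  x]).
Proof. exact: perm_kink_crossing. Qed.
Let permF m : perm_eq ([:: (m, b); (c, d);
  (c, ~~ d)] ++ [:: (m, ~~ b)]) (chords [:: c; m]).
Proof. exact: perm_crossing_kink. Qed.
Let perm1 m : perm_eq ([:: (m, b)] ++ [:: (m, ~~ b)]) (chords [:: m]).
Proof. by case: (b); rewrite //= perm_sym (perm_catC [:: _] [:: _]). Qed.

(** Releasing the strand cancels [x] against [z] and leaves [y], so the diagram without the kink is
    needed under this name too. *)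
Let base_y : colourable (base y).
Proof.
have [_ _ _ [xy _ _]] := neq_xy.
have /= := colourable_rename (swapK x y) base_x; congr colourable.
have E u : {subset u <= r} -> [seq (swap x y l.1, l.2) | l <- shadow u] = shadow u.
  move=> su; have : rename (swap x y) u = u.
    by apply: rename_off; [have := off (m := x)|have := off (m := y)];
      rewrite !inE eqxx ?orbT => /(_ isT);
      apply: contra => /mapP[l /su lr ->]; apply: (map_f (fun l => l.1.1)).
  by move=> {2}<-; rewrite /shadow /rename -!map_comp.
rewrite /base map_fill !E => [|l lu|l lu|l lu]; rewrite ?mem_cat ?lu ?orbT //=.
by rewrite /swap eqxx.
Qed.

Let validA K : (count (fun m => K m == Double) [:: c; x; y;
  z] + ndouble r)%N = n -> valid n (A K).
Proof.
move=> nd; have w : wf (A K) by rewrite (wf_arcs _ permA) names4 off4.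
apply/and3P; split=> //; last by rewrite (ndouble_arcs _ permA) nd.
apply/(planarP w); rewrite shadow_fill !shadow_deco.
exact: colourable_pulled.
Qed.

Let validB K : (count (fun m => K m == Double) [:: c; x; y;
  z] + ndouble r)%N = n -> valid n (B K).
Proof.
move=> nd; have w : wf (B K) by rewrite (wf_arcs _ permB) names4 off4.
apply/and3P; split=> //; last by rewrite (ndouble_arcs _ permB) nd.
apply/(planarP w); rewrite shadow_fill !shadow_deco.
exact: colourable_slid.
Qed.

Let in4 : [/\ c \in [:: c; x; y; z], x \in [:: c; x; y; z], y \in [:: c; x; y;
  z] & z \in [:: c; x; y; z]].
Proof. by rewrite !inE !eqxx !orbT. Qed.

Let planar_base K m v w : m \in [:: c; x; y; z] -> m != c -> colourable (base m) ->
  v ++ w = fill o u0 u1 u2 (deco K [:: (m, b)]) (deco K [:: (m, ~~ b)]) ->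
  planar (shadow (v ++ kink c d (K c) ++ w)).
Proof.
move=> m4 mc cm e; have [c4 _ _ _] := in4.
have wf1 : wf (v ++ w) by rewrite e (wf_arcs _ (perm1 m)) /= off.
have c1 : c \notin names (v ++ w).
  rewrite e /names (perm_mem (perm_map _ (perm_fill _ _ _ _ _ _))) -/(names _).
  rewrite names_cat mem_cat (negPf (off c4)) orbF names_shadow -deco_cat shadow_deco /=.
  by rewrite !inE orbb eq_sym.
rewrite planar_kink_in // e; apply/planarP; first by rewrite -e.
by rewrite shadow_fill !shadow_deco.
Qed.

Let validS K : (count (fun m => K m == Double) [:: c;
  x] + ndouble r)%N = n -> valid n (S K).
Proof.
move=> nd; have [c4 x4 y4 z4] := in4; have [cx cy cz [xy xz yz]] := neq_xy.
have w : wf (S K) by rewrite (wf_arcs _ permS) /= inE cx !off.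
apply/and3P; split=> //; last by rewrite (ndouble_arcs _ permS) nd.
have xc : x != c by rewrite eq_sym.
have := planar_base (K := K) x4 xc base_x; rewrite /S /fill /=; case: o => P.
  by have := P u0 (((x, b), K x) :: u1 ++ ((x, ~~ b, K x)) :: u2) erefl.
by have := P (u0 ++ ((x, ~~ b, K x)) :: u1) (((x, b), K x) :: u2);
  rewrite -!catA /= => /(_ erefl).
Qed.

Let validF m K : m \in [:: c; x; y; z] -> m != c -> colourable (base m) ->
  (count (fun m => K m == Double) [:: c; m] + ndouble r)%N = n -> valid n (F m K).
Proof.
move=> m4 mc cm nd; have [c4 _ _ _] := in4.
have w : wf (F m K) by rewrite (wf_arcs _ (permF m)) /= inE eq_sym mc !off.
apply/and3P; split=> //; last by rewrite (ndouble_arcs _ (permF m)) nd.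
have := planar_base (K := K) m4 mc cm; rewrite /F /fill /=; case: o => P.
  by have := P (u0 ++ [:: ((m, b), K m)]) (u1 ++ ((m, ~~ b, K m)) :: u2);
    rewrite -!catA /= => /(_ erefl).
by have := P (u0 ++ ((m, ~~ b, K m)) :: u1 ++ [:: ((m, b), K m)]) u2;
  rewrite -!catA /= -!catA /= => /(_ erefl).
Qed.

Let deforms_SA lay K : K y = pass_kind lay b -> K z = pass_kind lay (~~ b) ->
  deforms (R2_move lay y z b (d != b)) (S K) (A K).
Proof.
move=> ey ez; rewrite /S /A /F /B; pose dd (m : nat) (e : bool) := ((m, e), K m).
apply: (@deforms_fill _ _ _ _ _
  [:: inr [:: dd c d]; inl ([::], [:: dd y b; dd z (~~ b)]); inr [:: dd c (~~ d);
    dd x b]]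
  (if d != b then [:: inr [:: dd x (~~ b)]; inl ([::], [:: dd y (~~ b); dd z b])]
   else [:: inl ([::], [:: dd z b; dd y (~~ b)]); inr [:: dd x (~~ b)]]));
by rewrite /pulled_strand /R2_move /Defs.arc /dd ?ey ?ez; case: (d);
  case: (b) ey ez => /= ey ez; rewrite ?ey ?ez ?perm_refl.
Qed.

Let deforms_FB lay K : K x = pass_kind lay b -> K z = pass_kind lay (~~ b) ->
  deforms (R2_move lay z x (~~ b) (d == b)) (F y K) (B K).
Proof.
move=> ey ez; rewrite /S /A /F /B; pose dd (m : nat) (e : bool) := ((m, e), K m).
apply: (@deforms_fill _ _ _ _ _
  [:: inr [:: dd y b; dd c d]; inl ([::], [:: dd z (~~ b); dd x b]);
    inr [:: dd c (~~ d)]]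
  (if d != b then [:: inr [:: dd y (~~ b)]; inl ([::], [:: dd x (~~ b); dd z b])]
   else [:: inl ([::], [:: dd z b; dd x (~~ b)]); inr [:: dd y (~~ b)]]));
by rewrite /slid_strand /R2_move /Defs.arc /dd ?ey ?ez; case: (d);
  case: (b) ey ez => /= ey ez; rewrite ?ey ?ez ?perm_refl.
Qed.

Let deforms_AB P K :
  perm_eq [:: ([:: ((c, d), K c); ((y, b), K y)], [:: ((y, b), K y); ((c, d), K c)]);
      ([:: ((c, ~~ d), K c); ((x, b), K x)], [:: ((x, b), K x); ((c, ~~ d), K c)]);
      (if d != b then ([:: ((x, ~~ b), K x); ((y, ~~ b), K y)], [:: ((y, ~~ b), K y);
        ((x, ~~ b), K x)])
       else ([:: ((y, ~~ b), K y); ((x, ~~ b), K x)], [:: ((x, ~~ b), K x);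
         ((y, ~~ b), K y)]))] P ->
  deforms P (A K) (B K).
Proof.
rewrite /A /B => e; pose dd (m : nat) (e : bool) := ((m, e), K m).
apply: (@deforms_fill _ _ _ _ _
  [:: inl ([:: dd c d; dd y b], [:: dd y b; dd c d]); inr [:: dd z (~~ b)];
      inl ([:: dd c (~~ d); dd x b], [:: dd x b; dd c (~~ d)])]
  (if d != b then [:: inl ([:: dd x (~~ b); dd y (~~ b)], [:: dd y (~~ b);
    dd x (~~ b)]); inr [:: dd z b]]
   else [:: inr [:: dd z b]; inl ([:: dd y (~~ b); dd x (~~ b)], [:: dd x (~~ b);
     dd y (~~ b)])]));
by move: e; rewrite /slid_strand /pulled_strand /mirror /rev /dd; case: (d); case: (b).
Qed.

Let flay (lay : option bool) := if lay is Some _ then Classical true else Virtual.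

Let flat_pass lay e : flat_kind (pass_kind lay e) = flay lay.
Proof. by case: lay. Qed.

Let nd K := (count (fun m => K m == Double) [:: c; x; y; z] + ndouble r)%N = n.

Let nd_flat K K' : (forall m, flat_kind (K m) = flat_kind (K' m)) -> nd K -> nd K'.
Proof.
move=> e; rewrite /nd => <-; congr (_ + _)%N; apply: eq_count => m.
by rewrite -flat_kind_Double -e flat_kind_Double.
Qed.

Let sign_arcs K K' s t : (forall m, flat_kind (K m) = flat_kind (K' m)) ->
  valid n (fill o u0 u1 u2 (deco K s) (deco K t)) ->
  valid n (fill o u0 u1 u2 (deco K' s) (deco K' t)) ->
  feq C n (fill o u0 u1 u2 (deco K s) (deco K t)) (fill o u0 u1 u2 (deco K' s) (deco
    K' t)).
Proof.
move=> e v v'; apply: feq_sign => //; rewrite !flat_fill.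
by congr fill; apply: flat_deco => l _; apply: e.
Qed.

Let signA K K' : (forall m, flat_kind (K m) = flat_kind (K' m)) -> nd K ->
  feq C n (A K) (A K').
Proof. by move=> e nk; apply: sign_arcs => //; apply: validA => //;
  apply: nd_flat nk. Qed.

Let signB K K' : (forall m, flat_kind (K m) = flat_kind (K' m)) -> nd K ->
  feq C n (B K) (B K').
Proof. by move=> e nk; apply: sign_arcs => //; apply: validB => //;
  apply: nd_flat nk. Qed.

Let flat_upd K m k : flat_kind (K m) = flat_kind k ->
  forall q, flat_kind (K q) = flat_kind (upd K m k q).
Proof. by move=> e q; rewrite /upd; case: eqP => [->|]. Qed.

(** The arc that slides meets the crossings [m1] and [m2]; they are given the kinds [k1] and [k2]
    that the move demands, and their own signs are restored on the other side. *)
Let slide2 K m1 m2 k1 k2 : m1 != m2 -> nd K ->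
  flat_kind (K m1) = flat_kind k1 -> flat_kind (K m2) = flat_kind k2 ->
  (forall K', K' m1 = k1 -> K' m2 = k2 ->
     (forall m, m != m1 -> m != m2 -> K' m = K m) ->
     exists2 P, move C P & deforms P (A K') (B K')) ->
  feq C n (A K) (B K).
Proof.
move=> m12 nk e1 e2 H; pose K' := upd (upd K m1 k1) m2 k2.
have E m : flat_kind (K m) = flat_kind (K' m).
  rewrite /K'; rewrite -flat_upd; first exact: flat_upd.
  by rewrite /upd eq_sym (negPf m12).
have [||m h1 h2|P mP dP] := H K'; rewrite /K' /upd ?eqxx ?(negPf m12) //.
  by rewrite (negPf h1) (negPf h2).
have nk' : nd K' by apply: nd_flat nk.
apply: code_rel_trans (signA E nk) _.
apply: code_rel_trans (feq_move mP dP _ _) _; [exact: validA|exact: validB|].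
by apply: code_rel_sym; apply: signB.
Qed.

(** The triangle [c], [x], [y] is read from each of its vertices in [slide_c], [slide_x], [slide_y]:
    the arc opposite to the named vertex slides, so that this vertex may be rigid. *)
Let slide_c lay K : nd K -> flat_kind (K x) = flay lay -> flat_kind (K y) = flay lay ->
  (lay != None -> K c != Virtual) -> feq C n (A K) (B K).
Proof.
move=> nk ex ey kc; have [cx cy cz [xy xz yz]] := neq_xy.
apply: (@slide2 K x y (pass_kind lay (~~ b)) (pass_kind lay (~~ b)));
  rewrite ?flat_pass //.
move=> K' kx ky kk; exists (slide_move lay (K' c) c x y (~~ d) true false (d == b)).
  by case: lay {ex ey kx ky} kc => [ov|] kc; [apply: R3_classical;
    rewrite kk ?kc|apply: R3_virtual].
apply: deforms_AB; move: kx ky; rewrite /slide_move /Defs.arc.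
by case: (d); case: (b) => /= -> ->; rewrite perm_refl.
Qed.

Let slide_x K : nd K -> is_classical (K y) -> is_classical (K c) -> K x != Virtual ->
  feq C n (A K) (B K).
Proof.
move=> nk ky kc kx; have [cx cy cz [xy xz yz]] := neq_xy.
apply: (@slide2 K y c (pass_kind (Some true) b) (pass_kind (Some true) d)) => //.
- by rewrite eq_sym.
- by case: (K y) ky.
- by case: (K c) kc.
move=> K' ky' kc' kk; exists (slide_move (Some true) (K' x) x y c (~~ d) false (d ==
  b) true).
  by apply: R3_classical; rewrite kk // eq_sym.
apply: deforms_AB; move: ky' kc'; rewrite /slide_move /Defs.arc.
by case: (d); case: (b) => /= -> ->; rewrite perm_rot3.
Qed.

Let slide_y K : nd K -> is_classical (K x) -> is_classical (K c) -> K y != Virtual ->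
  feq C n (A K) (B K).
Proof.
move=> nk kx kc ky; have [cx cy cz [xy xz yz]] := neq_xy.
apply: (@slide2 K x c (pass_kind (Some true) b) (pass_kind (Some true) (~~ d))) => //.
- by rewrite eq_sym.
- by case: (K x) kx.
- by case: (K c) kc.
move=> K' kx' kc' kk; exists (slide_move (Some true) (K' y) y c x (~~ d) (d == b) true
  false).
  by apply: R3_classical; rewrite kk // eq_sym.
apply: deforms_AB; move: kx' kc'; rewrite /slide_move /Defs.arc.
by case: (d); case: (b) => /= -> ->; rewrite perm_rot3'.
Qed.

(** Arm and strand bound a bigon with corners [x], [z] in [B], and one with corners [y], [z] in [A]:
    these are the two places where a double point can be handed on. *)
Let flype_B K K' e : nd K -> nd K' -> K z = Double -> K x = Classical e ->
  K' z = Classical e -> K' x = Double -> K' c = K c -> K' y = K y ->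
    feq C n (B K) (B K').
Proof.
move=> nk nk' kz kx kz' kx' kc ky;
  apply: feq_move (Flype C z x (~~ b) (d == b) e) _ _ _; [|exact: validB..].
rewrite /B; pose dd (J : nat -> kind) (m : nat) (f : bool) := ((m, f), J m).
apply: (@deforms_fill _ _ _ _ _
  [:: inr [:: dd K y b; dd K c d]; inl ([:: dd K z (~~ b);
    dd K x b], [:: dd K' z (~~ b); dd K' x b]);
    inr [:: dd K c (~~ d)]]
  (if d != b then [:: inr [:: dd K y (~~ b)]; inl ([:: dd K x (~~ b);
    dd K z b], [:: dd K' x (~~ b); dd K' z b])]
   else [:: inl ([:: dd K z b; dd K x (~~ b)], [:: dd K' z b; dd K' x (~~ b)]);
     inr [:: dd K y (~~ b)]]));
rewrite /slid_strand /mirror /flype_move /Defs.arc /dd /rev;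
by case: (d); case: (b) => /=; rewrite ?kz ?kx ?kz' ?kx' ?kc ?ky ?perm_refl.
Qed.

Let flype_A K K' e : nd K -> nd K' -> K y = Double -> K z = Classical e ->
  K' y = Classical e -> K' z = Double -> K' c = K c -> K' x = K x ->
    feq C n (A K) (A K').
Proof.
move=> nk nk' kz kx kz' kx' kc ky; apply: feq_move (Flype C y z b (d != b) e) _ _ _;
  [|exact: validA..].
rewrite /A; pose dd (J : nat -> kind) (m : nat) (f : bool) := ((m, f), J m).
apply: (@deforms_fill _ _ _ _ _
  [:: inr [:: dd K c d]; inl ([:: dd K y b; dd K z (~~ b)], [:: dd K' y b;
    dd K' z (~~ b)]);
    inr [:: dd K c (~~ d); dd K x b]]
  (if d != b then [:: inr [:: dd K x (~~ b)]; inl ([:: dd K y (~~ b);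
    dd K z b], [:: dd K' y (~~ b); dd K' z b])]
   else [:: inl ([:: dd K z b; dd K y (~~ b)], [:: dd K' z b; dd K' y (~~ b)]);
     inr [:: dd K x (~~ b)]]));
rewrite /pulled_strand /mirror /flype_move /Defs.arc /dd /rev;
by case: (d); case: (b) => /=; rewrite ?kz ?kx ?kz' ?kx' ?kc ?ky ?perm_refl.
Qed.

Let nd_cx K : K y != Double -> K z != Double -> nd K ->
  (count (fun m => K m == Double) [:: c; x] + ndouble r)%N = n.
Proof. by move=> /negPf ky /negPf kz; rewrite /nd /= ky kz. Qed.

Let nd_cy K : K x != Double -> K z != Double -> nd K ->
  (count (fun m => K m == Double) [:: c; y] + ndouble r)%N = n.
Proof. by move=> /negPf kx /negPf kz; rewrite /nd /= kx kz. Qed.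

Let flay_Double lay k : flat_kind k = flay lay -> k != Double.
Proof. by case: lay k => [?|] []. Qed.

Let pull lay K : nd K -> flat_kind (K y) = flay lay -> flat_kind (K z) = flay lay ->
  feq C n (S K) (A K).
Proof.
move=> nk ey ez; have [cx cy cz [xy xz yz]] := neq_xy.
pose K' := upd (upd K y (pass_kind lay b)) z (pass_kind lay (~~ b)).
have E m : flat_kind (K m) = flat_kind (K' m).
  rewrite /K' -flat_upd; first by apply: flat_upd; rewrite flat_pass.
  by rewrite /upd eq_sym (negPf yz) flat_pass.
have nk' : nd K' by apply: nd_flat nk.
have vS : valid n (S K) by apply: validS; apply: nd_cx nk; apply: (@flay_Double lay).
have vS' : valid n (S K').
  by apply: validS; apply: nd_cx nk'; apply: (@flay_Double lay); rewrite -E.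
apply: code_rel_trans (sign_arcs E vS vS') _.
apply: code_rel_trans (code_rel_sym (signA E nk)).
apply: feq_move (R2 C lay y z b (d != b)) _ vS' (validA nk').
by apply: deforms_SA; rewrite /K' /upd ?eqxx ?(negPf yz).
Qed.

Let unpull lay K : nd K -> flat_kind (K x) = flay lay -> flat_kind (K z) = flay lay ->
  feq C n (F y K) (B K).
Proof.
move=> nk ey ez; have [cx cy cz [xy xz yz]] := neq_xy.
pose K' := upd (upd K x (pass_kind lay b)) z (pass_kind lay (~~ b)).
have E m : flat_kind (K m) = flat_kind (K' m).
  rewrite /K' -flat_upd; first by apply: flat_upd; rewrite flat_pass.
  by rewrite /upd eq_sym (negPf xz) flat_pass.
have nk' : nd K' by apply: nd_flat nk.
have [_ _ y4 _] := in4; have yc : y != c by rewrite eq_sym.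
have vS : valid n (F y K) by apply: validF => //; apply: nd_cy nk;
  apply: (@flay_Double lay).
have vS' : valid n (F y K').
  by apply: validF => //; apply: nd_cy nk'; apply: (@flay_Double lay); rewrite -E.
apply: code_rel_trans (sign_arcs E vS vS') _.
apply: code_rel_trans (code_rel_sym (signB E nk)).
apply: feq_move (R2 C lay z x (~~ b) (d == b)) _ vS' (validB nk').
by apply: deforms_FB; rewrite /K' /upd ?eqxx ?(negPf xz).
Qed.

(** The crossing left at the end is [y] instead of [x]; the two names are exchanged, and only the
    flat kind of the crossing has to be respected. *)
Let relabel K K' : flat_kind (K y) = flat_kind (K' x) -> K' c = K c ->
  valid n (F y K) -> valid n (F x K') -> feq C n (F y K) (F x K').
Proof.
move=> kyx kc v v'; have [cx cy cz [xy xz yz]] := neq_xy; have [c4 x4 y4 _] := in4.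
have offu u : {subset u <= r} -> rename (swap x y) u = u.
  move=> su; apply: rename_off; [have := off x4|have := off y4];
    by apply: contra => /mapP[l /su lr ->]; apply: (map_f (fun l => l.1.1)).
pose K2 := upd K x (K y).
have e : rename (swap x y) (F y K) = F x K2.
  have e0 : rename (swap x y) u0 = u0 by apply: offu => l lu; rewrite !mem_cat lu.
  have e1 : rename (swap x y) u1 = u1 by apply: offu => l lu; rewrite !mem_cat lu orbT.
  have e2 : rename (swap x y) u2 = u2 by apply: offu => l lu; rewrite !mem_cat lu !orbT.
  rewrite /F rename_fill e0 e1 e2.
  by rewrite /= /K2 /upd /swap !eqxx (negPf cx) (negPf cy) [y == x]eq_sym (negPf xy).
have kk m : m \in [:: c; x] -> flat_kind (K2 m) = flat_kind (K' m).
  rewrite !inE /K2 /upd => /orP[]/eqP->; first by rewrite (negPf cx) kc.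
  by rewrite eqxx.
have fE : flat_code (F x K2) = flat_code (F x K').
  rewrite /F !flat_fill; congr fill; apply: flat_deco => l /(map_f fst) /=;
    rewrite !inE => h;
  by apply: kk; move: h; rewrite !inE; do 2 case: eqP => //=.
have v2 : valid n (F x K2).
  case/and3P: v' => w' p' n'.
  have nE : ndouble (F x K2) = ndouble (F x K').
    rewrite !(ndouble_arcs _ (permF x)) /=; have := kk x; have := kk c;
      rewrite !inE !eqxx orbT.
    by move=> /(_ isT) h /(_ isT) h';
      rewrite -!(flat_kind_Double (K2 _)) h h' !flat_kind_Double.
  by rewrite /valid nE n' (wf_arcs _ (permF x)) -(wf_arcs K' (permF x)) w' shadow_fill
    !shadow_deco -(shadow_deco K' [:: _; _;
    _]) -(shadow_deco K' [:: (x, ~~ b)]) -shadow_fill p'.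
apply: (code_rel_trans _ (feq_sign C v2 v' fE)).
rewrite -e; apply: ieq_feq; apply: ieq_rename => //; last by rewrite e.
exact: inv_inj (swapK x y).
Qed.

Lemma double_kink_pass_local kc kx : kc = Double -> kx != Double ->
  (1 + ndouble r)%N = n ->
  let K m := if m == c then kc else kx in feq C n (S K) (F x K).
Proof.
move=> ekc nkx nr K; have [cx cy cz [xy xz yz]] := neq_xy; have [c4 x4 y4 z4] := in4.
have xc : x != c by rewrite eq_sym.
have yc : y != c by rewrite eq_sym.
have zc : z != c by rewrite eq_sym.
have [Kc Kx Ky Kz] : [/\ K c = kc, K x = kx, K y = kx & K z = kx].
  by rewrite /K eqxx (negPf xc) (negPf yc) (negPf zc).
have nk : nd K by rewrite /nd /= Kc Kx Ky Kz ekc (negPf nkx) -nr.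
(* The strand crosses the loop in the manner of [x]: virtually if [x] is virtual, as an overpass
   otherwise. *)
pose lay := if kx == Virtual then None else Some true.
have fl : flat_kind kx = flay lay by rewrite /lay; case: kx nkx {K Kc Kx Ky Kz nk lay}.
apply: (code_rel_trans (@pull lay _ nk _ _)); rewrite ?Ky ?Kz //.
apply: (code_rel_trans (@slide_c lay _ nk _ _ _)); rewrite ?Kx ?Ky ?Kc ?ekc //.
apply: (code_rel_trans (code_rel_sym (@unpull lay _ nk _ _))); rewrite ?Kx ?Kz //.
apply: relabel => //; first by rewrite Ky Kx.
- by apply: validF => //; rewrite /= Kc Ky ekc (negPf nkx) -nr.
- by apply: validF => //; rewrite /= Kc Kx ekc (negPf nkx) -nr.
Qed.

(* The crossing strand is attached to the rigid vertex [x], so it cannot be slid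
   off the kink as in the previous lemma: two flypes carry the double point along
   it from [x] to [y] through [z], with a triangle move before, between and after. *)
Lemma kink_pass_double_local kc kx : is_classical kc -> kx = Double ->
  (1 + ndouble r)%N = n ->
  let K m := if m == c then kc else kx in feq C n (S K) (F x K).
Proof.
move=> ekc ekx nr K; have [cx cy cz [xy xz yz]] := neq_xy; have [c4 x4 y4 z4] := in4.
have xc : x != c by rewrite eq_sym.
have yc : y != c by rewrite eq_sym.
have zc : z != c by rewrite eq_sym.
have nkc : kc == Double = false by case: kc ekc {K}.
pose J (q : nat) m := if m == c then kc else if m == q then Double else Classical true.
have Jc q : J q c = kc by rewrite /J eqxx.
have Jq q : q != c -> J q q = Double by rewrite /J eqxx => /negPf ->.
have Jn q m : m != c -> m != q -> J q m = Classical true by rewrite /J =>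
  /negPf -> /negPf ->.
have yx : y != x by rewrite eq_sym.
have zx : z != x by rewrite eq_sym.
have zy : z != y by rewrite eq_sym.
have nJ q : q \in [:: x; y; z] -> nd (J q).
  rewrite !inE /nd /= Jc nkc => /or3P[]/eqP->;
  by rewrite ?Jq ?(Jn _ x) ?(Jn _ y) ?(Jn _ z) // -nr.
have [nx ny nz] : [/\ nd (J x), nd (J y) & nd (J z)] by split; apply: nJ;
  rewrite !inE eqxx ?orbT.
have eS : S K = S (J x).
  by rewrite /S /K /J /= ekx; congr (fill _ _ _ _ _ _);
    rewrite /deco /= ?eqxx ?(negPf xc).
have eF : F x K = F x (J x).
  by rewrite /F /K /J /= ekx; congr (fill _ _ _ _ _ _);
    rewrite /deco /= ?eqxx ?(negPf xc).
rewrite eS eF.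
apply: (code_rel_trans (@pull (Some true) _ nx _ _)); rewrite ?Jn //.
apply: (code_rel_trans (@slide_x _ nx _ _ _)); rewrite ?Jc ?Jq ?Jn //.
apply: (code_rel_trans (code_rel_sym (@flype_B (J z) _ true nz nx _ _ _ _ _ _)));
  rewrite ?Jc ?Jq ?Jn //.
(* The triangle move is undone here because [y] and [z] bound a bigon only in the pulled
   position. *)
apply: (code_rel_trans (code_rel_sym (@slide_c (Some true) _ nz _ _ _)));
  rewrite ?Jc ?Jq ?Jn //.
  by move=> _; case: kc ekc {K nkc J Jc Jq Jn nJ nx ny nz eS eF}.
apply: (code_rel_trans (code_rel_sym (@flype_A (J y) _ true ny nz _ _ _ _ _ _)));
  rewrite ?Jc ?Jq ?Jn //.
apply: (code_rel_trans (@slide_y _ ny _ _ _)); rewrite ?Jc ?Jq ?Jn //.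
apply: (code_rel_trans (code_rel_sym (@unpull (Some true) _ ny _ _))); rewrite ?Jn //.
apply: relabel; rewrite ?Jc ?Jq //.
- by apply: validF => //; rewrite /= Jc Jq // nkc -nr.
- by apply: validF => //; rewrite /= Jc Jq // nkc -nr.
Qed.
End KinkPass.

(** * Double kinks: place, rotation, exchange with a classical kink *)

Lemma perm_kink c d k u v : perm_eq (u ++ kink c d k ++ v) (kink c d k ++ (u ++ v)).
Proof. by rewrite perm_catCA. Qed.

Lemma wf_kink_in c d k u v : wf (u ++ kink c d k ++ v) = (c \notin names (u ++ v)) &&
  wf (u ++ v).
Proof. by rewrite (wf_perm (perm_kink _ _ _ _ _)) wf_kink. Qed.

Lemma ndouble_kink c d k w : ndouble (kink c d k ++ w) = ((k == Double) + ndouble w)%N.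
Proof. by rewrite /ndouble count_cat /=; case: d; case: (k == Double). Qed.

Lemma valid_kink_in n c d k u v : c \notin names (u ++ v) ->
  valid ((k == Double) + n) (u ++ kink c d k ++ v) = valid n (u ++ v).
Proof.
move=> cu; rewrite /valid wf_kink_in cu /=.
case w: (wf (u ++ v)) => //=; rewrite planar_kink_in //.
by rewrite (ndouble_perm (perm_kink _ _ _ _ _)) ndouble_kink eqn_add2l.
Qed.

Lemma valid_double_kink c d u v : c \notin names (u ++ v) ->
  valid 1 (u ++ kink c d Double ++ v) = valid 0 (u ++ v).
Proof. exact: (@valid_kink_in 0 c d Double). Qed.

Lemma valid_crossing_kink n c d k u v : k != Double -> c \notin names (u ++ v) ->
  valid n (u ++ kink c d k ++ v) = valid n (u ++ v).
Proof. by move=> nk cu; rewrite -(@valid_kink_in n c d k u v) // (negPf nk). Qed.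

Lemma valid_kink_notin n c d k u v : valid n (u ++ kink c d k ++ v) ->
  c \notin names (u ++ v).
Proof. by case/and3P; rewrite wf_kink_in => /andP[]. Qed.

Lemma fresh_pair (ms : seq nat) : exists y z, [/\ y != z, y \notin ms & z \notin ms].
Proof.
pose N := \max_(m <- ms) m.
have H m k : m \in ms -> m != (N + k.+1)%N.
  move=> mm; have := @leq_bigmax_seq _ ms xpredT id m mm isT.
  by apply: contraTneq => ->; rewrite -ltnNge /= addnS ltnS leq_addr.
by exists (N + 1)%N, (N + 2)%N; split;
  [rewrite eqn_add2l|apply/negP => /(H _ 0)|apply/negP=> /(H _ 1%N)]; rewrite ?eqxx.
Qed.

Lemma names_perm w w' : perm_eq w w' -> names w =i names w'.
Proof. by move=> e; apply: perm_mem; apply: perm_map. Qed.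

Lemma kink_pass C n u v c d kc x b kx :
    valid n (u ++ kink c d kc ++ ((x, b), kx) :: v) ->
    kc = Double /\ kx != Double \/ is_classical kc /\ kx = Double ->
  feq C n (u ++ kink c d kc ++ ((x, b), kx) :: v) (u ++ ((x, b),
    kx) :: kink c d kc ++ v).
Proof.
move=> vw kk; have /and3P[ww pw /eqP nw] := vw.
have /andP[cw w1] : (c \notin names (u ++ ((x, b), kx) :: v)) &&
  wf (u ++ ((x, b), kx) :: v).
  by rewrite -(wf_kink_in c d kc).
have [o [u0 [u1 [u2 [e1 e2 e3]]]]] : exists o u0 u1 u2,
    [/\ u ++ ((x, b), kx) :: v = fill o u0 u1 u2 [:: ((x, b), kx)] [:: ((x, ~~ b), kx)],
      u ++ kink c d kc ++ ((x, b), kx) :: v = fill o u0 u1 u2 (kink c d kc ++ [:: ((x,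
        b), kx)]) [:: ((x, ~~ b), kx)]
    & u ++ ((x, b), kx) :: kink c d kc ++ v = fill o u0 u1 u2 (((x, b),
      kx) :: kink c d kc) [:: ((x, ~~ b), kx)]].
  have /andP[_ /allP clw] := w1.
  have := clw ((x, b), kx); rewrite mem_cat mem_head orbT => /(_ isT).
  rewrite mem_cat inE => /orP[|/predU1P[[]|]].
  - case/splitPr=> u0 u1; exists false, u0, u1, v.
    by rewrite /fill -!catA.
  - by case: (b).
  - case/splitPr=> u1 u2; exists true, u, u1, u2.
    by rewrite /fill.
have pe : perm_eq (u ++ ((x, b), kx) :: v) (kink x b kx ++ (u0 ++ u1 ++ u2)).
  by rewrite e1 (permPl (perm_fill _ _ _ _ _ _)).
move: (w1); rewrite (wf_perm pe) wf_kink => /andP[xr wr].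
move: cw; rewrite (names_perm pe) inE negb_or /= inE negb_or => /and3P[cx _ cr].
(* Names for the two crossings created when the transverse strand is pulled over the loop. *)
have [y [z [yz yn zn]]] := fresh_pair (c :: x :: names (u0 ++ u1 ++ u2)).
move: yn zn; rewrite !inE !negb_or => /and3P[yc yx yr] /and3P[zc zx zr].
have n4 : uniq [:: c; x; y; z].
  by rewrite /= !inE !negb_or cx ![c == _]eq_sym yc zc ![x == _]eq_sym yx zx yz.
have off4 : all (fun m => m \notin names (u0 ++ u1 ++ u2)) [:: c; x; y; z].
  by rewrite /= cr xr yr zr.
have bx : colourable (fill o (shadow u0) (shadow u1) (shadow u2) [:: (x, b)] [:: (x,
  ~~ b)]).
  have -> : fill o (shadow u0) (shadow u1) (shadow u2) [:: (x, b)] [:: (x, ~~ b)] =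
    shadow (u ++ ((x, b), kx) :: v) by rewrite e1 shadow_fill.
  apply/(planarP w1); rewrite -(@planar_kink_in c d kc) //.
  by rewrite (names_perm pe) names_cat mem_cat /= !inE (negPf cx) (negPf cr).
rewrite e2 e3; have nr : ((kc == Double) + (kx == Double) + ndouble (u0 ++ u1 ++
  u2))%N = n.
  rewrite -nw (ndouble_perm (perm_kink _ _ _ _ _)) ndouble_kink.
  by rewrite (ndouble_perm pe) ndouble_kink addnA.
case: kk => [[ekc nkx]|[ekc ekx]].
  have nr' : (1 + ndouble (u0 ++ u1 ++ u2))%N = n by rewrite -nr ekc (negPf nkx).
  have := double_kink_pass_local C d wr n4 off4 bx ekc nkx nr'.
  by rewrite /deco /= eqxx ![x == c]eq_sym (negPf cx).
have nr' : (1 + ndouble (u0 ++ u1 ++ u2))%N = n by rewrite -nr ekx;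
  case: kc ekc {e2 e3 nr vw ww pw nw}.
have := kink_pass_double_local C d wr n4 off4 bx ekc ekx nr'.
by rewrite /deco /= eqxx ![x == c]eq_sym (negPf cx).
Qed.

Lemma valid0_not_double w l : valid 0 w -> l \in w -> l.2 != Double.
Proof.
case: l => [[x b] k] /and3P[ww _ nw] lw; apply: contraTneq nw => /= ek; subst k.
rewrite -lt0n -has_count; have [_ /allP/(_ _ lw) h] := andP ww.
by apply/hasP; exists (x, true, Double) => //; case: b lw h.
Qed.

(** Without other double points every passage is classical or virtual, so [kink_pass] moves the kink
    by one passage at a time. No first Reidemeister move occurs, and both categories are covered. *)
Lemma double_kink_slide C c d u v w : valid 0 (u ++ v ++ w) ->
  c \notin names (u ++ v ++ w) ->
  feq C 1 (u ++ kink c d Double ++ v ++ w) (u ++ v ++ kink c d Double ++ w).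
Proof.
elim: v u => [|[[x b] k] v IH] u vw cw.
  by apply: code_rel_refl; rewrite valid_double_kink.
have nk : k != Double.
  by apply: (@valid0_not_double _ ((x, b), k) vw); rewrite mem_cat mem_head orbT.
have e : (u ++ [:: (x, b, k)]) ++ v ++ w = u ++ (x, b, k) :: v ++ w by rewrite -catA.
apply: (code_rel_trans (@kink_pass _ _ u (v ++ w) c d Double x b k _ _)).
- by rewrite valid_double_kink.
- by left.
have := IH (u ++ [:: (x, b, k)]); rewrite e => /(_ vw cw).
by rewrite -!catA.
Qed.

Lemma double_kink_rename C c c' d w : valid 0 w -> c \notin names w ->
  c' \notin names w ->
  feq C 1 (kink c d Double ++ w) (kink c' d Double ++ w).
Proof.
move=> v cw c'w; have e : rename (swap c c') (kink c d Double ++ w) = kink c' d Double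
  ++ w.
  rewrite /rename map_cat -/(rename _ w) rename_off //=.
  by rewrite /swap eqxx.
rewrite -e; apply: ieq_feq; apply: ieq_rename; rewrite ?e.
- exact: inv_inj (swapK c c').
- by rewrite (@valid_double_kink c d [::]).
- by rewrite (@valid_double_kink c' d [::]).
Qed.

(** A classical kink of opposite rotation inside the loop of the double kink makes [c] and [y] the
    corners of a bigon. The flype gives the double point to the inner kink, which then slides out of
    the loop past [c]. *)
Lemma double_kink_flype C c d y e u v : valid 0 (u ++ v) ->
    c != y -> c \notin names (u ++ v) -> y \notin names (u ++ v) ->
  feq C 1 (u ++ ((c, d), Double) :: kink y (~~ d) (Classical e) ++ ((c, ~~ d),
    Double) :: v)
    (u ++ kink c d (Classical e) ++ kink y (~~ d) Double ++ v).
Proof.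
move=> vw cy cw yw.
have nest k k' : valid ((k == Double) + (k' == Double))
    (u ++ ((c, d), k) :: kink y (~~ d) k' ++ ((c, ~~ d), k) :: v).
  have -> : u ++ ((c, d), k) :: kink y (~~ d) k' ++ ((c, ~~ d), k) :: v =
    (u ++ [:: ((c, d), k)]) ++ kink y (~~ d) k' ++ ((c, ~~ d), k) :: v by rewrite -catA.
  rewrite addnC valid_kink_in -?catA /=; last first.
    move: yw; rewrite !names_cat !mem_cat /= !inE !negb_or => /andP[-> ->].
    by rewrite [y == c]eq_sym cy.
  by rewrite -[nat_of_bool _]addn0 -(@valid_kink_in 0 c d k u v) // in vw *.
apply: (@code_rel_trans _ _ _ (u ++ ((c, d),
  Classical e) :: kink y (~~ d) Double ++ ((c, ~~ d), Classical e) :: v)).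
  apply: feq_move (Flype C c y d false e) _ (nest Double (Classical e)) (nest
    (Classical e) Double).
  apply: (@deforms_context _ [::
    inl ([:: ((c, d), Double); ((y, ~~ d), Classical e)], [:: ((c, d), Classical e);
      ((y, ~~ d), Double)]);
    inl ([:: ((y, ~~ ~~ d), Classical e);
      ((c, ~~ d), Double)], [:: ((y, ~~ ~~ d), Double);
      ((c, ~~ d), Classical e)])] u v) => //.
  by rewrite /flype_move /= negbK.
have := @kink_pass C 1 (u ++ [:: ((c, d),
  Classical e)]) v y (~~ d) Double c (~~ d) (Classical e).
rewrite -!catA /=; apply; last by left.
exact: (nest (Classical e) Double).
Qed.

Lemma feq_R1 n c d e u v : valid n (u ++ v) -> c \notin names (u ++ v) ->
  feq Unframed n (u ++ v) (u ++ kink c d (Classical e) ++ v).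
Proof.
move=> vw cw; apply: (feq_move (R1_classical c d e erefl) _ vw).
  exact: (@deforms_context _ [:: inl ([::], kink c d (Classical e))] u v).
by rewrite valid_crossing_kink.
Qed.

(** A kink of opposite rotation is created inside the loop, the flype makes it the double one, and
    the old kink, now classical, is removed. Both the creation and the removal are first
    Reidemeister moves of the unframed category. *)
Lemma double_kink_turn c d w : valid 0 w -> c \notin names w ->
  feq Unframed 1 (kink c d Double ++ w) (kink c (~~ d) Double ++ w).
Proof.
move=> vw cw; have [y [_ [_ + _]]] := fresh_pair (c :: names w).
rewrite inE negb_or => /andP[yc yw].
have yk : y \notin names (kink c d Double ++ w) by rewrite /= !inE !negb_or yc.
apply: (code_rel_trans (@feq_R1 1 y (~~ d) true [:: ((c, d), Double)] (((c, ~~ d),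
  Double) :: w) _ yk)).
  by rewrite -[_ ++ _]/([::] ++ kink c d Double ++ w) valid_double_kink.
rewrite eq_sym in yc.
apply: (code_rel_trans (@double_kink_flype _ c d y true [::] w vw yc cw yw)).
apply: (code_rel_trans (code_rel_sym (@feq_R1 1 c d true [::] (kink y (~~ d) Double ++
  w) _ _))).
- by rewrite (@valid_double_kink y _ [::]).
- by rewrite /= !inE !negb_or yc.
exact: double_kink_rename.
Qed.

(** This is the independence of [K^0_sing] from the kink: it slides to the front, takes the new
    name, and is turned if its rotation is wrong. *)
Lemma double_kink_anywhere c c' d d' u v : valid 0 (u ++ v) ->
    c \notin names (u ++ v) -> c' \notin names (u ++ v) ->
  feq Unframed 1 (u ++ kink c d Double ++ v) (kink c' d' Double ++ u ++ v).
Proof.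
move=> vw cw c'w.
apply: (code_rel_trans (code_rel_sym (@double_kink_slide _ c d [::] u v vw cw))).
apply: (code_rel_trans (@double_kink_rename _ c c' d (u ++ v) vw cw c'w)).
case: (eqVneq d d') => [<-|dd']; first by apply: code_rel_refl;
  rewrite (@valid_double_kink c' _ [::]).
have -> : d' = ~~ d by case: d d' dd' => [] [].
exact: double_kink_turn.
Qed.

(* For kinks of the same rotation the double one slides past the other; for
   opposite rotations the classical one enters the loop of the double one, where
   a flype exchanges them. *)
Lemma kink_pair_exchange C x y d d' e e' u v : valid 0 (u ++ v) -> x != y ->
    x \notin names (u ++ v) -> y \notin names (u ++ v) ->
  feq C 1 (u ++ kink x d Double ++ kink y d' (Classical e') ++ v)
          (u ++ kink x d (Classical e) ++ kink y d' Double ++ v).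
Proof.
move=> vw xy xw yw.
have yx : y != x by rewrite eq_sym.
have nin a b b' k s t : a != b -> a \notin names (s ++ t) ->
  a \notin names (s ++ kink b b' k ++ t).
  by move=> ab; rewrite !names_cat !mem_cat /= !inE !negb_or => /andP[-> ->];
    rewrite ab.
have valid_pair a b f f' k k' : a != b -> a \notin names (u ++ v) ->
  b \notin names (u ++ v) ->
    valid ((k == Double) + (k' == Double)) (u ++ kink a f k ++ kink b f' k' ++ v).
  move=> ab aw bw; rewrite valid_kink_in; last exact: nin.
  by rewrite -[nat_of_bool _]addn0 (@valid_kink_in 0 b f' k' u v).
have [ed|nd] := eqVneq d' d.
  rewrite ed; have vy : valid 0 (u ++ kink y d (Classical e') ++ v).
    by rewrite valid_crossing_kink.
  have xy' := nin x y d (Classical e') u v xy xw.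
  apply: (code_rel_trans (@double_kink_slide C x d u (kink y d (Classical e')) v vy
    xy')).
  have offs s : {subset s <= u ++ v} -> rename (swap x y) s = s.
    move=> ss; apply: rename_off; [apply: contra xw|apply: contra yw];
    by case/mapP=> l /ss ls ->; apply: (map_f (fun l => l.1.1)).
  have eu : rename (swap x y) u = u by apply: offs => l lu; rewrite mem_cat lu.
  have ev : rename (swap x y) v = v by apply: offs => l lu; rewrite mem_cat lu orbT.
  have E : rename (swap x y) (u ++ kink y d (Classical e') ++ kink x d Double ++ v) =
    u ++ kink x d (Classical e') ++ kink y d Double ++ v.
    rewrite /rename !map_cat -!/(rename _ _) eu ev /=.
    by rewrite /swap eqxx (negPf yx) eqxx.
  apply: (@code_rel_trans _ _ _ (u ++ kink x d (Classical e') ++ kink y d Double ++ v)).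
    rewrite -E; apply: ieq_feq; apply: ieq_rename; rewrite ?E.
    - exact: inv_inj (swapK x y).
    - exact: (valid_pair y x d d (Classical e') Double).
    - exact: (valid_pair x y d d (Classical e') Double).
  apply: feq_sign; [exact: (valid_pair x y d d (Classical e') Double)|exact:
    (valid_pair x y d d (Classical e) Double)|].
  by rewrite /flat_code !map_cat.
have {nd}-> : d' = ~~ d by case: d d' nd => [] [].
apply: (code_rel_trans _ (@double_kink_flype C x d y e u v vw xy xw yw)).
apply: (@code_rel_trans _ _ _ (u ++ ((x, d),
  Double) :: kink y (~~ d) (Classical e') ++ ((x, ~~ d), Double) :: v)).
  apply: code_rel_sym.
  have := @kink_pass C 1 (u ++ [:: ((x, d),
    Double)]) v y (~~ d) (Classical e') x (~~ d) Double.
  rewrite -!catA /=; apply; last by right.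
  have := @valid_crossing_kink 1 y (~~ d) (Classical e') (u ++ [:: ((x, d),
    Double)]) (((x, ~~ d), Double) :: v).
  rewrite -!catA /= => ->//; last exact: (nin y x d Double).
  by rewrite (@valid_double_kink x d u v).
have vn f : valid 1 (u ++ ((x, d), Double) :: kink y (~~ d) (Classical f) ++ ((x,
  ~~ d), Double) :: v).
  have := @valid_crossing_kink 1 y (~~ d) (Classical f) (u ++ [:: ((x, d),
    Double)]) (((x, ~~ d), Double) :: v).
  rewrite -!catA /= => ->//; last exact: (nin y x d Double).
  by rewrite (@valid_double_kink x d u v).
by apply: feq_sign => //; rewrite /flat_code !map_cat.
Qed.

Import GRing.Theory.

(** * Invariance of the glueing sum *)

Definition arcs_before (P : tangle_move) : code := flatten [seq p.1 | p <- P].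

Definition arcs_after (P : tangle_move) : code := flatten [seq p.2 | p <- P].

Lemma mem_chords ns c b : ((c, b) \in chords ns) = (c \in ns).
Proof.
elim: ns => //= n ns IH; rewrite !inE IH !xpair_eqE.
by case: (b); case: (c == n); rewrite ?andbF.
Qed.

Lemma uniq_chords ns : uniq (chords ns) -> uniq ns.
Proof.
elim: ns => //= n ns IH; rewrite inE negb_or mem_chords => /and3P[/andP[_ h] _ u].
by rewrite h IH.
Qed.

Lemma perm_flatten_zip (Q : tangle_move) (us : seq code) (f : code * code -> code) :
  size us = size Q ->
  perm_eq (flatten [seq f z.1 ++ z.2 | z <- zip Q us]) (flatten [seq f q | q <- Q] ++
    flatten us).
Proof.
elim: Q us => [|q Q IH] [|u us] //= [s].
by rewrite -!catA perm_cat2l perm_sym perm_catCA perm_cat2l perm_sym; apply: IH.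
Qed.

Lemma perm_flatten (T : eqType) (ss tt : seq (seq T)) : perm_eq ss tt ->
  perm_eq (flatten ss) (flatten tt).
Proof.
move=> e; apply/permP=> a; rewrite !count_flatten.
by rewrite !sumnE; apply: perm_big; apply: perm_map.
Qed.

Lemma deforms_rest P w w' : deforms P w w' -> exists Q u0 us,
  [/\ perm_eq Q P, size us = size Q,
      w = u0 ++ flatten [seq z.1.1 ++ z.2 | z <- zip Q us],
      w' = u0 ++ flatten [seq z.1.2 ++ z.2 | z <- zip Q us] &
      perm_eq w (arcs_before P ++ u0 ++ flatten us) /\
      perm_eq w' (arcs_after P ++ u0 ++ flatten us)].
Proof.
case=> Q [u0 [us [e s ew ew']]]; exists Q, u0, us; split=> //; split.
  rewrite ew perm_sym perm_catCA perm_cat2l perm_sym.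
  apply: perm_trans (perm_flatten_zip fst s) _; rewrite perm_cat2r.
  by apply: perm_flatten; apply: perm_map.
rewrite ew' perm_sym perm_catCA perm_cat2l perm_sym.
apply: perm_trans (perm_flatten_zip snd s) _; rewrite perm_cat2r.
by apply: perm_flatten; apply: perm_map.
Qed.

Lemma arcs_off ns (a v w : code) : wf w -> perm_eq w (a ++ v) ->
  perm_eq (shadow a) (chords ns) ->
  uniq ns /\ forall c, c \in ns -> c \notin names v.
Proof.
case/andP=> uw _ e ea; move: uw; rewrite (perm_uniq (perm_map fst e)) map_cat cat_uniq.
rewrite -!/(shadow _) (perm_uniq ea) => /and3P[/uniq_chords un /hasPn h _];
  split=> // c cn.
apply/negP=> /mapP[[[c' b] k] lv ec]; rewrite /= in ec; subst c'.
have /h : (c, b) \in shadow v by apply: (map_f fst lv).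
by rewrite (perm_mem ea) mem_chords cn.
Qed.

Lemma perm_arc (o : bool) (l l' : nat * bool * kind) : perm_eq (Defs.arc o l l') [::
  l; l'].
Proof. by case: o => //=; exact/permPl/(perm_catC [:: l'] [:: l]). Qed.

Lemma perm_R2_arcs layer x y d o : perm_eq (shadow (arcs_after (R2_move layer x y d
  o))) (chords [:: x; y]).
Proof.
apply/permP=> p; case: d; case: o => /=; 
move: (nat_of_bool (p (x, true))) (nat_of_bool (p (x, false))) (nat_of_bool (p (y,
  true))) (nat_of_bool (p (y, false))) => *; lia.
Qed.

Lemma perm_flype_arcs x y d o e :
  perm_eq (shadow (arcs_before (flype_move x y d o e))) (chords [:: x; y]) /\
  perm_eq (shadow (arcs_after (flype_move x y d o e))) (chords [:: x; y]).
Proof.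
split; apply/permP=> p; case: d; case: o => /=; 
move: (nat_of_bool (p (x, true))) (nat_of_bool (p (x, false))) (nat_of_bool (p (y,
  true))) (nat_of_bool (p (y, false))) => *; lia.
Qed.

Lemma perm_slide_arcs layer k x y z t f1 f2 f3 :
  perm_eq (shadow (arcs_before (slide_move layer k x y z t f1 f2 f3))) (chords [:: x;
    y; z]) /\
  perm_eq (arcs_after (slide_move layer k x y z t f1 f2 f3)) (arcs_before (slide_move
    layer k x y z t f1 f2 f3)).
Proof.
split; last first.
  by rewrite /arcs_after /arcs_before /= !cats0;
    rewrite !(perm_cat, permPl (perm_arc _ _ _)) // perm_sym perm_arc.
rewrite /arcs_before /= cats0.
move: (t (+) f1 (+) f2) (t (+) f2 (+) f3) (t (+) f3 (+) f1) => d1 d2 d3.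
apply: (@perm_trans _ [:: (x, d1); (z, ~~ d3); (y, d2); (x, ~~ d1); (z, d3);
  (y, ~~ d2)]).
  by rewrite /shadow !map_cat; do ?[apply: (@perm_cat _ _ [:: _; _])];
    exact: (perm_map fst (perm_arc _ _ _)).
apply/permP=> p; case: d1; case: d2; case: d3 => /=;
  move: (nat_of_bool (p (x, true))) (nat_of_bool (p (x, false))) (nat_of_bool (p (y,
    true))) (nat_of_bool (p (y, false)))
  (nat_of_bool (p (z, true))) (nat_of_bool (p (z, false)))=> *; lia.
Qed.

Lemma perm_R1_arcs x d k : perm_eq (shadow (kink x d k)) (chords [:: x]).
Proof. by case: d; rewrite //; exact/permPl/(perm_catC [:: (x, false)] [:: (x,
  true)]). Qed.

Lemma move_chords C P : move C P ->
  exists ns, perm_eq (shadow (arcs_after P)) (chords ns) /\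
    (arcs_before P = [::] \/ perm_eq (shadow (arcs_before P)) (chords ns)).
Proof.
case=> [x d e _|x y d d' e _|x d|l x y d o|k x y z t f1 f2 f3|ov k x y z t f1 f2 f3
  _|x y d o e].
- by exists [:: x]; split; [apply: perm_R1_arcs|left].
- exists [:: x; y]; split; last by left.
  exact: (perm_cat (perm_R1_arcs x d Virtual) (perm_R1_arcs y d' Virtual)).
- by exists [:: x]; split; [apply: perm_R1_arcs|left].
- by exists [:: x; y]; split; [apply: perm_R2_arcs|left].
- have [e1 e2] := perm_slide_arcs None k x y z t f1 f2 f3.
  by exists [:: x; y; z]; split; [apply: perm_trans (perm_map fst e2) e1|right].
- have [e1 e2] := perm_slide_arcs (Some ov) k x y z t f1 f2 f3.
  by exists [:: x; y; z]; split; [apply: perm_trans (perm_map fst e2) e1|right].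
- by have [e1 e2] := perm_flype_arcs x y d o e; exists [:: x; y]; split; [|right].
Qed.

Lemma classical_crossings_cat w w' :
  classical_crossings (w ++ w') = classical_crossings w ++ classical_crossings w'.
Proof. by rewrite /classical_crossings filter_cat map_cat. Qed.

Lemma classical_crossings_perm w w' : perm_eq w w' ->
  perm_eq (classical_crossings w) (classical_crossings w').
Proof. by move=> e; apply: perm_map; apply: perm_filter. Qed.

Lemma classical_crossingsP w c : reflect (exists e, ((c, true),
  Classical e) \in w) (c \in classical_crossings w).
Proof.
apply: (iffP mapP) => [[[[c' b] k]]|[e ew]]; last first.
  by exists ((c, true), Classical e); rewrite // mem_filter /= ew.
rewrite mem_filter /= => /andP[/andP[]]; case: b => // _; case: k => // e _ h ->.
by exists e.
Qed.

Lemma uniq_classical_crossings w : wf w -> uniq (classical_crossings w).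
Proof.
case/andP=> uw _; rewrite map_inj_in_uniq;
  first by rewrite filter_uniq // (map_uniq uw).
move=> [[c b] k] [[c' b'] k']; rewrite !mem_filter /=.
case: b => //=; case: b' => //= /andP[_ lw] /andP[_ lw'] e; subst c'.
elim: w uw lw lw' => //= a w IH /andP[aw uw];
  rewrite !inE => /predU1P[e1|h1] /predU1P[e2|h2].
- by rewrite e1 e2.
- by case/negP: aw; rewrite -e1; apply: (map_f fst h2).
- by case/negP: aw; rewrite -e2; apply: (map_f fst h1).
- exact: IH.
Qed.

(** * The glueing sum on codes *)

Section ClassOfCode.
Variable C : category.
Local Open Scope ring_scope.
Local Open Scope quotient_scope.

(** Total on codes, so that the terms of a sum can be compared by rewriting; on diagrams
    [code_class_gen] identifies it with the generator. *)
Definition code_class (w : code) : flat_group C :=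
  if insub w is Some T then gen C (T : diagram 1) else 0.

Lemma code_class_gen (T : diagram 1) : code_class T = gen C T.
Proof. by rewrite /code_class valK. Qed.

Lemma gen_flat (S S' : diagram 1) : flat_equiv C S S' -> gen C S = gen C S'.
Proof. by move=> h; rewrite /gen; congr << _ >>; apply/eqmodP; apply/asboolP. Qed.

Lemma code_class_feq w w' : feq C 1 w w' -> code_class w = code_class w'.
Proof. by case=> S [S' [<- <- h]]; rewrite !code_class_gen; apply: gen_flat. Qed.

Definition kink_class (w : code) : flat_group C :=
  code_class (kink (fresh w) false Double ++ w).

Definition crossing_sign (w : code) (c : nat) : int :=
  if ((c, true), Classical true) \in w then 1 else -1.

Definition glueing_term (w : code) (c : nat) : flat_group C :=
  (code_class (set_kind c Double w) - (if C is Unframed then kink_class w else 0))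
    *~ crossing_sign w c.

Definition code_glueing (w : code) : flat_group C :=
  \sum_(c <- classical_crossings w) glueing_term w c.

Lemma big_crossing (K : diagram 0) (F : nat -> flat_group C) :
  \sum_(c : crossing K) F (ssval c) = \sum_(c <- classical_crossings K) F c.
Proof.
rewrite -(big_map (fun c : crossing K => ssval c) xpredT F).
apply: perm_big; apply: uniq_perm.
- by rewrite map_inj_uniq ?index_enum_uniq //; apply: val_inj.
- by apply: uniq_classical_crossings; case/and3P: (code_valid K).
move=> c; apply/mapP/idP => [[x _ ->]|cK]; first exact: ssvalP.
by exists (SeqSub cK); rewrite // mem_index_enum.
Qed.

Lemma fresh_names w : fresh w \notin names w.
Proof.
apply/negP=> /mapP[[[c b] k] lw /= ec]; case/negP: (fresh_notin w b).
by rewrite ec; apply: (map_f fst lw).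
Qed.
End ClassOfCode.

(** The choice [kpos] disappears because a double kink can be carried to the front of the curve and
    turned to the fixed rotation used in [kink_class]. *)
Lemma glueingE C kpos K : glueing C kpos K = code_glueing C K.
Proof.
rewrite /code_glueing -(big_crossing K (glueing_term C K)) /glueing /glueing_term.
case: C; apply: eq_bigr => c _; rewrite -!code_class_gen ?subr0 //.
congr ((_ - _) *~ _)%R; apply: code_class_feq; rewrite /= /insert_kink.
have := @double_kink_anywhere (fresh K) (fresh K) (kpos K).2 false
  (take (kpos K).1 (code_of K)) (drop (kpos K).1 (code_of K)).
by rewrite cat_take_drop fresh_names; apply => //; apply: code_valid.
Qed.

Definition set1_kind (c : nat) (k : kind) (l : nat * bool * kind) :=
  if l.1.1 == c then (l.1, k) else l.

Lemma set_kindE c k w : set_kind c k w = map (set1_kind c k) w.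
Proof. by []. Qed.

Lemma set_kind_cat c k u v : set_kind c k (u ++ v) = set_kind c k u ++ set_kind c k v.
Proof. exact: map_cat. Qed.

Lemma set_kindC c c' k k' w : c != c' ->
  set_kind c k (set_kind c' k' w) = set_kind c' k' (set_kind c k w).
Proof.
move=> cc; rewrite /set_kind -!map_comp; apply: eq_map => -[[n b] q] /=.
case E: (n == c); case E': (n == c'); rewrite /= ?E ?E' //.
by move: cc; rewrite -(eqP E) E'.
Qed.

Lemma mem_crossings w c d e : wf w -> ((c, d), Classical e) \in w ->
  c \in classical_crossings w.
Proof.
case/andP=> _ /allP cw lw; apply/classical_crossingsP; exists e.
by case: d lw => // lw; have := cw _ lw.
Qed.

Lemma crossing_signE w c d e : wf w -> ((c, d), Classical e) \in w ->
  crossing_sign w c = (if e then 1 else -1)%R.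
Proof.
move=> ww lw; have [e' le'] := classical_crossingsP _ _ (mem_crossings ww lw).
have ee : e' = e by case: (wf_kindP ww lw le' erefl).
rewrite /crossing_sign; case: ifP => [h|/negP h].
  by have [<-] := wf_kindP ww lw h erefl.
rewrite {}ee in le'; by case: e {lw} le' => // /h.
Qed.

Lemma crossing_kind w c l : wf w -> c \in classical_crossings w -> l \in w ->
  l.1.1 = c ->
  is_classical l.2.
Proof. by move=> ww /classical_crossingsP[e ew] lw lc;
  rewrite (wf_kindP ww ew lw lc). Qed.

Lemma crossings_set_kind w c k c' : c' != c -> c' \in classical_crossings w ->
  c' \in classical_crossings (set_kind c k w).
Proof.
move=> cc /classical_crossingsP[e ew]; apply/classical_crossingsP; exists e.
by apply/mapP; exists ((c', true), Classical e); rewrite //= (negPf cc).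
Qed.

Lemma valid_set_sign n w c e : valid n w -> c \in classical_crossings w ->
  valid n (set_kind c (Classical e) w).
Proof.
case/and3P=> ww pw /eqP nw /classical_crossingsP[e' ew].
have := ndouble_set_kind (Classical e) ww ew; rewrite /= !addn0 => nE.
by rewrite /valid wf_set_kind // shadow_set_kind pw nE nw eqxx.
Qed.

Lemma feq_set_sign C n w c e : valid n w -> c \in classical_crossings w ->
  feq C n w (set_kind c (Classical e) w).
Proof.
move=> v cw; have /and3P[ww _ _] := v; apply: feq_sign => //;
  first exact: valid_set_sign.
rewrite /flat_code -map_comp; apply/eq_in_map => l lw /=; case: eqP => // lc.
by have := crossing_kind ww cw lw lc; case: (l.2).
Qed.

Lemma deforms_perm P P' w w' : perm_eq P P' -> deforms P w w' -> deforms P' w w'.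
Proof.
by move=> e [Q [u0 [us [eQ s ew ew']]]]; exists Q, u0, us; split=> //;
  apply: perm_trans eQ e.
Qed.

Lemma map_move_off (f : nat * bool * kind -> nat * bool * kind) P :
  (forall l, l \in arcs_before P ++ arcs_after P -> f l = l) -> map_move (map f) P = P.
Proof.
move=> H; rewrite -[RHS]map_id; apply/eq_in_map => -[a b] pP; congr (_, _).
  rewrite -[RHS]map_id; apply/eq_in_map => l la; apply: H; rewrite mem_cat.
  by apply/orP; left; apply/flattenP; exists a => //; apply: (map_f fst pP).
rewrite -[RHS]map_id; apply/eq_in_map => l lb; apply: H; rewrite mem_cat.
by apply/orP; right; apply/flattenP; exists b => //; apply: (map_f snd pP).
Qed.

Lemma kink_class_any C c w : valid 0 w -> c \notin names w ->
  kink_class C w = code_class C (kink c false Double ++ w).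
Proof.
by move=> v cw; apply: code_class_feq; apply: double_kink_rename => //;
  apply: fresh_names.
Qed.

(** The kink sits in front of the whole code, outside the disc of any move, and may take a name
    foreign to both diagrams; every flat step then lifts to the diagrams with the kink. *)
Lemma kink_class_feq C w w' : feq C 0 w w' -> kink_class C w = kink_class C w'.
Proof.
case=> S [S' [<- <- r]] {w w'}; elim: r => // [T T' s|T T' T'' _ -> _ ->] //.
have vT := code_valid T; have vT' := code_valid T'.
case: s => [[[f fi eT']|[P mP dP]]|[x [e dP]]].
- rewrite eT' in vT' *.
  have ff : f (fresh T) \notin names (rename f T).
    apply/mapP=> -[_ /mapP[l lT ->] /fi e]; case/negP: (fresh_names T).
    by rewrite e; apply: (map_f (fun l => l.1.1) lT).
  rewrite (kink_class_any _ vT' ff); apply: code_class_feq; apply: ieq_feq.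
  have E : rename f (kink (fresh T) false Double ++ code_of T) = kink (f (fresh T))
    false Double ++ rename f T by [].
  rewrite -E; apply: ieq_rename => //; rewrite ?E.
    by rewrite (@valid_double_kink _ false [::]) // fresh_names.
  by rewrite (@valid_double_kink _ false [::]).
- have [c [_ [_ cn _]]] := fresh_pair (names T ++ names T').
  move: cn; rewrite mem_cat negb_or => /andP[cT cT'].
  rewrite !(@kink_class_any C c) //; apply: code_class_feq.
  apply: (feq_move mP (deforms_catl _ dP));
    by rewrite (@valid_double_kink _ false [::]).
have [c [_ [_ cn _]]] := fresh_pair (names T ++ names T').
move: cn; rewrite mem_cat negb_or => /andP[cT cT'].
rewrite !(@kink_class_any C c) //; apply: code_class_feq.
apply: code_rel_step => [||U U' eU eU']; rewrite ?(@valid_double_kink _ false [::]) //.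
by right; exists x, e; rewrite eU eU'; apply: deforms_catl.
Qed.

Lemma names_chords a ns : perm_eq (shadow a) (chords ns) -> names a =i ns.
Proof.
move=> e c; rewrite names_shadow (perm_mem (perm_map fst e)); apply/mapP/idP.
  by case=> -[c' b]; rewrite mem_chords => h ->.
by move=> cn; exists (c, true); rewrite ?mem_chords.
Qed.

Lemma mem_slide_arcs layer k x y z t f1 f2 f3 :
  let A := arcs_before (slide_move layer k x y z t f1 f2 f3) in
  [/\ ((x, t (+) f1 (+) f2), k) \in A,
      ((y, t (+) f2 (+) f3), pass_kind layer (~~ (t (+) f2 (+) f3))) \in A
    & ((z, t (+) f3 (+) f1), pass_kind layer (t (+) f3 (+) f1)) \in A].
Proof.
rewrite /arcs_before /=.
by case: f1; case: f2; case: f3; split; rewrite !inE !eqxx ?orbT.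
Qed.

Lemma map_arc f o l l' : map f (Defs.arc o l l') = Defs.arc o (f l) (f l').
Proof. by case: o. Qed.

Section SlideGlue.
Variables (C : category) (w w' : code).
Hypotheses (vw : valid 0 w) (vw' : valid 0 w').

(* After changing the signs of the other two crossings, any of the three
   vertices of the triangle can play the part of the rigid one. *)
Lemma slide_glue_rot ov k x y z t f1 f2 f3 :
    x != y -> x != z -> y != z -> is_classical k ->
    [/\ x \in classical_crossings w,
      y \in classical_crossings w & z \in classical_crossings w] ->
    [/\ x \in classical_crossings w',
      y \in classical_crossings w' & z \in classical_crossings w'] ->
    deforms (slide_move (Some ov) k x y z t f1 f2 f3) w w' ->
  [/\ code_class C (set_kind x Double w) = code_class C (set_kind x Double w'),
      code_class C (set_kind y Double w) = code_class C (set_kind y Double w')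
    & code_class C (set_kind z Double w) = code_class C (set_kind z Double w')].
Proof.
move=> xy xz yz kc [x1 y1 z1] [x2 y2 z2] dP.
have yx : y != x by rewrite eq_sym.
have zx : z != x by rewrite eq_sym.
have zy : z != y by rewrite eq_sym.
pose dx := t (+) f1 (+) f2; pose dy := t (+) f2 (+) f3; pose dz := t (+) f3 (+) f1.
have step (c a b : nat) ka kb P : move C P -> a != c -> b != c -> a != b ->
   c \in classical_crossings w -> c \in classical_crossings w' ->
   a \in classical_crossings w -> a \in classical_crossings w' ->
   b \in classical_crossings w -> b \in classical_crossings w' ->
   perm_eq (map_move (map (set1_kind b (Classical kb) \o set1_kind a (Classical ka) \o
     set1_kind c Double))
     (slide_move (Some ov) k x y z t f1 f2 f3)) P ->
   code_class C (set_kind c Double w) = code_class C (set_kind c Double w').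
  move=> mP ac bc ab c1 c2 a1 a2 b1 b2 eP; apply: code_class_feq.
  have G W : valid 0 W -> c \in classical_crossings W -> a \in classical_crossings W ->
      b \in classical_crossings W ->
      valid 1 (set_kind b (Classical kb) (set_kind a (Classical ka) (set_kind c Double
        W))) /\
      feq C 1 (set_kind c Double W) (set_kind b (Classical kb) (set_kind a (Classical
        ka) (set_kind c Double W))).
    move=> vW cW aW bW; have v1 := valid_glue vW cW.
    have aW' := crossings_set_kind Double ac aW.
    have bW' := crossings_set_kind Double bc bW.
    have v2 := valid_set_sign ka v1 aW'.
    have bW2 : b \in classical_crossings (set_kind a (Classical ka) (set_kind c Double
      W)).
      by apply: crossings_set_kind => //; rewrite eq_sym.
    split; first exact: valid_set_sign.
    exact: code_rel_trans (feq_set_sign C ka v1 aW') (feq_set_sign C kb v2 bW2).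
  have [va ea] := G w vw c1 a1 b1; have [vb eb] := G w' vw' c2 a2 b2.
  apply: code_rel_trans ea _; apply: code_rel_trans (code_rel_sym eb).
  apply: (feq_move mP _ va vb).
  have := deforms_perm eP (deforms_map (set1_kind b (Classical kb) \o set1_kind a
    (Classical ka) \o set1_kind c Double) dP).
  by rewrite !set_kindE -!map_comp.
(* The description of the triangle is cyclic: rotating [x], [y], [z] together with [f1], [f2], [f3]
   permutes the three arcs. The signs make the arc opposite to the glued vertex pass in the layer
   [ov]. *)
split.
- apply: (@step x y z (~~ dy == ov) (dz == ov) (slide_move (Some ov) Double x y z t f1
  f2 f3)) => //.
    exact: R3_classical.
  by rewrite /slide_move /map_move /= !map_arc /= /set1_kind /= !eqxx ?(negPf xy,
    negPf xz, negPf yz, negPf yx, negPf zx, negPf zy, eqxx) /= perm_refl.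
- apply: (@step y z x (~~ dz == ov) (dx == ov) (slide_move (Some ov) Double y z x t f2
  f3 f1)) => //.
    exact: R3_classical.
  by rewrite /slide_move /map_move /= !map_arc /= /set1_kind /= !eqxx ?(negPf xy,
    negPf xz, negPf yz, negPf yx, negPf zx, negPf zy, eqxx) /= perm_rot3.
- apply: (@step z x y (~~ dx == ov) (dy == ov) (slide_move (Some ov) Double z x y t f3
  f1 f2)) => //.
    exact: R3_classical.
  by rewrite /slide_move /map_move /= !map_arc /= /set1_kind /= !eqxx ?(negPf xy,
    negPf xz, negPf yz, negPf yx, negPf zx, negPf zy, eqxx) /= perm_rot3'.
Qed.
End SlideGlue.

Lemma crossings_rename f w :
  classical_crossings (rename f w) = map f (classical_crossings w).
Proof.
by elim: w => //= -[[c b] k] w IH; rewrite /classical_crossings /=;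
  case: ifP => //= _; congr (_ :: _).
Qed.

Lemma set_kind_rename f c k w : injective f ->
  set_kind (f c) k (rename f w) = rename f (set_kind c k w).
Proof.
move=> fi; rewrite /set_kind /rename -!map_comp; apply: eq_map => l /=.
by rewrite (inj_eq fi); case: eqP.
Qed.

Lemma code_glueing_rename C f w : injective f -> valid 0 w -> valid 0 (rename f w) ->
  code_glueing C (rename f w) = code_glueing C w.
Proof.
move=> fi v v'; rewrite /code_glueing crossings_rename big_map.
apply: eq_big_seq => c cw; rewrite /glueing_term.
congr ((_ - _) *~ _)%R.
- rewrite set_kind_rename //; apply: code_class_feq; apply: code_rel_sym.
  have v1 := valid_glue v cw.
  have v2 : valid 1 (set_kind (f c) Double (rename f w)).
    by apply: valid_glue => //; rewrite crossings_rename map_f.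
  by rewrite set_kind_rename // in v2; apply: ieq_feq; apply: ieq_rename.
- case: C => //; apply: kink_class_feq; apply: code_rel_sym.
  by apply: ieq_feq; apply: ieq_rename.
rewrite /crossing_sign; congr (if _ then _ else _).
apply/mapP/idP => [[[[c' b] k] lw [/fi-> -> ->]] //|lw].
by exists ((c, true), Classical true).
Qed.

(** Two decorations of one curve that agree outside the disc differ by a move that redecorates the
    arcs. This exhibits the flype between the two glued diagrams of a second Reidemeister move. *)
Lemma deforms_two_maps (f g : nat * bool * kind ->
  nat * bool * kind) (Q : tangle_move) (u0 : code) us :
    size us = size Q -> (forall l, l \in u0 ++ flatten us -> f l = g l) ->
  let w := u0 ++ flatten [seq z.1.2 ++ z.2 | z <- zip Q us] in
  deforms [seq (map f p.2, map g p.2) | p <- Q] (map f w) (map g w).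
Proof.
move=> s fg; exists [seq (map f p.2, map g p.2) | p <- Q], (map f u0), (map (map f) us).
split=> //; first by rewrite !size_map.
  rewrite map_cat map_flatten; congr (_ ++ flatten _).
  by elim: Q us s {fg} => [|q Q IH] [|u us] //= [s]; rewrite map_cat IH.
rewrite map_cat map_flatten; congr (_ ++ flatten _).
  by apply/eq_in_map => l lu; rewrite fg // mem_cat lu.
have {}fg l : l \in flatten us -> f l = g l by move=> lu; apply: fg;
  rewrite mem_cat lu orbT.
elim: Q us s fg => [|q Q IH] [|u us] //= [s] fg; rewrite map_cat IH //; last first.
  by move=> l lu; apply: fg; rewrite mem_cat lu orbT.
by congr ((_ ++ _) :: _); apply/eq_in_map => l lu; rewrite fg // mem_cat lu.
Qed.

Local Open Scope ring_scope.

(** * The glueing sum under each move *)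

Lemma code_glueing_perm C w a v : perm_eq w (a ++ v) ->
  code_glueing C w = \sum_(c <- classical_crossings a) glueing_term C w c
    + \sum_(c <- classical_crossings v) glueing_term C w c.
Proof.
move=> e; rewrite /code_glueing (perm_big _ (classical_crossings_perm e)).
by rewrite classical_crossings_cat big_cat.
Qed.

Lemma crossing_sign_perm w w' c : perm_eq w w' ->
  crossing_sign w c = crossing_sign w' c.
Proof. by move=> e; rewrite /crossing_sign (perm_mem e). Qed.

Lemma crossings_slide_virtual k x y z t f1 f2 f3 c :
  c \in classical_crossings (arcs_before (slide_move None k x y z t f1 f2 f3)) ->
  c = x /\ is_classical k.
Proof.
case/classical_crossingsP=> e; rewrite /arcs_before /=; case: f1; case: f2; case: f3;
  rewrite /= !inE;
by do ?[case/orP]; move/eqP => [-> _] // <-.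
Qed.

(** Both sides consist of the same passages in another order, so the sums are compared crossing by
    crossing. A crossing away from the triangle is glued before and after the move; in a virtual
    slide only [x] can be classical, and glueing it gives a virtual slide past a double point; in a
    classical slide [slide_glue_rot] treats all three. *)
Lemma code_glueing_slide C l k x y z t f1 f2 f3 w w' :
    move C (slide_move l k x y z t f1 f2 f3) -> (l != None -> k != Virtual) ->
    deforms (slide_move l k x y z t f1 f2 f3) w w' ->
    valid 0 w -> valid 0 w' ->
  code_glueing C w = code_glueing C w'.
Proof.
move=> mP kl dP v v'; have [Q [u0 [us [eQ s ew ew' [pw pw']]]]] := deforms_rest dP.
have /and3P[ww _ _] := v.
have [e1 e2] := perm_slide_arcs l k x y z t f1 f2 f3.
have pww' : perm_eq w w'.
  by rewrite (permPl pw) (permPr pw') perm_cat2r perm_sym.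
have [uns off] := arcs_off ww pw e1.
have kk : kink_class C w = kink_class C w' by apply: kink_class_feq;
  apply: feq_move dP _ _.
rewrite /code_glueing -(perm_big _ (classical_crossings_perm pww')) /=;
  apply: eq_big_seq => c cw.
have cw' : c \in classical_crossings w'.
  by rewrite -(perm_mem (classical_crossings_perm pww')).
rewrite /glueing_term kk -(crossing_sign_perm c pww'); congr ((_ - _) *~ _).
move: (uns); rewrite /= !inE !negb_or andbT => /andP[/andP[xy xz] yz].
have [cn|cn] := boolP (c \in [:: x; y; z]); last first.
  apply: code_class_feq; have := deforms_map (set1_kind c Double) dP.
  rewrite map_move_off => [d2|a].
    by apply: feq_move mP d2 _ _; apply: valid_glue.
  rewrite mem_cat (perm_mem e2) orbb => la; rewrite /set1_kind; case: eqP => // lc.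
  by case/negP: cn; rewrite -lc -(names_chords e1); apply: (map_f (fun l => l.1.1) la).
have cb : c \in classical_crossings (arcs_before (slide_move l k x y z t f1 f2 f3)).
  have /classical_crossingsP[e] := cw; rewrite (perm_mem pw) mem_cat => /orP[h|h].
    by apply/classical_crossingsP; exists e.
  by case/negP: (off c cn); apply: (map_f (fun l => l.1.1) h).
have yx : y != x by rewrite eq_sym.
have zx : z != x by rewrite eq_sym.
case: l {mP kk e1 e2} kl dP cb pw pw' eQ => [ov|] kl dP cb pw pw' eQ; last first.
  have [ec kc] := crossings_slide_virtual cb; rewrite {}ec in cw cw' *.
  apply: code_class_feq; have := deforms_map (set1_kind x Double) dP.
  have -> : map_move (map (set1_kind x Double)) (slide_move None k x y z t f1 f2 f3) =
    slide_move None Double x y z t f1 f2 f3.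
    by rewrite /slide_move /map_move /= !map_arc /= /set1_kind /= !eqxx (negPf yx)
      (negPf zx).
  by move=> d2; apply: feq_move (R3_virtual C Double x y z t f1 f2 f3) d2 _ _;
    apply: valid_glue.
have inw a : a \in arcs_before (slide_move (Some ov) k x y z t f1 f2 f3) -> a \in w.
  by move=> h; rewrite (perm_mem pw) mem_cat h.
have [hx hy hz] := mem_slide_arcs (Some ov) k x y z t f1 f2 f3.
have kc : is_classical k.
  by have := valid0_not_double v (inw _ hx); have := kl isT; case: (k).
have Cx : x \in classical_crossings w.
  by move: (inw _ hx); case: (k) kc => // e' _; apply: mem_crossings.
have Cy := mem_crossings ww (inw _ hy); have Cz := mem_crossings ww (inw _ hz).
have pc := perm_mem (classical_crossings_perm pww').
have [gx gy gz] := @slide_glue_rot C w w' v v' ov k x y z t f1 f2 f3 xy xz yz kc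
  (And3 Cx Cy Cz) (And3 (etrans (esym (pc x)) Cx) (etrans (esym (pc y)) Cy) (etrans
    (esym (pc z)) Cz)) dP.
by move: cn; rewrite !inE => /or3P[]/eqP->.
Qed.

(** For moves that create crossings the old terms match one by one, as the move can still be made
    after glueing outside its disc. What remains is the contribution of the new crossings. *)
Lemma code_glueing_insertion C P w w' : move C P -> arcs_before P = [::] ->
    deforms P w w' -> valid 0 w -> valid 0 w' ->
    \sum_(c <- classical_crossings (arcs_after P)) glueing_term C w' c = 0 ->
  code_glueing C w = code_glueing C w'.
Proof.
move=> mP b0 dP v v' sum0; have [Q [u0 [us [eQ s ew ew' [pw pw']]]]] := deforms_rest dP.
have /and3P[ww' _ _] := v'; have /and3P[ww _ _] := v.
have [ns [ea _]] := move_chords mP; have [uns off] := arcs_off ww' pw' ea.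
have kk : kink_class C w = kink_class C w' by apply: kink_class_feq;
  apply: feq_move dP _ _.
rewrite (code_glueing_perm _ pw) (code_glueing_perm _ pw') sum0 b0 big_nil !add0r.
apply: eq_big_seq => c /classical_crossingsP[e er].
have ew1 : ((c, true), Classical e) \in w by rewrite (perm_mem pw) mem_cat er orbT.
have ew1' : ((c, true), Classical e) \in w' by rewrite (perm_mem pw') mem_cat er orbT.
have cn : c \notin ns by apply: contraTN er => /off; apply: contra => h;
  apply: (map_f (fun l => l.1.1) h).
rewrite /glueing_term kk (crossing_signE ww ew1) (crossing_signE ww' ew1');
  congr ((_ - _) *~ _).
apply: code_class_feq; have := deforms_map (set1_kind c Double) dP.
rewrite map_move_off => [d2|l].
  by apply: feq_move mP d2 _ _; apply: valid_glue => //;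
    apply: mem_crossings ew1 || apply: mem_crossings ew1'.
rewrite b0 /= => la; rewrite /set1_kind; case: eqP => // lc; case/negP: cn.
by rewrite -lc -(names_chords ea); apply: (map_f (fun l => l.1.1) la).
Qed.

Lemma deforms_insertion a w w' : deforms [:: ([::], a)] w w' ->
  exists u v, w = u ++ v /\ w' = u ++ a ++ v.
Proof.
case=> Q [u0 [us [eQ s -> ->]]].
have eQ1 := perm_small_eq (isT : (size [:: ([::] : code, a)] <= 1)%N) eQ.
move: s; rewrite eQ1; case: us => [|u1 [|]] //= _.
by exists u0, u1; rewrite !cats0.
Qed.

Lemma code_glueing_R1 x d e w w' : deforms [:: ([::], kink x d (Classical e))] w w' ->
  valid 0 w -> valid 0 w' -> code_glueing Unframed w = code_glueing Unframed w'.
Proof.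
move=> dP v v'; have mP := R1_classical x d e (erefl Unframed).
apply: (code_glueing_insertion mP _ dP) => //.
have -> : classical_crossings (arcs_after [:: ([::], kink x d (Classical e))]) = [:: x].
  by rewrite /arcs_after /=; case: (d).
have kk : kink_class Unframed w = kink_class Unframed w'.
  by apply: kink_class_feq; apply: feq_move dP _ _.
rewrite big_seq1 /glueing_term -kk; have [u0 [u1 [ew ew']]] := deforms_insertion dP.
have xr : x \notin names (u0 ++ u1) by rewrite ew' in v'; apply: valid_kink_notin v'.
have -> : set_kind x Double w' = u0 ++ kink x d Double ++ u1.
  move: xr; rewrite names_cat mem_cat negb_or => /andP[x0 x1].
  by rewrite ew' !set_kind_cat /= /set_kind /= !eqxx -!/(set_kind _ _ _) !set_kind_off.
rewrite (_ : code_class _ _ = kink_class Unframed w) ?subrr ?mul0rz //.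
rewrite ew in v *; apply: code_class_feq; apply: double_kink_anywhere => //.
exact: fresh_names.
Qed.

(** Glueing one kink or the other gives the same flat class by [kink_pair_exchange], whatever the
    rotations, and the two signs are opposite. *)
Lemma code_glueing_R1_framed x y d d' e w w' :
    deforms [:: ([::], kink x d (Classical e) ++ kink y d' (Classical (~~ e)))] w w' ->
  valid 0 w -> valid 0 w' -> code_glueing Framed w = code_glueing Framed w'.
Proof.
move=> dP v v'; have mP := R1_framed x y d d' e (erefl Framed).
apply: (code_glueing_insertion mP _ dP) => //.
have -> : classical_crossings (arcs_after [:: ([::],
  kink x d (Classical e) ++ kink y d' (Classical (~~ e)))]) = [:: x; y].
  by rewrite /arcs_after /=; case: (d); case: (d').
have [u0 [u1 [ew ew']]] := deforms_insertion dP; rewrite -catA in ew'.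
have /and3P[ww' _ _] := v'.
have xr := v'; rewrite ew' in xr; have := valid_kink_notin xr.
rewrite !names_cat !mem_cat /= !inE !negb_or => /andP[x0 /andP[/andP[xy _] x1]].
have xu : x \notin names (u0 ++ u1) by rewrite names_cat mem_cat negb_or x0.
have yr : wf (u0 ++ kink y d' (Classical (~~ e)) ++ u1).
  by move: ww'; rewrite ew' wf_kink_in => /andP[].
have yu : y \notin names (u0 ++ u1) by move: yr; rewrite wf_kink_in => /andP[].
have yx : y != x by rewrite eq_sym.
move: (yu); rewrite names_cat mem_cat negb_or => /andP[y0 y1].
have sx : ((x, d), Classical e) \in w' by rewrite ew' !mem_cat !inE eqxx !orbT.
have sy : ((y, d'), Classical (~~ e)) \in w' by rewrite ew' !mem_cat !inE eqxx !orbT.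
rewrite big_cons big_seq1 /glueing_term !subr0 (crossing_signE ww' sx) (crossing_signE
  ww' sy).
have -> : code_class Framed (set_kind x Double w') = code_class Framed (set_kind y
  Double w').
  apply: code_class_feq; rewrite ew' !set_kind_cat {1 2 3 5 6 7}/set_kind /= !eqxx
    (negPf xy) (negPf yx).
  rewrite -!/(set_kind _ _ _) !set_kind_off //.
  by apply: kink_pair_exchange => //; rewrite -ew.
by case: (e); rewrite mulr1z mulrN1z ?subrr // addrC subrr.
Qed.

Lemma code_glueing_R2 C l x y d o w w' : deforms (R2_move l x y d o) w w' ->
  valid 0 w -> valid 0 w' -> code_glueing C w = code_glueing C w'.
Proof.
move=> dP v v'; have mP := R2 C l x y d o.
apply: (code_glueing_insertion mP _ dP) => //.
case: l dP mP => [ov|] dP mP; last first.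
  by rewrite /arcs_after /=; case: (d); case: (o); rewrite big_nil.
have [Q [u0 [us [eQ s ew ew' [pw pw']]]]] := deforms_rest dP.
have /and3P[ww' _ _] := v'; have ea := perm_R2_arcs (Some ov) x y d o.
have [uns off] := arcs_off ww' pw' ea.
have pc : perm_eq (classical_crossings (arcs_after (R2_move (Some ov) x y d o))) [::
  x; y].
  by rewrite /arcs_after /=; case: (d); case: (o); rewrite //=;
    apply/permPl/(perm_catC [:: y] [:: x]).
rewrite (perm_big _ pc) /= big_cons big_seq1 /glueing_term.
have xy : x != y by move: uns; rewrite /= inE andbT.
have yx : y != x by rewrite eq_sym.
have sx : ((x, d), Classical (d == ov)) \in w'.
  by rewrite (perm_mem pw') mem_cat /arcs_after /= inE eqxx.
have sy : ((y, ~~ d), Classical (~~ d == ov)) \in w'.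
  by rewrite (perm_mem pw') mem_cat /arcs_after /= !inE eqxx orbT.
rewrite (crossing_signE ww' sx) (crossing_signE ww' sy).
have -> : code_class C (set_kind x Double w') = code_class C (set_kind y Double w');
  last first.
  by case: (d); case: (ov); rewrite mulr1z mulrN1z ?subrr // addrC subrr.
apply: code_class_feq; have Cx := mem_crossings ww' sx; have Cy := mem_crossings ww' sy.
have vx := valid_set_sign (~~ d == ov) v' Cx.
have Cy' := crossings_set_kind (Classical (~~ d == ov)) yx Cy.
have vxy := valid_glue vx Cy'.
(* A flype keeps the sign of its classical crossing, so in the target [x] carries the sign that [y]
   had. *)
apply: (@code_rel_trans _ _ _ (set_kind y Double (set_kind x (Classical (~~ d == ov))
  w'))); last first.
  have vy := valid_glue v' Cy; apply: code_rel_sym.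
  have := feq_set_sign C (~~ d == ov) vy (crossings_set_kind Double xy Cx).
  by rewrite set_kindC // eq_sym.
apply: (feq_move (Flype C x y d o (~~ d == ov)) _ (valid_glue v' Cx) vxy).
set f := set1_kind x Double.
set g := set1_kind y Double \o set1_kind x (Classical (~~ d == ov)).
have fg a : a \in u0 ++ flatten us -> f a = g a.
  move=> ar; rewrite /f /g /set1_kind /=.
  have [nx ny] : (a.1.1 != x) /\ (a.1.1 != y).
    have [xn yn] : x \in [:: x; y] /\ y \in [:: x; y] by rewrite !inE !eqxx orbT.
    split; [apply: contraNneq (off x xn) => <-|apply: contraNneq (off y yn) => <-];
    exact: (map_f (fun l => l.1.1) ar).
  by rewrite (negPf nx) /= (negPf ny).
have := deforms_two_maps s fg; rewrite /= -ew' (map_comp (set1_kind y Double)).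
apply: deforms_perm; apply: perm_trans (perm_map _ eQ) _.
rewrite /R2_move /flype_move /= !map_arc /= /f /g /set1_kind /=.
by rewrite !eqxx ?(negPf xy) ?(negPf yx) /= ?eqxx ?(negPf xy) ?(negPf yx) /= perm_refl.
Qed.

Lemma code_glueing_move C P w w' : move C P -> deforms P w w' -> valid 0 w ->
  valid 0 w' ->
  code_glueing C w = code_glueing C w'.
Proof.
move=> mP dP v v'; case: mP (mP) dP =>
  [x d e eC|x y d d' e eC|x d|l x y d o|k x y z t f1 f2 f3|ov k x y z t f1 f2 f3 nk|x
  y d o e] mP dP.
- by rewrite {mP}eC; apply: code_glueing_R1 dP v v'.
- by rewrite {mP}eC; apply: code_glueing_R1_framed dP v v'.
- by apply: (code_glueing_insertion mP (erefl _) dP v v'); case: (d); rewrite big_nil.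
- exact: code_glueing_R2 dP v v'.
- by apply: code_glueing_slide dP v v'.
- by apply: code_glueing_slide dP v v'.
(* A flype contains a double point, which a diagram of a long knot has not. *)
have [Q [u0 [us [eQ s ew ew' [pw pw']]]]] := deforms_rest dP.
have xw : ((x, d), Double) \in w by rewrite (perm_mem pw) mem_cat /arcs_before /= inE
  eqxx.
by have := valid0_not_double v xw.
Qed.

Lemma glueing_invariant C kpos : knot_invariant C (glueing C kpos).
Proof.
move=> K K'; elim=> // [T T' [[f fi e]|[P mP dP]]|T T' T'' _ -> _ ->] //;
  rewrite !glueingE.
  have v' := code_valid T'; rewrite e in v' *.
  by rewrite code_glueing_rename //; apply: code_valid.
by apply: code_glueing_move mP dP _ _; apply: code_valid.
Qed.

Import Num.Theory.

(** * Order one *)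

Lemma set_kindK c k k' w : set_kind c k (set_kind c k' w) = set_kind c k w.
Proof.
rewrite /set_kind -map_comp; apply: eq_map => l /=.
by case E: (l.1.1 == c); rewrite /= E.
Qed.

Lemma double_points_mem w c : wf w ->
  (c \in double_points w) = (((c, true), Double) \in w).
Proof.
move=> ww; apply/mapP/idP => [[[[c' b] k]]|cw]; last by exists ((c, true), Double);
  rewrite // mem_filter.
by rewrite mem_filter /= => /andP[/andP[bt /eqP->] h] ->; rewrite bt in h.
Qed.

Lemma double_point1 w c d : valid 1 w -> ((c, d), Double) \in w ->
  double_points w = [:: c].
Proof.
case/and3P=> ww _ nw cw; have : c \in double_points w.
  rewrite double_points_mem //; case: d cw => // cw.
  by have [_ /allP/(_ _ cw)] := andP ww.
have : size (double_points w) = 1%N by rewrite size_map size_filter; apply/eqP.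
by case: (double_points w) => [|c' []] //= _; rewrite inE => /eqP->.
Qed.

Lemma head_double_point n w : valid n.+1 w ->
  ((head 0%N (double_points w), true), Double) \in w.
Proof.
case/and3P=> ww _ nw; rewrite -double_points_mem //.
have : size (double_points w) = n.+1 by rewrite size_map size_filter; apply/eqP.
by case: (double_points w) => //= a q _; rewrite inE eqxx.
Qed.

Lemma set_kind_crossing w c d k e : ((c, d), k) \in w -> wf w ->
  c \in classical_crossings (set_kind c (Classical e) w).
Proof.
move=> cw ww; apply: (@mem_crossings _ c d e); first exact: wf_set_kind.
by apply/mapP; exists ((c, d), k); rewrite //= eqxx.
Qed.

Lemma double_points_set_kind c e e' w :
  double_points (set_kind c (Classical e) w) = double_points (set_kind c (Classical
    e') w).
Proof.
by elim: w => //= -[[n b] k] w IH; rewrite /double_points /=;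
   case: (n == c); rewrite /= ?andbF //; case: ifP => //= _; congr (_ :: _).
Qed.

(* Half of the jump of the glueing invariant at the double point of [w]. *)
Definition half_jump C (w : code) : flat_group C :=
  code_class C w - (if C is Unframed
    then kink_class C (set_kind (head 0%N (double_points w)) (Classical true) w) else
      0).

(** Glueing another crossing gives flat classes that do not see the sign of [c], so these terms
    cancel. The term of [c] has the same class in both resolutions, with signs 1 and -1, and is
    therefore doubled. *)
Lemma code_glueing_jump C w c d : valid 1 w -> ((c, d), Double) \in w ->
  code_glueing C (set_kind c (Classical true) w) - code_glueing C (set_kind c
    (Classical false) w)
  = half_jump C w *+ 2.
Proof.
move=> v cw; have /and3P[ww _ _] := v.
have hd : head 0%N (double_points w) = c by rewrite (double_point1 v cw).
have vr e : valid 0 (set_kind c (Classical e) w) by have := valid_resolve e v;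
  rewrite hd.
pose W e := set_kind c (Classical e) w.
have cW e : c \in classical_crossings (W e) by apply: set_kind_crossing cw ww.
have [o [u0 [u1 [u2 [ew cr]]]]] := split_name ww cw.
have WE e : W e = fill o u0 u1 u2 [:: ((c, d), Classical e)] [:: ((c, ~~ d),
  Classical e)].
  by rewrite /W ew set_kind_fill //= /set_kind /= eqxx.
have pW e : perm_eq (W e) (kink c d (Classical e) ++ (u0 ++ u1 ++ u2)).
  by rewrite WE (permPl (perm_fill _ _ _ _ _ _)).
have wW e : wf (W e) by have /and3P[] := vr e.
have cc e : classical_crossings (kink c d (Classical e)) = [:: c] by case: (d).
have sgnW e : crossing_sign (W e) c = if e then 1 else -1.
  by apply: (@crossing_signE _ c d); rewrite ?wW // (perm_mem (pW e)) inE eqxx.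
have kk : kink_class C (W false) = kink_class C (W true).
  apply: kink_class_feq; apply: code_rel_sym.
  by have := feq_set_sign C false (vr true) (cW true); rewrite set_kindK.
rewrite -!/(W _) !(code_glueing_perm C (pW _)) !cc !big_seq1.
have rest : \sum_(c' <- classical_crossings (u0 ++ u1 ++ u2)) glueing_term C (W true)
  c' =
   \sum_(c' <- classical_crossings (u0 ++ u1 ++ u2)) glueing_term C (W false) c'.
  apply: eq_big_seq => c' /classical_crossingsP[e er].
  have cc' : c != c'.
    by apply: contraNneq cr => ->; apply: (map_f (fun l => l.1.1) er).
  have inW f : ((c', true), Classical e) \in W f by rewrite (perm_mem (pW f)) mem_cat
    er orbT.
  have cW' f : c' \in classical_crossings (W f) by apply: mem_crossings (inW f).
  rewrite /glueing_term (crossing_signE (wW _) (inW true)) (crossing_signE (wW _) (inW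
    false)) kk.
  congr ((_ - _) *~ _); apply: code_class_feq.
  have vg := valid_glue (vr true) (cW' true).
  have := feq_set_sign C false vg (crossings_set_kind Double cc' (cW true)).
  by rewrite (@set_kindC c c' (Classical false) Double) // set_kindK.
rewrite rest opprD addrACA subrr addr0 /glueing_term !sgnW kk.
have WD e : set_kind c Double (W e) = w by rewrite /W set_kindK (set_kind_id ww cw).
by rewrite !WD /half_jump hd -/(W true) mulr1z mulrN1z opprK mulr2n.
Qed.

Lemma glueing_ext1 C kpos (S : diagram 1) :
  singular_ext (glueing C kpos) S = half_jump C S *+ 2.
Proof.
rewrite /= !glueingE /resolve /=.
by apply: code_glueing_jump (code_valid S) (head_double_point (code_valid S)).
Qed.

Lemma glueing_ext2 C kpos (T : diagram 2) : singular_ext (glueing C kpos) T = 0.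
Proof.
rewrite -[LHS]/(singular_ext _ (resolve T true) - singular_ext _ (resolve T false)).
rewrite !glueing_ext1 /half_jump /resolve /=.
have v := code_valid T; have /and3P[wT _ _] := v.
set c := head _ _; have cT : ((c, true),
  Double) \in code_of T by apply: head_double_point v.
have v1 e : valid 1 (set_kind c (Classical e) T) by apply: valid_resolve.
have c1 e : c \in classical_crossings (set_kind c (Classical e) T) by apply:
  set_kind_crossing cT wT.
have -> : code_class C (set_kind c (Classical false) T) = code_class C (set_kind c
  (Classical true) T).
  apply: code_class_feq; apply: code_rel_sym.
  by have := feq_set_sign C false (v1 true) (c1 true); rewrite set_kindK.
rewrite (double_points_set_kind c false true).
set c2 := head _ _.
have c2T : ((c2, true), Double) \in set_kind c (Classical true) T by apply:
  head_double_point (v1 true).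
have cc2 : c != c2.
  apply/negP=> /eqP e; rewrite -e in c2T; have /and3P[w1 _ _] := v1 true.
  by have := crossing_kind w1 (c1 true) c2T erefl.
have v0 : valid 0 (set_kind c2 (Classical true) (set_kind c (Classical true) T)) by
  apply: valid_resolve.
suff -> : kink_class C (set_kind c2 (Classical true) (set_kind c (Classical false) T)) =
  kink_class C (set_kind c2 (Classical true) (set_kind c (Classical true) T)) by
    rewrite subrr.
apply: kink_class_feq; apply: code_rel_sym.
have := feq_set_sign C false v0 (crossings_set_kind _ cc2 (c1 true)).
by rewrite (@set_kindC c c2 (Classical false)) // set_kindK.
Qed.

Lemma glueing_order_le1 C kpos : order_le C (glueing C kpos) 1.
Proof.
split; first exact: glueing_invariant.
case=> [|[|m]] // S _; elim: m S => [|m IH] S; first exact: glueing_ext2.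
by rewrite -[LHS]/(singular_ext _ (resolve S true) - singular_ext _ (resolve S false))
  !IH subrr.
Qed.

(* For a code with one double point and [b = false]: the parity of the number of
   classical passages met between the two passages through the double point. *)
Fixpoint inner_parity (b : bool) (w : code) : bool :=
  if w is l :: w' then
    if l.2 == Double then inner_parity (~~ b) w'
    else (b && is_classical l.2) (+) inner_parity b w'
  else false.

Definition double_parity (w : code) : bool := odd (count (fun l => l.2 == Double) w).

Lemma inner_parity_cat b u v :
  inner_parity b (u ++ v) = inner_parity b u (+) inner_parity (b (+) double_parity u) v.
Proof.
elim: u b => [|l u IH] b /=; first by rewrite addbF.
rewrite /double_parity /= oddD; case: (l.2 == Double) => /=.
  by rewrite IH addbN addNb.
by rewrite IH addbA.
Qed.

Definition parity_change (q : code * code) : bool :=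
  inner_parity false q.1 (+) inner_parity false q.2.

(** If each arc keeps the parity of its passages through double points, the stretches after it are
    read in the same state; if its own change does not depend on the state in which it is met, the
    order of the arcs is irrelevant and the changes add up. *)
Lemma inner_parity_deforms P w w' b :
    (forall q, q \in P -> double_parity q.1 = double_parity q.2 /\
       forall b, inner_parity b q.1 (+) inner_parity b q.2 = parity_change q) ->
    deforms P w w' ->
  inner_parity b w (+) inner_parity b w' = \big[addb/false]_(q <- P) parity_change q.
Proof.
move=> H [Q [u0 [us [eQ s -> ->]]]]; rewrite -(perm_big _ eQ) /= {w w'}.
have {H eQ P} : forall q, q \in Q -> double_parity q.1 = double_parity q.2 /\
       forall b, inner_parity b q.1 (+) inner_parity b q.2 = parity_change q.
  by move=> q; rewrite (perm_mem eQ); apply: H.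
rewrite !inner_parity_cat addbCA -!addbA addbA addbb addFb.
elim: Q us (b (+) _) s => [|q Q IH] [|u us] b' //= s H; first by rewrite big_nil.
rewrite -!catA !inner_parity_cat big_cons.
have [dq pq] := H q (mem_head _ _); rewrite -(pq b') -dq.
have := IH us (b' (+) double_parity q.1 (+) double_parity u) (succn_inj s).
move=> <-; last by move=> q' q'Q; apply: H; rewrite inE q'Q orbT.
move: (inner_parity _ (flatten _)) (inner_parity _ (flatten _)) (inner_parity b' q.1)
  (inner_parity b' q.2) (inner_parity _ u).
by move=> [] [] [] [] [].
Qed.

(** The parity of a single arc changes only when a classical passage is carried across a double
    point. In a slide or a flype this happens on both branches through that point at once. *)
Lemma inner_parity_move C P w w' b : move C P -> deforms P w w' ->
  inner_parity b w = inner_parity b w'.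
Proof.
move=> mP dP; suff [H e0] : (forall q, q \in P ->
  double_parity q.1 = double_parity q.2 /\
       forall b, inner_parity b q.1 (+) inner_parity b q.2 = parity_change q) /\
    \big[addb/false]_(q <- P) parity_change q = false.
  have := inner_parity_deforms b H dP; rewrite e0.
  by case: (inner_parity b w) (inner_parity b w') => [] [].
case: mP => [x d e _|x y d d' e _|x d|l x y d o|k x y z t f1 f2 f3|ov k x y z t f1 f2
  f3 _|x y d o e];
rewrite !unlock /=; (split; [move=> q; rewrite !inE|]).
- by move=> /eqP->; split=> // -[].
- by [].
- by move=> /eqP->; split=> // -[].
- by [].
- by move=> /eqP->; split=> // -[].
- by [].
- by case: l => [ov|] /orP[]/eqP->; case: (o); split=> // -[].
- by case: l => [ov|]; case: (o).
- by case/or3P=> /eqP->; case: f1; case: f2; case: f3; case: (k) => [?||];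
  split=> // -[].
- by case: f1; case: f2; case: f3; case: (k).
- by case/or3P=> /eqP->; case: f1; case: f2; case: f3; case: (k) => [?||];
  split=> // -[].
- by case: f1; case: f2; case: f3; case: (k).
- by case/orP=> /eqP->; case: (o); split=> // -[].
- by case: (o).
Qed.

Lemma inner_parity_flat C n (S S' : diagram n) : flat_equiv C S S' ->
  inner_parity false S = inner_parity false S'.
Proof.
elim=> // [T T' [[[f _ ->]|[P mP dP]]|[x [e dP]]]|T T' T'' _ -> _ ->] //.
- by elim: (code_of T) false => //= -[[c d] k] w IH b /=; rewrite -!IH.
- exact: inner_parity_move mP dP.
have H q : q \in crossing_change x e -> double_parity q.1 = double_parity q.2 /\
       forall b, inner_parity b q.1 (+) inner_parity b q.2 = parity_change q.
  by rewrite !inE => /orP[]/eqP->; split=> // -[].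
have := inner_parity_deforms false H dP; rewrite !unlock /=.
by case: (inner_parity _ _) (inner_parity _ _) => [] [].
Qed.

Lemma inner_parity_kink c d w : valid 0 w ->
  inner_parity false (kink c d Double ++ w) = false.
Proof.
move=> v; rewrite /=; have : forall l, l \in w -> l.2 != Double by move=> l;
  apply: valid0_not_double.
elim: w {v} => //= l w IH H; rewrite (negPf (H l (mem_head _ _))) IH // => l' lw.
by apply: H; rewrite inE lw orbT.
Qed.

(** * A singular knot with nonzero jump *)

Lemma planar_nil : planar [::].
Proof.
apply/(@colourableP [::] isT isT) => b g.
by exists (fun=> (false, false, false, false)), (false, b); split=> //=; rewrite eqxx.
Qed.

Lemma colourable_kink x b : colourable [:: (x, b); (x, ~~ b)].
Proof.
apply/colourableP; [by rewrite /= inE xpair_eqE eqxx;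
  case: b|by rewrite /flip_closed /= !inE !negbK !eqxx orbT|].
exact: (etrans (@planar_kink x b [::] [::] (fun b => erefl) (fun l h => h)) planar_nil).
Qed.

(* Its inner parity is odd, whereas that of a double kink is even. *)
Definition trefoil : code :=
  [:: ((0, false), Double); ((1, true), Classical true); ((2, false), Virtual);
      ((0, true), Double); ((1, false), Classical true); ((2, true), Virtual)]%N.

(** Its shadow with an additional kink [3] is the pulled configuration built on a curve whose only
    crossing is that kink; removing the kink keeps planarity. *)
Lemma valid_trefoil : valid 1 trefoil.
Proof.
apply/and3P; split=> //.
have H := @colourable_pulled true [::] [::] [::] 0 3 1 2 false true isT (fun n _ =>
  isT) (colourable_kink 3 true).
have /colourableP/= : colourable ([:: (0, false); (1, true); (2, false);
  (0, true)]%N ++ [:: (3, true); (3, false)]%N ++ [:: (1, false); (2, true)]%N) by [].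
move=> /(_ isT isT) h; apply: etrans (esym _) h.
apply: (@planar_kink 3 true [:: (0, false); (1, true); (2, false);
  (0, true)]%N [:: (1, false); (2, true)]%N).
  by case.
by apply/allP.
Qed.

Lemma gen_inj C (S S' : diagram 1) : gen C S = gen C S' -> flat_equiv C S S'.
Proof.
rewrite /gen => /(congr1 (coeff (\pi_(flat_class C)%qT S)));
  rewrite !coeffU eqxx !mul1r.
case: eqP => [/eqmodP/asboolP e _|_ /eqP //].
exact: rst_sym.
Qed.

Lemma flat_group_torsion_free C (x : flat_group C) : x *+ 2 = 0 -> x = 0.
Proof.
move=> e; apply/eqP/freeg_eqP => q; rewrite coeff0.
have := congr1 (coeff q) e; rewrite coeffMn coeff0 => /eqP.
by rewrite mulrn_eq0 /= => /eqP.
Qed.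

Lemma glueing_not_order_le0 C kpos : ~ order_le C (glueing C kpos) 0.
Proof.
case=> _ H.
suff [S nS] : exists S : diagram 1, half_jump C S != 0.
  have := H 1%N S isT; rewrite glueing_ext1 => /flat_group_torsion_free e.
  by rewrite e eqxx in nS.
exists (Diagram valid_trefoil); apply/eqP; rewrite /half_jump code_class_gen.
case: C {H} => [|]; last first.
  (* In the framed category the half jump is a single generator, with coefficient 1. *)
  rewrite subr0 => /(congr1 (coeff (\pi_(flat_class Framed)%qT (Diagram
    valid_trefoil)))).
  by rewrite coeffU coeff0 eqxx.
move/eqP; rewrite subr_eq0 /kink_class => /eqP.
set w := set_kind _ _ _; have vw : valid 0 w by apply: (valid_resolve true
  valid_trefoil).
have vk : valid 1 (kink (fresh w) false Double ++ w).
  by rewrite (@valid_double_kink _ false [::]) // fresh_names.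
rewrite (code_class_gen Unframed (Diagram vk)) => /gen_inj/inner_parity_flat /=.
by rewrite -[X in _ = X -> _]/(inner_parity false (kink (fresh w) false Double ++ w))
  inner_parity_kink.
Qed.

(** * Universality *)

Lemma wf_rest ns (w a r : code) : wf w -> perm_eq w (a ++ r) ->
  perm_eq (shadow a) (chords ns) -> wf r.
Proof.
move=> ww pw ea; have [_ off] := arcs_off ww pw ea.
have /andP[uw /allP cw] := ww; apply/andP; split.
  by move: uw; rewrite (perm_uniq (perm_map fst pw)) map_cat cat_uniq => /and3P[].
apply/allP=> l lr; have := cw l;
  rewrite !(perm_mem pw) !mem_cat lr orbT => /(_ isT)/orP[la|//].
have : l.1.1 \in ns by rewrite -(names_chords ea); apply: (map_f (fun l => l.1.1) la).
by move/off => /negP[]; apply: (map_f (fun l => l.1.1) lr).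
Qed.

Lemma perm_pair (T : eqType) (s : seq T) a b : perm_eq s [:: a; b] -> s = [:: a;
  b] \/ s = [:: b; a].
Proof.
move=> e; have := perm_size e; case: s e => [|x [|y [|]]] // e _.
have : x \in [:: a; b] by rewrite -(perm_mem e) mem_head.
rewrite !inE => /orP[]/eqP ex; subst x; [left|right]; congr (_ :: _);
  apply/perm_small_eq => //.
  by rewrite -(perm_cons a).
by rewrite -(perm_cons b); apply: perm_trans e _;
  exact/permPl/(perm_catC [:: a] [:: b]).
Qed.

(** The comparison of the two resolutions of a flype passes through the diagram without the bigon.
    It is not an end of the given move, so its planarity has to be established. *)
Lemma valid_bigon_removal n x y d o k k' (w : code) Q (u0 : code) us :
    let P : tangle_move := [:: ([:: ((x, d), k); ((y, ~~ d), k')], [::]);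
             (Defs.arc o ((x, ~~ d), k) ((y, d), k'), [::])] in
    perm_eq Q P -> size us = size Q ->
      w = u0 ++ flatten [seq z.1.1 ++ z.2 | z <- zip Q us] ->
    k != Double -> k' != Double ->
  valid n w -> valid n (u0 ++ flatten us).
Proof.
move=> P eQ s ew nk nk' v; have /and3P[ww pw /eqP nw] := v.
have pwr : perm_eq w (arcs_before P ++ u0 ++ flatten us).
  rewrite ew perm_sym perm_catCA perm_cat2l perm_sym.
  apply: perm_trans (perm_flatten_zip fst s) _; rewrite perm_cat2r.
  by apply: perm_flatten; apply: perm_map.
have ea : perm_eq (shadow (arcs_before P)) (chords [:: x; y]).
  by have := perm_R2_arcs None x y d o; rewrite /arcs_after /arcs_before /=; case: (o).
have [uns off] := arcs_off ww pwr ea.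
have wr := wf_rest ww pwr ea.
have xy : x != y by move: uns; rewrite /= inE andbT.
apply/and3P; split=> //; last first.
  rewrite -nw (ndouble_perm pwr) {2}/ndouble count_cat.
  by rewrite /arcs_before /=; case: (o); rewrite /= (negPf nk) (negPf nk') !andbF.
apply/(planarP wr).
have fr c : c \in [:: x; y] -> fresh_for c (shadow (u0 ++ flatten us)).
  by move=> /off; rewrite names_shadow.
move: s; rewrite (perm_size eQ);
  case: us ew fr {pwr off wr} => [|v1 [|v2 []]] //= ew fr _.
rewrite !cats0 in fr *.
(* The curve may meet the two arcs in either order. *)
have [o' {}ew] : exists o', w = fill o' u0 v1 v2 [:: ((x, d), k);
  ((y, ~~ d), k')] (Defs.arc o ((x, ~~ d), k) ((y, d), k')).
  move: ew; have [->|->] := perm_pair eQ; rewrite /= !cats0 => ->.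
    by exists true; rewrite /fill /= -?catA.
  by exists false; rewrite /fill /= -?catA.
have sE : shadow (u0 ++ v1 ++ v2) = shadow u0 ++ shadow v1 ++ shadow v2 by rewrite
  /shadow !map_cat.
rewrite sE in fr *; apply: (@colourable_bigon_removal o' _ _ _ x y d o xy).
- by apply: fr; rewrite !inE eqxx.
- by apply: fr; rewrite !inE eqxx orbT.
move/(planarP ww): pw; rewrite ew shadow_fill /=.
by case: (o).
Qed.

Lemma map_zip_before (f : nat * bool * kind ->
  nat * bool * kind) (Q : tangle_move) (u0 : code) us :
  size us = size Q -> (forall l, l \in u0 ++ flatten us -> f l = l) ->
  map f (u0 ++ flatten [seq z.1.1 ++ z.2 | z <- zip Q us]) =
  u0 ++ flatten [seq z.1.1 ++ z.2 | z <- zip [seq (map f q.1, q.2) | q <- Q] us].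
Proof.
move=> s H; rewrite map_cat map_flatten; congr (_ ++ flatten _).
  by rewrite -[RHS]map_id; apply/eq_in_map => l lu; apply: H; rewrite mem_cat lu.
have {}H l : l \in flatten us -> f l = l by move=> h; apply: H; rewrite mem_cat h orbT.
elim: Q us s H => [|q Q IH] [|u us] //= [s] H; rewrite map_cat IH //; last first.
  by move=> l lu; apply: H; rewrite mem_cat lu orbT.
congr ((_ ++ _) :: _); rewrite -[RHS]map_id; apply/eq_in_map => l lu.
by apply: H; rewrite mem_cat lu.
Qed.

Lemma zip_swap (Q : tangle_move) (us : seq code) :
  [seq z.1.2 ++ z.2 | z <- zip Q us] = [seq z.1.1 ++ z.2 | z <- zip [seq (q.2,
    q.1) | q <- Q] us].
Proof. by elim: Q us => [|q Q IH] [|u us] //=; rewrite IH. Qed.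

Lemma zip_nil (Q : tangle_move) (g : code * code ->
  code) (us : seq code) : size us = size Q ->
  flatten [seq z.1.1 ++ z.2 | z <- zip [seq ([::], g q) | q <- Q] us] = flatten us.
Proof. by elim: Q us => [|q Q IH] [|u us] //= [s]; rewrite IH. Qed.

(** * The derived invariant on flat classes of singular knots *)

Section Extension.
Variables (C : category) (A : zmodType) (V : diagram 0 -> A).
Hypothesis inv : knot_invariant C V.

Definition code_value (w : code) : A :=
  if insub w is Some K then V (K : diagram 0) else 0.

Lemma code_value_diagram (K : diagram 0) : code_value K = V K.
Proof. by rewrite /code_value valK. Qed.

Lemma code_value_ieq w w' : ieq C 0 w w' -> code_value w = code_value w'.
Proof. by case=> K [K' [<- <- h]]; rewrite !code_value_diagram; apply: inv. Qed.

Definition value_jump c (w : code) : A :=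
  code_value (set_kind c (Classical true) w) - code_value (set_kind c (Classical
    false) w).

Lemma singular_ext1 (S : diagram 1) c d : ((c, d), Double) \in code_of S ->
  singular_ext V S = value_jump c S.
Proof.
move=> cS; have hd := double_point1 (code_valid S) cS.
rewrite -[LHS]/(V (resolve S true) - V (resolve S false)) -!code_value_diagram.
by rewrite /= hd.
Qed.

Lemma valid_resolve_at w c d e : valid 1 w -> ((c, d), Double) \in w ->
  valid 0 (set_kind c (Classical e) w).
Proof. by move=> v cw; have := valid_resolve e v; rewrite (double_point1 v cw). Qed.

(** If the move stays legal when [c] is resolved in either way, both resolutions of [w] are isotopic
    to those of [w']. *)
Lemma value_jump_move P c w w' : move C P -> deforms P w w' -> valid 1 w ->
  valid 1 w' ->
    (forall e, move C (map_move (set_kind c (Classical e)) P)) ->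
    ((c, true), Double) \in w -> ((c, true), Double) \in w' ->
  value_jump c w = value_jump c w'.
Proof.
move=> mP dP v v' mc cw cw'; have E e : code_value (set_kind c (Classical e) w) =
  code_value (set_kind c (Classical e) w').
  apply: code_value_ieq.
  have dP' := deforms_map (set1_kind c (Classical e)) dP.
  by apply: (ieq_move (mc e) dP');
    [exact: valid_resolve_at v cw|exact: valid_resolve_at v' cw'].
by rewrite /value_jump !E.
Qed.

(* Both resolutions of the flype with the sign [e] agree; with the other sign both
   come from the diagram without the bigon by a second Reidemeister move. *)
Lemma value_jump_flype x y d o e w w' : deforms (flype_move x y d o e) w w' ->
  valid 1 w -> valid 1 w' -> value_jump x w = value_jump y w'.
Proof.
move=> dP v v'; have [Q [u0 [us [eQ s ew ew' [pw pw']]]]] := deforms_rest dP.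
have /and3P[ww _ _] := v; have [ea ea'] := perm_flype_arcs x y d o e.
have [uns off] := arcs_off ww pw ea.
have xy : x != y by move: uns; rewrite /= inE andbT.
have yx : y != x by rewrite eq_sym.
have xD : ((x, d), Double) \in w by rewrite (perm_mem pw) mem_cat inE eqxx.
have offr c k l : c \in [:: x; y] -> l \in u0 ++ flatten us -> set1_kind c k l = l.
  move=> cn lr; rewrite /set1_kind; case: eqP => // lc; case/negP: (off c cn).
  by rewrite -lc; apply: (map_f (fun l => l.1.1) lr).
have [xn yn] : x \in [:: x; y] /\ y \in [:: x; y] by rewrite !inE !eqxx orbT.
have wE k : set_kind x k w = u0 ++ flatten [seq z.1.1 ++ z.2 | z <- zip [seq (set_kind
  x k q.1, q.2) | q <- Q] us].
  by rewrite ew; apply: (map_zip_before s) => l; apply: offr.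
have wE' k : set_kind y k w' = u0 ++ flatten [seq z.1.1 ++ z.2 | z <- zip [seq
  (set_kind y k q.2, q.1) | q <- Q] us].
  rewrite ew' zip_swap set_kindE map_zip_before ?size_map //;
    first by rewrite -map_comp.
  by move=> l; apply: offr.
pose side kx ky : tangle_move := [:: ([:: ((x, d), kx); ((y, ~~ d), ky)], [::]);
             (Defs.arc o ((x, ~~ d), kx) ((y, d), ky), [::])].
have Qx k : perm_eq [seq (set_kind x k q.1,
  [::] : code) | q <- Q] (side k (Classical e)).
  apply: perm_trans (perm_map _ eQ) _.
  by rewrite /flype_move /side /set_kind /= !map_arc /= eqxx (negPf yx) perm_refl.
have Qy k : perm_eq [seq (set_kind y k q.2,
  [::] : code) | q <- Q] (side (Classical e) k).
  apply: perm_trans (perm_map _ eQ) _.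
  by rewrite /flype_move /side /set_kind /= !map_arc /= eqxx (negPf xy) perm_refl.
have Eq : set_kind x (Classical e) w = set_kind y (Classical e) w'.
  rewrite wE wE'; congr (_ ++ flatten _).
  have : forall q, q \in Q -> set_kind x (Classical e) q.1 = set_kind y (Classical e)
    q.2.
    move=> q; rewrite (perm_mem eQ) !inE => /orP[]/eqP->;
    by rewrite /flype_move /set_kind /= ?map_arc /= !eqxx (negPf xy) (negPf yx).
  elim: (Q) us s {ew ew' wE wE' pw pw' off offr} => [|q Q' IH] [|u us] //= [s] H.
  by rewrite H ?mem_head // IH // => q' q'Q; apply: H; rewrite inE q'Q orbT.
pose ne := Classical (~~ e).
pose r := u0 ++ flatten us.
have vx : valid 0 (set_kind x ne w) by apply: valid_resolve_at v xD.
have yD : ((y, ~~ d), Double) \in w'.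
  by rewrite (perm_mem pw') mem_cat /arcs_after /= !inE eqxx !orbT.
have vy : valid 0 (set_kind y ne w') by apply: valid_resolve_at v' yD.
have zipE (f : code * code -> code) (g : code * code -> code) :
    flatten [seq z.1.1 ++ z.2 | z <- zip [seq (f q, g q) | q <- Q] us] =
    flatten [seq z.1.1 ++ z.2 | z <- zip [seq (f q, [::] : code) | q <- Q] us].
  congr flatten; elim: (Q) (us) {Qx Qy eQ s ew ew' wE wE' Eq} =>
    [|q Q' IH] [|u us'] //=.
  by rewrite IH.
have vr : valid 0 r.
  have sz : size us = size [seq (set_kind x ne q.1,
    [::] : code) | q <- Q] by rewrite size_map.
  apply: (valid_bigon_removal (Qx ne) sz _ _ _ vx) => //.
  by rewrite wE zipE.
(* With opposite signs the bigon arises by a second Reidemeister move; the layer [d == kx] is the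
   one for which [pass_kind] returns the sign [kx] at a passage with bit [d]. *)
have toR (kx ky : bool) (f : code * code -> code) W : ky = ~~ kx ->
    perm_eq [seq (f q, [::] : code) | q <- Q] (side (Classical kx) (Classical ky)) ->
    W = u0 ++ flatten [seq z.1.1 ++ z.2 | z <- zip [seq (f q,
      [::] : code) | q <- Q] us] ->
    valid 0 W -> code_value W = code_value r.
  move=> eky pf eW vW; apply: esym; apply: code_value_ieq.
  apply: (ieq_move (R2 C (Some (d == kx)) x y d o) _ vr vW).
  exists [seq ([::] : code, f q) | q <- Q], u0, us; split.
  - have := perm_map (fun p : code * code => ([::] : code, p.1)) pf.
    rewrite -map_comp /= /side /R2_move /= eky.
    by case: (d); case: (kx).
  - by rewrite size_map.
  - by rewrite zip_nil.
  rewrite eW zip_swap; congr (_ ++ flatten _).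
  by rewrite -[in RHS]map_comp.
have X : code_value (set_kind x ne w) = code_value r.
  apply: (toR (~~ e) e _ _ (esym (negbK e)) (Qx ne) _ vx).
  by rewrite wE (zipE (fun q => set_kind x ne q.1) snd).
have Y : code_value (set_kind y ne w') = code_value r.
  by apply: (toR e (~~ e) _ _ erefl (Qy ne) _ vy);
    rewrite wE' (zipE (fun q => set_kind y ne q.2) fst).
rewrite /value_jump; move: Eq X Y; rewrite /ne; case: (e) => /= -> -> ->; by [].
Qed.

(** The crossings [y] and [z] get their kinds from [pass_kind], which never produces a double
    point. *)
Lemma double_kind_slide w l k x y z t f1 f2 f3 c : valid 1 w ->
    perm_eq (shadow (arcs_before (slide_move l k x y z t f1 f2 f3))) (chords [:: x;
      y; z]) ->
    {subset arcs_before (slide_move l k x y z t f1 f2 f3) <= w} ->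
    ((c, true), Double) \in w -> c \in [:: x; y; z] -> c = x /\ k = Double.
Proof.
move=> v e1 sub cw cn; have /and3P[ww _ _] := v.
have [hx hy hz] := mem_slide_arcs l k x y z t f1 f2 f3.
move: cn; rewrite !inE => /or3P[]/eqP ec; subst c.
- by split=> //; have := wf_kindP ww cw (sub _ hx) erefl.
- by have := wf_kindP ww cw (sub _ hy) erefl; rewrite /=; case: (l).
- by have := wf_kindP ww cw (sub _ hz) erefl; rewrite /=; case: (l).
Qed.

(** A double point outside the disc is resolved without disturbing the move; the vertex of a slide
    is resolved into the vertex of a slide past a classical crossing. The flype alone carries the
    double point to another name, hence the two names [c] and [c']. *)
Lemma value_jump_knot_move P c c' w w' : move C P -> deforms P w w' -> valid 1 w ->
  valid 1 w' ->
    ((c, true), Double) \in w -> ((c', true), Double) \in w' ->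
  value_jump c w = value_jump c' w'.
Proof.
move=> mP dP v v' cw cw'.
have [Q [u0 [us [eQ s ew ew' [pw pw']]]]] := deforms_rest dP.
have /and3P[ww _ _] := v; have /and3P[ww' _ _] := v'.
have uniq_double W a b d : valid 1 W -> ((a, d), Double) \in W ->
  ((b, true), Double) \in W -> a = b.
  by move=> vW aW bW; have := double_point1 vW aW; rewrite (double_point1 vW bW) => -[].
have outside : (forall l, l \in arcs_before P ++ arcs_after P ->
  set1_kind c (Classical true) l = l /\ set1_kind c (Classical false) l = l) ->
   ((c, true), Double) \in w' -> value_jump c w = value_jump c' w'.
  move=> H cw1; rewrite -(uniq_double _ _ _ _ v' cw1 cw').
  apply: (value_jump_move mP dP v v' _ cw cw1) => e.
  by rewrite map_move_off // => l /H[]; case: e.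
have off_ns ns : perm_eq (shadow (arcs_after P)) (chords ns) ->
    (arcs_before P = [::] \/ perm_eq (shadow (arcs_before P)) (chords ns)) ->
      c \notin ns ->
    forall l, l \in arcs_before P ++ arcs_after P ->
      set1_kind c (Classical true) l = l /\ set1_kind c (Classical false) l = l.
  move=> ea eb cn l lP; rewrite /set1_kind; case: eqP => // lc.
  case/negP: cn; rewrite -lc; move: lP; rewrite mem_cat => /orP[la|la]; last first.
    by rewrite -(names_chords ea); apply: (map_f (fun l => l.1.1) la).
  case: eb => [e0|eb]; first by rewrite e0 in la.
  by rewrite -(names_chords eb); apply: (map_f (fun l => l.1.1) la).
have insertion : arcs_before P = [::] -> value_jump c w = value_jump c' w'.
  move=> b0; have [ns [ea eb]] := move_chords mP.
  have [uns off] := arcs_off ww' pw' ea.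
  have cr : ((c, true), Double) \in u0 ++ flatten us by rewrite (perm_mem pw) b0 in cw.
  apply: outside; last by rewrite (perm_mem pw') mem_cat cr orbT.
  apply: (off_ns _ ea eb); apply/negP => /off /negP[].
  exact: (map_f (fun l => l.1.1) cr).
have slide l k x y z t f1 f2 f3 : P = slide_move l k x y z t f1 f2 f3 ->
    (forall e, move C (slide_move l (Classical e) x y z t f1 f2 f3)) ->
    value_jump c w = value_jump c' w'.
  move=> eP mE; have [e1 e2] := perm_slide_arcs l k x y z t f1 f2 f3;
    rewrite -eP in e1 e2.
  have cw1 : ((c, true), Double) \in w'.
    by rewrite (perm_mem pw') mem_cat (perm_mem e2) -mem_cat -(perm_mem pw).
  have [uns off] := arcs_off ww pw e1.
  have [cn|cn] := boolP (c \in [:: x; y; z]); last first.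
    by apply: (outside _ cw1); apply: (off_ns _ _ _ cn);
      [apply: perm_trans (perm_map fst e2) e1|right].
  have [ec ek] : c = x /\ k = Double.
    apply: (@double_kind_slide w l k x y z t f1 f2 f3 c v) => //; rewrite -eP //.
    by move=> a h; rewrite (perm_mem pw) mem_cat h.
  rewrite -(uniq_double _ _ _ _ v' cw1 cw').
  apply: (value_jump_move mP dP v v' _ cw cw1) => e.
  move: uns; rewrite /= !inE !negb_or andbT => /andP[/andP[xy xz] yz].
  have yx : y != x by rewrite eq_sym.
  have zx : z != x by rewrite eq_sym.
  rewrite eP ec; have := mE e; congr move.
  by rewrite /slide_move /map_move /set_kind /= !map_arc /= !eqxx (negPf yx) (negPf zx).
case: mP dP pw pw' insertion slide {eQ off_ns outside} =>
  [x d e eC|x y d d' e eC|x d|l x y d o|k x y z t f1 f2 f3|ov k x y z t f1 f2 f3 nk|x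
  y d o e] dP pw pw' insertion slide.
- exact: insertion.
- exact: insertion.
- exact: insertion.
- exact: insertion.
- by apply: slide erefl _ => e; apply: R3_virtual.
- by apply: slide erefl _ => e; apply: R3_classical.
have xD : ((x, d), Double) \in w by rewrite (perm_mem pw) mem_cat inE eqxx.
have yD : ((y, ~~ d), Double) \in w'.
  by rewrite (perm_mem pw') mem_cat /arcs_after /= !inE eqxx !orbT.
rewrite -(uniq_double _ _ _ _ v xD cw) -(uniq_double _ _ _ _ v' yD cw').
exact: value_jump_flype dP v v'.
Qed.

Lemma value_jump_rename c f w : injective f -> valid 1 w -> valid 1 (rename f w) ->
  ((c, true), Double) \in w -> value_jump (f c) (rename f w) = value_jump c w.
Proof.
move=> fi v v' cw; have cw' : ((f c, true), Double) \in rename f w.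
  by apply/mapP; exists ((c, true), Double).
have E e : code_value (set_kind (f c) (Classical e) (rename f w)) = code_value
  (set_kind c (Classical e) w).
  have v1 := valid_resolve_at e v cw; have v2 := valid_resolve_at e v' cw'.
  rewrite set_kind_rename // in v2 *; apply: code_value_ieq; apply: code_rel_sym.
  exact: ieq_rename.
by rewrite /value_jump !E.
Qed.

Lemma deforms_crossing_change x e w w' : deforms (crossing_change x e) w w' -> wf w ->
  w' = set_kind x (Classical (~~ e)) w /\ ((x, true), Classical e) \in w.
Proof.
move=> dP ww; have [Q [u0 [us [eQ s ew ew' [pw pw']]]]] := deforms_rest dP.
have ea : perm_eq (shadow (arcs_before (crossing_change x e))) (chords [:: x]) by [].
have [_ off] := arcs_off ww pw ea; split; last by rewrite (perm_mem pw) inE eqxx.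
have offr l : l \in u0 ++ flatten us -> set1_kind x (Classical (~~ e)) l = l.
  move=> lr; rewrite /set1_kind; case: eqP => // lc; case/negP: (off x (mem_head _ _)).
  by rewrite -lc; apply: (map_f (fun l => l.1.1) lr).
rewrite ew ew' set_kindE (map_zip_before s offr); congr (_ ++ flatten _).
have : forall q, q \in Q -> q.2 = map (set1_kind x (Classical (~~ e))) q.1.
  by move=> q; rewrite (perm_mem eQ) !inE => /orP[]/eqP->; rewrite /= /set1_kind eqxx.
elim: (Q) us s {eQ ew ew' pw pw' off offr dP} => [|q Q' IH] [|u us] //= [s] H.
by rewrite H ?mem_head // IH // => q' q'Q; apply: H; rewrite inE q'Q orbT.
Qed.

(** Renamings and moves need only the invariance of [V]; the order is used for a crossing change at
    [x]. Making [x] double as well, the vanishing of the second difference says that the jump at [c]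
    does not depend on the sign of [x]. *)
Lemma singular_ext_flat (S S' : diagram 1) : order_le C V 1 -> flat_equiv C S S' ->
  singular_ext V S = singular_ext V S'.
Proof.
move=> [_ ord]; elim=> // [T T' sT|T T' T'' _ -> _ ->] //.
have v := code_valid T; have v' := code_valid T'.
have cT := head_double_point v; have cT' := head_double_point v'.
rewrite (singular_ext1 cT) (singular_ext1 cT').
move: cT cT'; set c := head _ _; set c' := head _ _ => cT cT'.
case: sT => [[[f fi e]|[P mP dP]]|[x [e dP]]].
- have fcT : ((f c, true), Double) \in code_of T'.
    by rewrite e; apply/mapP; exists ((c, true), Double).
  have <- : f c = c' by have := double_point1 v' fcT;
    rewrite (double_point1 v' cT') => -[].
  by rewrite e in v' *; rewrite value_jump_rename.
- exact: value_jump_knot_move mP dP v v' cT cT'.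
have /and3P[ww _ _] := v.
have [eT xT] := deforms_crossing_change dP ww.
have xc : x != c.
  by apply/eqP=> ex; rewrite ex in xT; have := wf_kindP ww cT xT erefl.
have cx : c != x by rewrite eq_sym.
have <- : c = c'.
  have : ((c, true), Double) \in code_of T'.
    by rewrite eT; apply/mapP; exists ((c, true), Double); rewrite //= (negPf cx).
  by move=> h; have := double_point1 v' h; rewrite (double_point1 v' cT') => -[].
have xcr : x \in classical_crossings T by apply/classical_crossingsP; exists e.
pose D := Diagram (valid_glue v xcr).
have := ord 2%N D isT.
pose val a b := code_value (set_kind c (Classical a) (set_kind x (Classical b)
  (code_of T))).
rewrite -[singular_ext V D]/(singular_ext _ (resolve D true) - singular_ext _ (resolve
  D false)).
have vD e' := code_valid (resolve D e').
have Dd e' : code_of (resolve D e') = set_kind (head 0%N (double_points (set_kind x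
  Double T))) (Classical e') (set_kind x Double T) by [].
have wD : wf (set_kind x Double T) by rewrite wf_set_kind.
have := head_double_point (valid_glue v xcr); move: Dd; set h := head _ _ => Dd.
have TE e' : value_jump c (set_kind x (Classical e') T) = val true e' - val false e'
  by [].
have idT : set_kind x (Classical e) T = T by rewrite (set_kind_id ww xT).
have -> : value_jump c T = val true e - val false e by rewrite -TE idT.
move=> hD key; rewrite eT TE.
(* The extension resolves first the head of the list of double points, [x] or [c]. Both cases lead
   to the same alternating sum of the four values [val a b]. *)
have [eh|nh] := eqVneq h x.
  have cD e' : ((c, true), Double) \in code_of (resolve D e').
    by rewrite Dd eh set_kindK; apply/mapP; exists ((c, true), Double);
      rewrite //= (negPf cx).
  have J e' : singular_ext V (resolve D e') = val true e' - val false e'.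
    by rewrite (singular_ext1 (cD e')) Dd eh set_kindK TE.
  move: key; rewrite !J => /eqP; rewrite subr_eq0 => /eqP.
  by case: (e) => /= [->|<-].
have eh : h = c.
  move: hD; case/mapP=> -[[a b] k] aT /=; case: eqP => [ea [e1]|na [e1 e2 e3]].
    by case: nh; rewrite e1 ea eqxx.
  rewrite -e1 -e2 -e3 in aT.
  by have := double_point1 v aT; rewrite (double_point1 v cT) => -[].
have xD e' : ((x, true), Double) \in code_of (resolve D e').
  rewrite Dd eh set_kindC //; apply/mapP; exists ((x, true), Classical e);
    rewrite /= ?eqxx //.
  by apply/mapP; exists ((x, true), Classical e); rewrite //= (negPf xc).
have J e' : singular_ext V (resolve D e') = val e' true - val e' false.
  rewrite (singular_ext1 (xD e')) Dd eh /value_jump /val.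
  by rewrite !(@set_kindC x c _ (Classical e')) // !set_kindK.
move: key; rewrite !J opprB => key.
have {}key : val true true - val false true = val true false - val false false.
  apply/eqP; rewrite -subr_eq0 -key opprB; apply/eqP.
  by rewrite addrACA [in RHS]addrACA; congr (_ + _); rewrite addrC.
by case: (e) => /=; rewrite key.
Qed.
End Extension.

(** A class is evaluated on a chosen representative; [ext_hom_gen] shows that for order at most one
    any other gives the same value. *)
Definition ext_hom C (A : zmodType) (V : diagram 0 -> A) : flat_group C -> A :=
  fglift (fun q : flat_class C => singular_ext V (repr q)%qT : zmodule A).

Lemma ext_hom_additive C (A : zmodType) (V : diagram 0 ->
  A) : zmod_morphism (@ext_hom C A V).
Proof. move=> x y. exact: (lift_is_additive (fun q : flat_class C =>
  singular_ext V (repr q)%qT : zmodule A) x y). Qed.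

HB.instance Definition _ C (A : zmodType) (V : diagram 0 -> A) :=
  GRing.isZmodMorphism.Build (flat_group C) A (@ext_hom C A V) (@ext_hom_additive C A
    V).

Section Universality.
Variables (C : category) (A : zmodType) (V : diagram 0 -> A).
Hypothesis ordV : order_le C V 1.
Let inv : knot_invariant C V := proj1 ordV.

Lemma ext_hom_gen S : ext_hom V (gen C S) = singular_ext V S.
Proof.
rewrite /ext_hom /gen liftU scale1r; apply: (singular_ext_flat inv) ordV _.
have e : (repr (\pi_(flat_class C) S) = S %[mod flat_class C])%qT by rewrite reprK.
by move/eqmodP: e => /asboolP.
Qed.

Lemma kink_class_vanish w : C = Unframed -> valid 0 w -> ext_hom V (kink_class C w) = 0.
Proof.
move=> eC v; rewrite /kink_class; set c := fresh w.
have vk : valid 1 (kink c false Double ++ w) by rewrite (@valid_double_kink _ false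
  [::]) // fresh_names.
rewrite (code_class_gen C (Diagram vk)) ext_hom_gen.
have cD : ((c, false), Double) \in code_of (Diagram vk) by apply: mem_head.
rewrite (singular_ext1 _ cD) [code_of _]/=.
have E e : code_value V (set_kind c (Classical e) (kink c false Double ++ w)) =
  code_value V w.
  have -> : set_kind c (Classical e) (kink c false Double ++ w) = kink c false
    (Classical e) ++ w.
    by rewrite set_kind_cat (set_kind_off _ (fresh_names w)) /set_kind /= eqxx.
  apply: (code_value_ieq inv); apply: code_rel_sym.
  apply: (ieq_move (P := [:: ([::], kink c false (Classical e))])) => //.
  - exact: R1_classical.
  - by apply: (@deforms_context _ [:: inl ([::], kink c false (Classical e))] [::] w).
  by rewrite (@valid_crossing_kink 0 c false (Classical e) [::]) // fresh_names.
by rewrite /value_jump !E subrr.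
Qed.

Lemma ext_hom_half_jump (S : diagram 1) : ext_hom V (half_jump C S) = singular_ext V S.
Proof.
rewrite /half_jump raddfB /= code_class_gen ext_hom_gen -[RHS]subr0; congr (_ - _).
have := @kink_class_vanish (code_of (resolve S true)).
case: C => [H|_]; last by rewrite raddf0.
by apply: H => //; apply: (code_valid (resolve S true)).
Qed.

Lemma homotopic_half kpos (K K0 : diagram 0) : homotopic C K K0 ->
  exists x : flat_group C, x *+ 2 = glueing C kpos K - glueing C kpos K0
    /\ V K = V K0 + ext_hom V x.
Proof.
elim=> [T T' [sT|[x [e dP]]]|T|T T' _ [x [ex vx]]|T T' T'' _ [x [ex vx]] _ [y [ey vy]]].
- exists 0; rewrite mul0rn raddf0 addr0.
  have iT : isotopic C T T' by apply: rst_step.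
  by rewrite (inv iT) (glueing_invariant kpos iT) subrr.
- have v := code_valid T; have /and3P[ww _ _] := v.
  have [eT xT] := deforms_crossing_change dP ww.
  have xcr : x \in classical_crossings T by apply/classical_crossingsP; exists e.
  pose D := Diagram (valid_glue v xcr).
  have xD : ((x, true), Double) \in code_of D.
    by apply/mapP; exists ((x, true), Classical e); rewrite //= eqxx.
  have R e' : code_of (resolve D e') = set_kind x (Classical e') T.
    by rewrite /= (double_point1 (valid_glue v xcr) xD) /= set_kindK.
  have Re : resolve D e = T by apply: val_inj; apply: etrans (R e) _;
    apply: set_kind_id ww xT.
  have Rne : resolve D (~~ e) = T' by apply: val_inj; apply: etrans (R (~~ e)) _;
    rewrite -eT.
  have jG := glueing_ext1 C kpos D; have jV := ext_hom_half_jump D.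
  rewrite -[LHS]/(glueing C kpos (resolve D true) - glueing C kpos (resolve D false))
    in jG.
  rewrite -[RHS]/(V (resolve D true) - V (resolve D false)) in jV.
  (* The half jump is taken with the sign of the change: for [e] true the step goes from the
     positive resolution of [D] to the negative one, otherwise the other way. *)
  case: e Re Rne {dP eT xT R} => Re Rne; rewrite Re Rne in jG jV.
    by exists (half_jump C D); rewrite jG jV addrC subrK.
  exists (- half_jump C D); rewrite mulNrn -jG opprB raddfN /= jV opprB.
  by split=> //; rewrite addrC subrK.
- by exists 0; rewrite mul0rn raddf0 addr0 subrr.
- exists (- x); rewrite mulNrn ex opprB; split=> //.
  by rewrite raddfN /= vx addrK.
exists (x + y); rewrite mulrnDl ex ey addrA subrK; split=> //.
by rewrite raddfD /= vx vy -addrA [ext_hom V y + _]addrC.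
Qed.
End Universality.

Theorem theorem16 (C : category) (kpos : diagram 0 -> nat * bool) :
  let G := glueing C kpos in
  [/\ knot_invariant C G,
      order_one C G
    & forall (A : zmodType) (V : diagram 0 -> A), order_le C V 1 ->
      exists V1 : {additive flat_group C -> A},
        (forall S : diagram 1, V1 (gen C S) = singular_ext V S) /\
        forall K K0 : diagram 0, homotopic C K K0 ->
          exists x : flat_group C,
            [/\ x *+ 2 = G K - G K0,
                forall y : flat_group C, y *+ 2 = G K - G K0 -> y = x
              & V K = V K0 + V1 x]].
Proof.
move=> G; split; first exact: glueing_invariant.
  by split; [apply: glueing_order_le1|apply: glueing_not_order_le0].
move=> A V ordV; exists (ext_hom V); split; first exact: ext_hom_gen.
move=> K K0 h; have [x [ex vx]] := homotopic_half ordV kpos h.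
(* Two halves of the same element differ by an element killed by 2. *)
exists x; split=> // y ey; apply/eqP; rewrite -subr_eq0; apply/eqP.
by apply: flat_group_torsion_free; rewrite mulrnBl ey ex subrr.
Qed.
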